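(* Let $S_i(t)=r_it+B_i(t)$, $i=1,\dots,d$, where $r_i\in\mathbb R$ and $\boldsymbol B=(B_1,\dots,B_d)^\top$ is a $d$-dimensional Brownian motion with zero drift and $\mathbb E[\boldsymbol B(t)\boldsymbol B(t)^\top]=\boldsymbol\Sigma t$, $\boldsymbol\Sigma=(\sigma_{i,j}^2)_{i,j}$. Put $S=\sum_{i=1}^d S_i$, $r=\sum_{i=1}^d r_i$ and $\sigma^2=\sum_{i,j=1}^d\sigma_{i,j}^2$, assumed strictly positive. Let $0<T<\infty$ and $u>0$. Then for every $i\in\{1,\dots,d\}$ the allocation $\overline K_i(u,S,T)$ satisfies $$\overline K_i(u,S,T)=\mathbb E[S_i(t_T^* )\mid S(t_T^* )=u]=\mathbb E[t_T^*\mid S(t_T^* )=u]\left(r_i-\frac{\sum_{j=1}^d\sigma_{i,j}^2}{\sigma^2}\,r\right)+\frac{\sum_{j=1}^d\sigma_{i,j}^2}{\sigma^2}\,u,$$ where $$\mathbb E[t_T^*\mid S(t_T^* )=u]=u\left(-r+\frac{\sigma\, e^{-\frac{(u+rT)^2}{2\sigma^2T}}}{\sqrt{2\pi T}\;\Phi\left(\frac{-u-rT}{\sigma\sqrt T}\right)}\right)^{-1}.$$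
   Context: $d\ge2$. The symbol $\sigma_{i,j}^2$ denotes the $(i,j)$ entry of the covariance matrix $\boldsymbol\Sigma$, with $\sigma_{i,j}^2=\sigma_{j,i}^2=\rho_{i,j}\sigma_{i,i}\sigma_{j,j}$ for correlations $\rho_{i,j}\in[-1,1]$ (so it may be negative for $i\ne j$). $\sigma=\sqrt{\sigma^2}>0$. $\Phi$ is the standard normal distribution function. $t_T^*$ is the first time in $[0,T]$ at which $S$ attains its supremum over $[0,T]$, i.e. $t_T^*=\min\{t\in[0,T]:S(t)=\sup_{s\in[0,T]}S(s)\}$ (it is set to $\infty$ if this set is empty), so $S(t_T^* )=\max_{[0,T]}S$. The allocation is defined by $\overline K_i(u,S,T)=\mathbb E[S_i(t_T^* )\mid S(t_T^* )=u,\ t_T^*\le T]$. Conditional expectations given $S(t_T^* )=u$ are those given by conditional densities (the versions continuous in $u>0$). *)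

(* Defs.v *)
(* MathComp / MathComp-Analysis *)
From mathcomp Require Import all_boot all_order all_algebra.
From mathcomp Require Import all_classical all_reals all_analysis.
Set Implicit Arguments.
Unset Strict Implicit.
Unset Printing Implicit Defensive.
Import Order.TTheory GRing.Theory Num.Theory.
Import numFieldNormedType.Exports.
Local Open Scope classical_set_scope.
Local Open Scope ring_scope.

(* [v] is the variance. The case [v = 0] is separate because [normal_prob m 0]
   is the uniform distribution on [0, 1], not the point mass at [m]. *)
Definition normal_law (R : realType) (m v : R) (A : set R) : \bar R :=
  if v == 0 then \d_m A else normal_prob m (Num.sqrt v) A.

Definition Phi (R : realType) (x : R) : R := fine (normal_prob 0 1 `]-oo, x]).

Definition quad_form (R : realType) (d : nat) (C : 'M[R]_d) (a : 'rV[R]_d) : R :=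
  (a *m C *m a^T) 0 0.

Definition covariance_mx (R : realType) (d : nat) (C : 'M[R]_d) : Prop :=
  C^T = C /\ forall a : 'rV[R]_d, 0 <= quad_form C a.

(* The law N(0, C) on R^d, possibly degenerate: every linear combination of
   the coordinates is a univariate normal variable. *)
Definition centered_gaussian (R : realType) (dO : measure_display)
    (Omega : measurableType dO) (P : probability Omega R) (d : nat)
    (X : 'I_d -> Omega -> R) (C : 'M[R]_d) : Prop :=
  covariance_mx C /\
  forall (a : 'rV[R]_d) (A : set R), measurable A ->
    P ((fun w => \sum_(i < d) a 0 i * X i w) @^-1` A) =
    normal_law 0 (quad_form C a) A.

(* Each sigma-algebra contains the whole space, so that the product rule for
   the full family of increments includes the one for every subfamily. *)
Definition independent_increments (R : realType) (dO : measure_display)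
    (Omega : measurableType dO) (P : probability Omega R) (d : nat)
    (B : 'I_d -> R -> Omega -> R) : Prop :=
  forall (n : nat) (t : nat -> R) (E : 'I_n -> set Omega),
    0 <= t 0%N -> {homo t : k l / (k <= l)%N >-> k <= l} ->
    (forall k : 'I_n,
      g_sigma_preimage (fun i : 'I_d => B i (t k.+1) \- B i (t k)) (E k)) ->
    P (\bigcap_(k in [set: 'I_n]) E k) = (\prod_(k < n) P (E k))%E.

(* [B i t w] is used for [0 <= t] only. *)
Definition brownian_motion (R : realType) (dO : measure_display)
    (Omega : measurableType dO) (P : probability Omega R) (d : nat)
    (Sigma : 'M[R]_d) (B : 'I_d -> R -> Omega -> R) : Prop :=
  [/\ forall (i : 'I_d) (t : R), 0 <= t -> measurable_fun setT (B i t),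
      {ae P, forall w, forall i : 'I_d, B i 0 w = 0},
      forall (i : 'I_d) (w : Omega),
        {within `[0, +oo[, continuous (fun t : R => B i t w)},
      independent_increments P B &
      forall s t : R, 0 <= s -> s <= t ->
        centered_gaussian P (fun i => B i t \- B i s) ((t - s) *: Sigma)].

Definition drifted (R : realType) (Omega : Type) (d : nat) (r : 'I_d -> R)
    (B : 'I_d -> R -> Omega -> R) (i : 'I_d) (t : R) (w : Omega) : R :=
  r i * t + B i t w.

Definition aggregate (R : realType) (Omega : Type) (d : nat)
    (Si : 'I_d -> R -> Omega -> R) (t : R) (w : Omega) : R :=
  \sum_(i < d) Si i t w.

(* The infimum of the empty set is [+oo]; for a continuous path the set is
   nonempty and closed, and its infimum is a minimum. *)
Definition argmax_time (R : realType) (Omega : Type) (S : R -> Omega -> R)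
    (T : R) (w : Omega) : \bar R :=
  ereal_inf [set t%:E | t in [set t : R | 0 <= t <= T /\
    (S t w)%:E = ereal_sup [set (S s w)%:E | s in `[0, T]]]].

Definition at_time (R : realType) (Omega : Type) (X : R -> Omega -> R)
    (tau : Omega -> \bar R) (w : Omega) : R :=
  X (fine (tau w)) w.

(* [k] is a version, continuous on ]0, +oo[, of y |-> E[X | Y = y, E]: the
   defining identity of the conditional expectation with respect to P( . | E),
   both sides being multiplied by P(E). *)
Definition condE_version (R : realType) (dO : measure_display)
    (Omega : measurableType dO) (P : probability Omega R) (E : set Omega)
    (X Y : Omega -> R) (k : R -> R) : Prop :=
  [/\ P.-integrable E (EFin \o X),
      {within `]0, +oo[, continuous k} &
      forall A : set R, measurable A -> A `<=` `]0, +oo[ ->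
        (\int[P]_(w in E `&` Y @^-1` A) (X w)%:E =
         \int[P]_(w in E `&` Y @^-1` A) (k (Y w))%:E)%E].

Definition condE_defined (R : realType) (dO : measure_display)
    (Omega : measurableType dO) (P : probability Omega R) (E : set Omega)
    (X Y : Omega -> R) : Prop :=
  (exists k : R -> R, condE_version P E X Y k) /\
  (forall k1 k2 : R -> R, condE_version P E X Y k1 -> condE_version P E X Y k2 ->
     forall y : R, 0 < y -> k1 y = k2 y).

(* E[X | Y = u, E] for [0 < u]; meaningful under [condE_defined P E X Y]. *)
Definition condE (R : realType) (dO : measure_display)
    (Omega : measurableType dO) (P : probability Omega R) (E : set Omega)
    (X Y : Omega -> R) (u : R) : R :=
  xget (fun=> 0) [set k : R -> R | condE_version P E X Y k] u.

Definition attained_by (R : realType) (Omega : Type) (tau : Omega -> \bar R)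
    (T : R) : set Omega :=
  [set w | (tau w <= T%:E)%E].

Definition allocation (R : realType) (dO : measure_display)
    (Omega : measurableType dO) (P : probability Omega R) (d : nat)
    (Si : 'I_d -> R -> Omega -> R) (T u : R) (i : 'I_d) : R :=
  let S := aggregate Si in
  let tstar := argmax_time S T in
  condE P (attained_by tstar T) (at_time (Si i) tstar) (at_time S tstar) u.

(* Main.v *)
Require Import Defs.
From HB Require Import structures.
From mathcomp Require Import all_boot all_order all_algebra.
From mathcomp Require Import all_classical all_reals all_analysis.
From mathcomp Require Import measurable_realfun ring lra.
Set Implicit Arguments.
Unset Strict Implicit.
Unset Printing Implicit Defensive.
Import Order.TTheory GRing.Theory Num.Theory.
Import numFieldNormedType.Exports.
Local Open Scope classical_set_scope.
Local Open Scope ring_scope.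

(* Let X be the aggregate process started at 0, M its maximum over [0, T] and t*
   its first maximizer; W is the Brownian part of X, v its variance, and
   f(u) = - d/du P(M > u). The law of M comes from the reflection principle.
   For K the clipping to [a, b] and any process V,
   max (X + e V) >= M + e V(t* ), with equality at e = 0, so that the derivatives
   at e = 0 of the expectations of K of both sides agree:
     E[V(t* ); a < M <= b] = d/de E[K(max (X + e V))] at e = 0.
   - V(t) = t perturbs the drift of X: the right-hand side is the integral over
     [a, b] of the derivative of P(M > u) in the drift, and its quotient by f is
     E[t* | M = u].
   - V = Z := B_i - beta W is uncorrelated with W: rotating W towards Z leaves
     the law of the maximum unchanged, so E[Z(t* ) | M = u] = 0.
   The allocation then follows from
   S_i(t* ) = (r_i - beta r) t* + beta M + Z(t* ). *)

(** The joint law of t* and M is never computed, and no conditional expectation given the path is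
    formed. Reflection is carried out on finite grids, at the first grid time where the path is at
    least u, with overshoot below e. The tilt depends on the drift and the variance only through c =
    2 mu / v, whatever the remaining time, so the past enters only through the position, which is u
    up to e; e tends to 0 after the mesh. The obstacle is that f must be positive on ]0, +oo[, for
    the quotient and for the uniqueness of continuous versions, which its formula does not show.
    Positivity is drawn from probability: once the closed formula is known to be a tail, it is
    nonincreasing, and this forces f > 0. The same fact gives Mills' inequality, hence the
    integrability of the maxima and of Z at t*. K is bounded and 1-Lipschitz: its expectations are
    integrals of tails over [a, b], and the difference quotients are dominated. Each touching
    argument gives one inequality; the opposite perturbation gives the other. Identities on
    intervals ]a, b] then extend to Borel subsets of ]0, +oo[ by uniqueness of measures. *)

Section Density.
Local Open Scope ereal_scope.
Import HBNNSimple.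

(** Monotone convergence along the simple functions [h n] reduces the identity to level sets, where
    it is the assumption on [nu]. That assumption concerns subsets of [D]: the law of the maximum
    has a known density on ]0, +oo[ only. *)
Lemma ge0_integral_density d (T : measurableType d) (R : realType)
    (mu nu : {measure set T -> \bar R}) (g : T -> R) (D : set T)
    (f : T -> \bar R) :
  measurable D -> measurable_fun D g -> (forall x, D x -> 0 <= g x)%R ->
  (forall A, measurable A -> A `<=` D -> nu A = \int[mu]_(x in A) (g x)%:E) ->
  measurable_fun D f -> (forall x, D x -> 0 <= f x) ->
  \int[nu]_(x in D) f x = \int[mu]_(x in D) (f x * (g x)%:E).
Proof.
move=> mD mg g0 nuE mf f0.
have mG : measurable_fun D (EFin \o g) by exact/measurable_EFinP.
pose h := nnsfun_approx mD mf.
have -> : \int[nu]_(x in D) f x =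
    lim (\int[nu]_(x in D) (EFin \o h n) x @[n --> \oo]).
  have fE x : D x -> f x = lim ((EFin \o h n) x @[n --> \oo]).
    by move=> Dx; apply/esym/cvg_lim => //; exact: cvg_nnsfun_approx.
  under eq_integral => x /[!inE] /fE -> //.
  apply: monotone_convergence => //.
  - move=> n; apply/measurable_EFinP.
    by apply: (measurable_funS measurableT) => //; exact/measurable_funP.
  - by move=> n x Dx //=; rewrite lee_fin.
  - by move=> x Dx a b ab; rewrite lee_fin; exact/lefP/nd_nnsfun_approx.
have -> : \int[mu]_(x in D) (f x * (g x)%:E) =
    lim (\int[mu]_(x in D) ((h n x)%:E * (g x)%:E) @[n --> \oo]).
  have fg x : D x -> f x * (g x)%:E = lim (((h n x)%:E * (g x)%:E) @[n --> \oo]).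
    by move=> Dx; apply/esym/cvg_lim => //; apply: cvgeZr => //;
      exact: cvg_nnsfun_approx.
  under eq_integral => x /[!inE] /fg -> //.
  apply: monotone_convergence => [//| | |].
  - move=> n; apply/emeasurable_funM => //; apply/measurable_funTS.
    exact/measurable_EFinP.
  - by move=> n x Dx /=; rewrite mule_ge0 ?lee_fin ?g0.
  - move=> x Dx a b ab/=; rewrite lee_wpmul2r ?lee_fin ?g0//.
    exact/lefP/nd_nnsfun_approx.
suff suf n : \int[mu]_(x in D) ((h n x)%:E * (g x)%:E) =
    \int[nu]_(x in D) (EFin \o h n) x.
  by congr (lim (_ @ \oo)); apply/funext => n; rewrite suf.
transitivity (\int[nu]_(x in D)
   (\sum_(y \in range (h n)) (y * \1_(h n @^-1` [set y]) x)%:E)); last first.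
  by apply: eq_integral => t tD; rewrite /= fimfunE -fsumEFin.
have indich m r : measurable_fun D (fun x => (r * \1_(h m @^-1` [set r]) x)%:E).
  by apply: (measurable_comp measurableT) => //; exact: measurable_funM.
rewrite ge0_integral_fsum//; last by move=> m y Ey; exact: nnfun_muleindic_ge0.
transitivity (\int[mu]_(x in D) (\sum_(y \in range (h n))
    (y * \1_(h n @^-1` [set y]) x)%:E * (g x)%:E)).
  under [RHS]eq_integral => x xE.
    rewrite -ge0_mule_fsuml => [|y]; last exact: nnfun_muleindic_ge0.
    rewrite fsumEFin // -(fimfunE _ x); over.
  by [].
rewrite ge0_integral_fsum//; last 2 first.
  - by move=> y; apply: emeasurable_funM.
  - by move=> m y Dy; apply: mule_ge0; [exact: nnfun_muleindic_ge0|rewrite lee_fin g0].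
apply: eq_fsbigr => r rhn.
under [RHS]eq_integral do rewrite EFinM.
rewrite integralZl_indic_nnsfun => //.
under eq_integral do rewrite EFinM -muleA.
rewrite ge0_integralZl//.
- under eq_integral do rewrite muleC.
  rewrite (eq_integral ((EFin \o g) \_ (h n @^-1` [set r]))); last first.
    by move=> x xD; rewrite epatch_indic.
  rewrite -integral_mkcondr integral_indic// nuE; first by rewrite setIC.
  + exact: measurableI.
  + exact: subIsetr.
- by apply: emeasurable_funM => //; exact/measurable_EFinP.
- by move=> t Dt; rewrite mule_ge0 ?lee_fin ?g0.
- by move: rhn; rewrite inE => -[t _ <-]; rewrite lee_fin.
Qed.

End Density.

(** The measures may be infinite near 0 and at infinity. They are finite on each [D n], where the
    pi-system of half-open intervals decides, and the sets [D n] increase to ]0, +oo[. *)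
Lemma measure_pos_itv_unique (R : realType)
    (m1 m2 : {measure set R -> \bar R}) :
  (forall a b : R, 0 < a -> a < b -> m1 `]a, b]%classic = m2 `]a, b]%classic) ->
  (forall a b : R, 0 < a -> a < b -> (m1 `]a, b]%classic < +oo)%E) ->
  forall A : set R, measurable A -> A `<=` `]0, +oo[ -> m1 A = m2 A.
Proof.
move=> m12 m1oo A mA A0.
pose D n : set R := `]n.+1%:R^-1, n.+1%:R]%classic.
have n1gt0 n : 0 < n.+1%:R^-1 :> R by rewrite invr_gt0.
have m12' a b : 0 < a -> m1 `]a, b]%classic = m2 `]a, b]%classic.
  move=> a0; have [ab|ba] := ltP a b; first exact: m12.
  by rewrite set_itv_ge ?measure0// bnd_simp -leNgt.
have DI n (a b : R) : D n `&` `]a, b]%classic =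
    `]Num.max n.+1%:R^-1 a, Num.min n.+1%:R b]%classic.
  apply/seteqP; split=> x; rewrite /D /= !in_itv/= gt_max le_min.
    by move=> [/andP[-> ->] /andP[-> ->]].
  by move=> /andP[/andP[-> ->] /andP[-> ->]].
have key n B : measurable B -> m1 (D n `&` B) = m2 (D n `&` B).
  move=> mB.
  have Doo : (m1 (D n) < +oo)%E.
    have [ab|ba] := ltP (n.+1%:R^-1 : R) n.+1%:R; first exact: m1oo.
    by rewrite /D set_itv_ge ?measure0// bnd_simp -leNgt.
  have mD : measurable (D n) by exact: measurable_itv.
  have := @measure_unique _ R _ (@ocitv R) (fun k => `](- k%:R), k%:R]%classic) _ _ _ _
    (mrestr m1 mD) (mrestr m2 mD).
  rewrite /= /mrestr !(setIC (D n)) => -> //.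
  - by move=> X Y; exact: ocitvI.
  - by move=> i; exists (- i%:R, i%:R).
  - apply/seteqP; split => // x _ /=.
    have [k xk] : exists k : nat, `|x| < k%:R.
      by exists (Num.truncn `|x|).+1; rewrite truncnS_gt.
    exists k => //=; rewrite in_itv/=.
    by move: xk; rewrite ltr_norml => /andP[-> /ltW ->].
  - move=> _ [[a b] _ <-]/=; rewrite setIC DI; apply: m12'.
    by rewrite lt_max n1gt0.
  - move=> k; rewrite (le_lt_trans _ Doo)// le_measure ?inE//=; exact: measurableI.
have AE : A = \bigcup_n (D n `&` A).
  apply/seteqP; split => [x Ax|x [n _ []]//].
  have := A0 _ Ax; rewrite /= in_itv/= andbT => x0.
  pose n := (Num.truncn x + Num.truncn x^-1).+1%N.
  have xV0 : 0 <= x^-1 by rewrite invr_ge0 ltW.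
  exists n => //; split => //; rewrite /D /= in_itv/=; apply/andP; split.
    rewrite -(invrK x) ltf_pV2 ?posrE ?invr_gt0//.
    by rewrite (lt_le_trans (truncnS_gt _))// ler_nat /n ltnS leqW// leq_addl.
  by apply/ltW; rewrite (lt_le_trans (truncnS_gt _))// ler_nat /n ltnS leqW// leq_addr.
have ndD : nondecreasing_seq (fun n => D n `&` A).
  move=> m n mn; apply/subsetPset; apply: setSI => x /=.
  rewrite /D /= !in_itv/= => /andP[mx xm]; apply/andP; split.
    by rewrite (le_lt_trans _ mx)// lef_pV2 ?posrE// ler_nat.
  by rewrite (le_trans xm)// ler_nat.
have mDA n : measurable (D n `&` A) by apply: measurableI => //; exact: measurable_itv.
rewrite AE.
have c1 := nondecreasing_cvg_mu (mu := m1) mDA (bigcup_measurable (fun n _ => mDA n)) ndD.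
have c2 := nondecreasing_cvg_mu (mu := m2) mDA (bigcup_measurable (fun n _ => mDA n)) ndD.
rewrite -(cvg_lim _ c1)// -(cvg_lim _ c2)//.
by congr (lim (_ @ \oo)); apply/funext => n /=; exact: key.
Qed.

(** * Normal distribution *)

Section Normal.
Context {R : realType}.
Implicit Types m s x u c : R.

Lemma normal_pdf01E x :
  normal_pdf 0 1 x = (Num.sqrt (2 * pi))^-1 * expR (- (x ^+ 2 / 2)).
Proof.
rewrite normal_pdfE ?oner_eq0// /normal_peak /normal_fun expr1n mul1r subr0.
by rewrite mulr_natl mulNr.
Qed.

Lemma normal_pdf_scale m s x : 0 < s ->
  normal_pdf m s x = normal_pdf 0 1 ((x - m) / s) / s.
Proof.
move=> s0; have sn0 : s != 0 by rewrite gt_eqF.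
rewrite normal_pdf01E normal_pdfE//= /normal_peak /normal_fun.
rewrite [RHS]mulrAC; congr (_ * expR _); last first.
  by field; rewrite sn0.
rewrite -mulrnAr sqrtrM ?sqr_ge0// sqrtr_sqr gtr0_norm// mulr_natl.
by rewrite invfM mulrC.
Qed.

Lemma normal_pdf_gt0 m s x : 0 < s -> 0 < normal_pdf m s x.
Proof.
move=> s0; rewrite normal_pdf_scale// divr_gt0// normal_pdf01E mulr_gt0 ?expR_gt0//.
by rewrite invr_gt0 sqrtr_gt0 mulr_gt0// pi_gt0.
Qed.

(** Completing the square. For a drift mu over a time t, m = mu t and s^2 = v t, so c = 2 mu / v
    does not depend on t: one tilt serves for every remaining time. *)
Lemma normal_pdf_tilt m s c x : 0 < s -> c * s ^+ 2 = 2 * m ->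
  expR (- (c * x)) * normal_pdf m s x = normal_pdf m s (- x).
Proof.
move=> s0 cE; have sn0 : s != 0 by rewrite gt_eqF.
rewrite !(@normal_pdf_scale m s)// mulrA; congr (_ / _).
rewrite !normal_pdf01E mulrCA -expRD; congr (_ * expR _).
have -> : c = 2 * m / s ^+ 2 by rewrite -cE; field.
by field.
Qed.

Lemma PhiE x : (Phi x)%:E = normal_prob 0 1 `]-oo, x].
Proof. by rewrite /Phi fineK// fin_num_measure. Qed.

Lemma Phi_ge0 x : 0 <= Phi x.
Proof. by rewrite fine_ge0. Qed.

Lemma Phi_le1 x : Phi x <= 1.
Proof. by rewrite -lee_fin PhiE probability_le1. Qed.

Lemma is_derive_Phi x : is_derive x 1 (@Phi R) (normal_pdf 0 1 x).
Proof.
have i1 : lebesgue_measure.-integrable [set` Interval -oo%O (BRight (x + 1))]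
    (EFin \o normal_pdf (0 : R) 1).
  by apply: integrableS (integrable_normal_pdf 0 1).
have [] := continuous_FTC1 (ltr_pwDr ltr01 (lexx x)) i1 _ _.
- by rewrite ltNyr.
- exact: (@continuous_normal_pdf _ 0 1 (oner_neq0 _) x).
by move=> dP P'; apply: DeriveDef; [exact: dP|rewrite -derive1E; exact: P'].
Qed.

Lemma Phi_lt x u : x < u -> Phi x < Phi u.
Proof.
move=> xu.
have dP y : derivable (@Phi R) y 1 by have [] := is_derive_Phi y.
have [||c] := @MVT _ (@Phi R) (normal_pdf 0 1) _ _ xu.
- by move=> y _; exact: is_derive_Phi.
- by apply: derivable_within_continuous => y _.
- move=> _ e; rewrite -subr_gt0 e mulr_gt0 ?subr_gt0//.
  exact: normal_pdf_gt0.
Qed.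

Lemma Phi_gt0 x : 0 < Phi x.
Proof. by rewrite (le_lt_trans (Phi_ge0 (x - 1)))// Phi_lt// gtrBl. Qed.

Lemma continuous_Phi : continuous (@Phi R).
Proof.
move=> x; apply: differentiable_continuous; apply/derivable1_diffP.
by have [] := is_derive_Phi x.
Qed.

Lemma normal_probNy m s x : 0 < s ->
  normal_prob m s `]-oo, x] = (Phi ((x - m) / s))%:E.
Proof.
move=> s0; rewrite PhiE /normal_prob.
pose F y : R := (y - m) / s.
have dF (y : R) : is_derive y 1 F s^-1.
  by rewrite /F; apply: is_derive_eq; rewrite scaler0 add0r subr0 scaler1.
have F'E : F^`()%classic = cst s^-1.
  by apply/funext => y; rewrite derive1E; exact: derive_val.
rewrite (@increasing_ge0_integration_by_substitutionNy _ F (normal_pdf 0 1)).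
- apply: eq_integral => y _; rewrite F'E !fctE/=.
  by rewrite normal_pdf_scale.
- by move=> y z _ _ yz; rewrite /F ltr_pM2r ?invr_gt0// ltrD2r.
- by rewrite F'E => y _; exact: cst_continuous.
- by rewrite F'E; exact: is_cvg_cst.
- by rewrite F'E; exact: cvg_cst.
- split=> [y _|].
    by have [] := dF y.
  apply: cvg_at_left_filter; apply: differentiable_continuous.
  by apply/derivable1_diffP; have [] := dF x.
- apply: gt0_cvgMlNy; first by rewrite invr_gt0.
  exact: cvg_addrr_Ny.
- apply: continuous_subspaceT; apply: continuous_normal_pdf.
  by rewrite oner_eq0.
- by move=> y _; exact: normal_pdf_ge0.
Qed.

Lemma integral_normal_pdfN m s x : s != 0 ->
  (\int[lebesgue_measure]_(y in `[x, +oo[) (normal_pdf m s (- y))%:E)%E =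
  normal_prob m s `]-oo, - x].
Proof.
move=> s0; rewrite /normal_prob.
rewrite (@ge0_integration_by_substitutionNy _ (normal_pdf m s) x)//.
  by apply: continuous_subspaceT; exact: continuous_normal_pdf.
by move=> y _; exact: normal_pdf_ge0.
Qed.

Lemma normal_proby m s x : 0 < s ->
  normal_prob m s `[x, +oo[ = (Phi ((m - x) / s))%:E.
Proof.
move=> s0; have sn0 : s != 0 by rewrite gt_eqF.
have h := @normal_probNy (- m) s (- x) s0.
rewrite -(integral_normal_pdfN (- m) x sn0) opprK (addrC (- x)) in h.
rewrite -h.
apply: eq_integral => y _; congr EFin; rewrite !(@normal_pdf_scale _ s)//.
rewrite !normal_pdf01E; congr (_ * expR _ / _).
by field.
Qed.

Lemma PhiN x : Phi x + Phi (- x) = 1.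
Proof.
have e : (Phi (- x))%:E = normal_prob (0 : R) 1 `]x, +oo[%classic.
  transitivity (normal_prob (0 : R) 1 `[x, +oo[%classic).
    have h := @normal_proby 0 1 x ltr01.
    have e0 : (0 - x) / 1 = - x by rewrite sub0r divr1.
    by rewrite e0 in h; exact: esym h.
  apply/esym/integral_itv_obnd_cbnd.
  by apply/measurable_EFinP/measurable_funTS; exact: measurable_normal_pdf.
have := @probability_setT _ _ _ (normal_prob (0 : R) 1).
rewrite -(setUv `]-oo, x]%classic) setCitvl measureU//; last first.
  by rewrite -setCitvl setICr.
move=> h; apply: EFin_inj; rewrite -[RHS]h EFinD.
by congr (_ + _)%E; [exact: PhiE|exact: e].
Qed.

(** The tilt turns the exponential summand into exp (c u) times the mass of ]-oo, - u]. At u = 0 the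
    right-hand side is 1 by [PhiN]; for the increment over [0, T] it is [max_tail]. *)
Lemma integral_normal_reflection m s c u : 0 < s -> c * s ^+ 2 = 2 * m ->
  (\int[normal_prob m s]_(x in `[u, +oo[) (1 + expR (c * (u - x)))%:E =
   (Phi ((m - u) / s) + expR (c * u) * Phi ((- u - m) / s))%:E)%E.
Proof.
move=> s0 cE; have sn0 : s != 0 by rewrite gt_eqF.
have mp D : measurable_fun D (EFin \o normal_pdf m s).
  by apply/measurable_EFinP/measurable_funTS; exact: measurable_normal_pdf.
have me : measurable_fun (`[u, +oo[ : set R) (fun x => expR (c * (u - x))).
  apply: measurable_funTS; apply: measurableT_comp => //.
  apply: measurable_funM => //; exact: measurable_funB.
rewrite (@ge0_integral_density _ _ _ lebesgue_measure _ (normal_pdf m s))//.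
- have pt x : ((1 + expR (c * (u - x)))%:E * (normal_pdf m s x)%:E =
      (normal_pdf m s x)%:E + (expR (c * u))%:E * (normal_pdf m s (- x))%:E)%E.
    rewrite -(normal_pdf_tilt x s0 cE) -!EFinM -EFinD mulrA -expRD.
    by congr EFin; rewrite mulrDl mul1r mulrBr.
  under eq_integral => x _ do rewrite pt.
  rewrite ge0_integralD//.
  + have e1 : (\int[lebesgue_measure]_(x in `[u, +oo[) (normal_pdf m s x)%:E =
      (Phi ((m - u) / s))%:E)%E by exact: normal_proby.
    have e2 : (\int[lebesgue_measure]_(x in `[u, +oo[)
        ((expR (c * u))%:E * (normal_pdf m s (- x))%:E) =
      (expR (c * u) * Phi ((- u - m) / s))%:E)%E.
      rewrite ge0_integralZl//.
      * by rewrite EFinM -(normal_probNy _ _ s0) integral_normal_pdfN.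
      * apply/measurable_EFinP; apply: measurable_funTS.
        by apply: measurableT_comp => //; exact: measurable_normal_pdf.
      * by move=> x _; rewrite lee_fin normal_pdf_ge0.
    by rewrite EFinD -e1 -e2.
  + by move=> x _; rewrite lee_fin normal_pdf_ge0.
  + by apply/measurable_EFinP; apply: measurable_funTS; exact: measurable_normal_pdf.
  + by move=> x _; rewrite -EFinM lee_fin mulr_ge0 ?expR_ge0 ?normal_pdf_ge0.
  + apply/measurable_EFinP; apply: measurable_funM => //; apply: measurable_funTS.
    by apply: measurableT_comp => //; exact: measurable_normal_pdf.
- by apply: measurable_funTS; exact: measurable_normal_pdf.
- by move=> x _; exact: normal_pdf_ge0.
- by apply/measurable_EFinP; exact: measurable_funD.
Qed.

End Normal.

(** * Tail and density of the maximum *)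

(** The Bachelier-Levy formula for P(M > u), u > 0, as [law_max] establishes. *)
Definition max_tail (R : realType) (T v mu u : R) : R :=
  Phi ((mu * T - u) / Num.sqrt (v * T)) +
  expR (2 * mu / v * u) * Phi ((- u - mu * T) / Num.sqrt (v * T)).

(** It carries the sign of the density, the exponential in front being positive, and it decreases on
    ]0, +oo[. *)
Definition max_dens_factor (R : realType) (T v mu u : R) : R :=
  let s := Num.sqrt (v * T) in
  let z := (- u - mu * T) / s in
  v * normal_pdf 0 1 z / s - mu * Phi z.

Definition max_dens (R : realType) (T v mu u : R) : R :=
  2 / v * expR (2 * mu / v * u) * max_dens_factor T v mu u.

Definition max_tail_drift (R : realType) (T v mu u : R) : R :=
  2 * u / v * expR (2 * mu / v * u) * Phi ((- u - mu * T) / Num.sqrt (v * T)).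

Section MaxTail.
Context {R : realType}.
Variables (T v : R).
Hypotheses (T0 : 0 < T) (v0 : 0 < v).
Implicit Types mu u : R.

Let s : R := Num.sqrt (v * T).
Let s0 : 0 < s. Proof. by rewrite sqrtr_gt0 mulr_gt0. Qed.
Let sn0 : s != 0. Proof. by rewrite gt_eqF. Qed.
Let Tn0 : T != 0. Proof. by rewrite gt_eqF. Qed.
Let vE : v = s ^+ 2 / T.
Proof. by rewrite sqr_sqrtr ?mulfK// mulr_ge0// ltW. Qed.

(** The two normal densities that come from differentiating [max_tail] agree up to the exponential:
    they add up in the derivative in [u] and cancel in the derivative in the drift. *)
Lemma max_tail_tilt mu u :
  expR (2 * mu / v * u) * normal_pdf 0 1 ((- u - mu * T) / s) =
  normal_pdf 0 1 ((mu * T - u) / s).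
Proof.
rewrite !normal_pdf01E mulrCA -expRD; congr (_ * expR _).
by rewrite vE; field; rewrite Tn0 sn0.
Qed.

Let is_derive_z mu u :
  is_derive u 1 (fun u : R => (- u - mu * T) / s) (- s^-1).
Proof. by apply: is_derive_eq; rewrite /GRing.scale/=; ring. Qed.

Lemma is_derive_max_tail mu u :
  is_derive u 1 (max_tail T v mu) (- max_dens T v mu u).
Proof.
have da : is_derive u 1 (fun u : R => (mu * T - u) / s) (- s^-1).
  by apply: is_derive_eq; rewrite /GRing.scale/=; ring.
have d1 := is_derive1_comp (is_derive_Phi _) da.
have d2 := is_derive1_comp (is_derive_Phi _) (is_derive_z mu u).
have de : is_derive u 1 (fun u : R => 2 * mu / v * u) (2 * mu / v).
  by apply: is_derive_eq; rewrite /GRing.scale/=; ring.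
have d3 := is_derive1_comp (is_derive_expR _) de.
have d4 := is_deriveD d1 (is_deriveM d3 d2).
apply: (@is_derive_eq _ _ _ _ _ _ _ _ d4) => /=.
rewrite /max_dens /max_dens_factor -/s -max_tail_tilt /= /GRing.scale/=.
rewrite vE; field; by rewrite Tn0 sn0.
Qed.

Lemma is_derive_max_tail_drift mu u :
  is_derive mu 1 (fun m : R => max_tail T v m u) (max_tail_drift T v mu u).
Proof.
have da : is_derive mu 1 (fun m : R => (m * T - u) / s) (T / s).
  by apply: is_derive_eq; rewrite /GRing.scale/=; ring.
have dz : is_derive mu 1 (fun m : R => (- u - m * T) / s) (- (T / s)).
  by apply: is_derive_eq; rewrite /GRing.scale/=; ring.
have d1 := is_derive1_comp (is_derive_Phi _) da.
have d2 := is_derive1_comp (is_derive_Phi _) dz.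
have de : is_derive mu 1 (fun m : R => 2 * m / v * u) (2 / v * u).
  by apply: is_derive_eq; rewrite /GRing.scale/=; ring.
have d3 := is_derive1_comp (is_derive_expR _) de.
have d4 := is_deriveD d1 (is_deriveM d3 d2).
apply: (@is_derive_eq _ _ _ _ _ _ _ _ d4) => /=.
rewrite /max_tail_drift -/s -max_tail_tilt /= /GRing.scale/=.
rewrite vE; field; by rewrite Tn0 sn0.
Qed.

(** The terms in the drift cancel, which leaves a derivative with the sign of - u. *)
Lemma is_derive_max_dens_factor mu u :
  is_derive u 1 (max_dens_factor T v mu)
    (- (u / (s * T)) * normal_pdf 0 1 ((- u - mu * T) / s)).
Proof.
have dz := is_derive_z mu u.
have d2 := is_derive1_comp (is_derive_Phi _) dz.
have de (y : R) : is_derive y 1 (normal_pdf (0 : R) 1) (- y * normal_pdf 0 1 y).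
  have -> : normal_pdf (0 : R) 1 =
      (fun y => (Num.sqrt (2 * pi))^-1 * (expR \o (fun y : R => - (y ^+ 2 / 2))) y).
    by apply/funext => x; rewrite normal_pdf01E.
  have dq : is_derive y 1 (fun y : R => - (y ^+ 2 / 2)) (- y).
    by apply: is_derive_eq; rewrite /GRing.scale/=; field.
  have dd := is_derive1_comp (is_derive_expR _) dq.
  have dc := is_deriveZ (Num.sqrt (2 * pi))^-1 dd.
  apply: (@is_derive_eq _ _ _ _ _ _ _ _ dc).
  by rewrite /GRing.scale/=; ring.
have d3 := is_derive1_comp (de _) dz.
have d4 := is_deriveB (is_deriveZ (v / s) d3) (is_deriveZ mu d2).
have -> : max_dens_factor T v mu =
    (v / s) \*: (normal_pdf 0 1 \o (fun u : R => (- u - mu * T) / s)) -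
    mu \*: (@Phi R \o (fun u : R => (- u - mu * T) / s)).
  by apply/funext => x; rewrite /max_dens_factor -/s mulrAC.
apply: (@is_derive_eq _ _ _ _ _ _ _ _ d4) => /=.
rewrite /GRing.scale/= vE; field; by rewrite Tn0 sn0.
Qed.

Lemma max_dens_factor_lt mu x u : 0 < x -> x < u ->
  max_dens_factor T v mu u < max_dens_factor T v mu x.
Proof.
move=> x0 xu.
pose df y := - (y / (s * T)) * normal_pdf 0 1 ((- y - mu * T) / s).
have [||c] := @MVT _ (max_dens_factor T v mu) df _ _ xu.
- by move=> y _; exact: is_derive_max_dens_factor.
- apply: derivable_within_continuous => y _.
  by have [] := is_derive_max_dens_factor mu y.
rewrite in_itv/= => /andP[xc _] e; rewrite -subr_lt0 e.
rewrite pmulr_llt0 ?subr_gt0// /df mulNr oppr_lt0 mulr_gt0 ?normal_pdf_gt0//.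
by rewrite divr_gt0 ?mulr_gt0// (lt_trans x0).
Qed.

Lemma continuous_max_tail mu : continuous (max_tail T v mu).
Proof.
move=> x; apply: differentiable_continuous; apply/derivable1_diffP.
by have [] := is_derive_max_tail mu x.
Qed.

(* Where the factor is not positive, it stays negative further right, and the
   tail would increase. *)
Lemma max_dens_factor_gt0 mu u :
  (forall x y, 0 < x -> x <= y -> max_tail T v mu y <= max_tail T v mu x) ->
  0 < u -> 0 < max_dens_factor T v mu u.
Proof.
move=> tail_ninc u0; rewrite ltNge; apply/negP => hu.
have uu1 : u < u + 1 by rewrite ltrDl.
have [||c] := @MVT _ (max_tail T v mu) (fun y => - max_dens T v mu y) _ _ uu1.
- by move=> y _; exact: is_derive_max_tail.
- by apply: continuous_subspaceT; exact: continuous_max_tail.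
rewrite in_itv/= => /andP[uc _] e.
have := tail_ninc u (u + 1) u0 (ltW uu1).
rewrite -subr_le0 e leNgt pmulr_lgt0 ?subr_gt0// oppr_gt0 /max_dens.
rewrite pmulr_rlt0 ?mulr_gt0 ?divr_gt0 ?expR_gt0//.
by rewrite (lt_le_trans (max_dens_factor_lt mu u0 uc)).
by rewrite invr_gt0.
Qed.

Let continuous_exp_lin c : continuous (fun u => expR (c * u)).
Proof.
move=> x; apply: (@continuous_comp _ _ _ (fun u => c * u) expR).
  by apply: (@mulrl_continuous R).
exact: continuous_expR.
Qed.

Lemma continuous_max_dens mu : continuous (max_dens T v mu).
Proof.
move=> x; rewrite /max_dens; apply: cvgM.
  by apply: cvgMr; exact: continuous_exp_lin.
apply: differentiable_continuous; apply/derivable1_diffP.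
by have [] := is_derive_max_dens_factor mu x.
Qed.

Lemma continuous_max_tail_drift mu : continuous (max_tail_drift T v mu).
Proof.
move=> x; rewrite /max_tail_drift; apply: cvgM.
  apply: cvgM; last exact: continuous_exp_lin.
  by apply: cvgMl; apply: cvgMr; exact: cvg_id.
apply: (@continuous_comp _ _ _ (fun u => (- u - mu * T) / s) (@Phi R)).
  apply: differentiable_continuous; apply/derivable1_diffP.
  by have [] := is_derive_z mu x.
exact: continuous_Phi.
Qed.

End MaxTail.

(** * Restriction, independence and limits of integrals; uniform continuity *)

Section MeasureLemmas.
Local Open Scope ereal_scope.
Context d (T : measurableType d) (R : realType).

Lemma ge0_integral_mrestr (mu : {measure set T -> \bar R}) (E D : set T)
    (mE : measurable E) (f : T -> \bar R) :
  measurable D -> measurable_fun D f -> (forall x, D x -> 0 <= f x) ->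
  \int[mrestr mu mE]_(x in D) f x = \int[mu]_(x in E `&` D) f x.
Proof.
move=> mD mf f0.
rewrite (@ge0_integral_density _ _ _ mu (mrestr mu mE) (\1_E : T -> R))//.
- rewrite setIC [RHS]integral_mkcondr; apply: eq_integral => x xD.
  by rewrite epatch_indic.
- by move=> A mA AD; rewrite integral_indic// setIC.
Qed.

(** Under [P] restricted to [E], the law of [Y] is P(E) times [nu]. This replaces conditioning on
    the past at a passage. *)
Lemma ge0_integral_indep d' (T' : measurableType d') (P : probability T R)
    (nu : probability T' R) (Y : T -> T') (E : set T) (D : set T')
    (f : T' -> \bar R) :
  measurable E -> measurable_fun setT Y ->
  (forall A, measurable A -> P (E `&` Y @^-1` A) = P E * nu A) ->
  measurable D -> measurable_fun D f -> (forall x, D x -> 0 <= f x) ->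
  \int[P]_(w in E `&` Y @^-1` D) f (Y w) = P E * \int[nu]_(x in D) f x.
Proof.
move=> mE mY ind mD mf f0.
have mYD : measurable (Y @^-1` D) by rewrite -[_ @^-1` _]setTI; exact: mY.
have PE : (0 <= fine (P E))%R by exact: fine_ge0.
transitivity (\int[pushforward (mrestr P mE) Y]_(x in D) f x).
  rewrite ge0_integral_pushforward//; last by move=> x /set_mem; exact: f0.
  rewrite ge0_integral_mrestr//.
  + by apply: (measurable_comp mD) => // [_ [x Dx <-]//|]; exact: measurable_funTS.
  + by move=> x Dx; exact: f0.
transitivity (\int[mscale (NngNum PE) nu]_(x in D) f x).
  apply: eq_measure_integral => A mA _.
  rewrite -[LHS]/(P (Y @^-1` A `&` E)) setIC ind//.
  by rewrite -[X in (X * _)]fineK ?fin_num_measure.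
rewrite ge0_integral_mscale//.
by rewrite -[X in _ = X * _]fineK ?fin_num_measure.
Qed.

(** Dominated convergence for sets that need not be monotone: the grids of mesh T / (n + 1) are not
    nested, so the passage events need not increase with [n]. *)
Lemma cvg_integral_eventually_in (mu : {measure set T -> \bar R})
    (D : set T) (U : (set T)^nat) (f : T -> \bar R) :
  measurable D -> (forall n, measurable (U n)) -> mu.-integrable D f ->
  (forall x, D x -> \forall n \near \oo, U n x) ->
  \int[mu]_(x in D `&` U n) f x @[n --> \oo] --> \int[mu]_(x in D) f x.
Proof.
move=> mD mU fi DU.
have mf := measurable_int _ fi.
have [|||] := @dominated_convergence _ _ _ mu D mD
    (fun n => (f \_ (U n))) f (abse \o f) _ mf _ (integrable_abse fi).
- move=> n; apply/(measurable_restrict _ (mU n) mD).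
  by apply: measurable_funS mf => //; exact: subIsetl.
- apply: aeW => x Dx; apply: cvg_near_cst.
  by apply: filterS (DU x Dx) => n Ux; rewrite patchE mem_set.
- apply: aeW => x n Dx /=; rewrite patchE; case: ifP => // _.
  by rewrite abse0 abse_ge0.
move=> _ _; rewrite [X in X @ _ --> _](_ : _ =
  fun n => \int[mu]_(x in D `&` U n) f x)//.
by apply/funext => n; rewrite integral_mkcondr.
Qed.

Lemma cvg_measure_eventually_in (mu : {finite_measure set T -> \bar R})
    (D : set T) (U : (set T)^nat) :
  measurable D -> (forall n, measurable (U n)) ->
  (forall x, D x -> \forall n \near \oo, U n x) ->
  mu (D `&` U n) @[n --> \oo] --> mu D.
Proof.
move=> mD mU DU.
have -> : (fun n => mu (D `&` U n)) = (fun n => \int[mu]_(x in D `&` U n) cst 1 x).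
  by apply/funext => n; rewrite integral_cst ?mul1e//; exact: measurableI.
rewrite -[mu D]mul1e -(integral_cst mu mD 1).
by apply: cvg_integral_eventually_in => //; exact: finite_measure_integrable_cst.
Qed.

End MeasureLemmas.

(** Heine's theorem: compactness makes the radius of continuity uniform. *)
Lemma segment_uniform_continuity (R : realType) (f : R -> R) (a b e : R) :
  {within `[a, b], continuous f} -> 0 < e ->
  exists2 del, 0 < del & forall x y, x \in `[a, b] -> y \in `[a, b] ->
    `|x - y| < del -> `|f x - f y| < e.
Proof.
move=> cf e0.
have := @segment_compact _ a b; move=> /compact_near_coveringP.
move=> /(_ R (0 : R)^'+ (fun del x => x \in `[a, b] -> forall y, y \in `[a, b] ->
    `|x - y| < del -> `|f x - f y| < e) _).
have cov : forall x, `[a, b]%classic x ->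
    \forall x' \near x & i \near (0 : R)^'+,
      x' \in `[a, b] -> forall y, y \in `[a, b] ->
      `|x' - y| < i -> `|f x' - f y| < e.
  move=> x xab.
  have e2 : 0 < e / 2 by rewrite divr_gt0.
  have := (iffLR (subspace_continuousP _ _) cf) x xab.
  move=> /cvgrPdist_lt /(_ _ e2); rewrite near_withinE => -[rho /= rho0 hrho].
  have rho2 : 0 < rho / 2 by rewrite divr_gt0.
  near=> x' i => x'ab y yab x'y.
  have xx' : `|x - x'| < rho / 2 by near: x'; exact: nbhsx_ballx.
  have ir : i < rho / 2 by near: i; exact: nbhs_right_lt.
  have h1 : `|f x - f x'| < e / 2.
    by apply: hrho => //; rewrite /ball/= (lt_trans xx')// ltr_pdivrMr// ltr_pMr// ltr1n.
  have h2 : `|f x - f y| < e / 2.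
    apply: hrho => //; rewrite /ball/=.
    rewrite (splitr rho) (le_lt_trans (ler_distD x' _ _))// ltrD//.
    exact: lt_trans ir.
  rewrite (splitr e) (le_lt_trans (ler_distD (f x) _ _))// ltrD// distrC//.
move=> /(_ cov) h.
have [del /= del0 hdel] := h.
exists (del / 2); first by rewrite divr_gt0.
move=> x y xab yab xy.
apply: (hdel (del / 2)) => //=.
- rewrite sub0r normrN gtr0_norm ?divr_gt0//.
  by rewrite ltr_pdivrMr// ltr_pMr// ltr1n.
- by rewrite divr_gt0.
Unshelve. all: by end_near. Qed.

(** * Grids and the first maximizer *)

Definition grid (R : realType) (T : R) (n k : nat) : R := k%:R * T / n.+1%:R.

Section Grid.
Context {R : realType}.
Variable T : R.
Hypothesis T0 : 0 <= T.

Lemma grid_ge0 n k : 0 <= grid T n k.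
Proof. by rewrite divr_ge0 ?mulr_ge0. Qed.

Lemma grid0 n : grid T n 0 = 0.
Proof. by rewrite /grid !mul0r. Qed.

Lemma gridT n : grid T n n.+1 = T.
Proof. by rewrite /grid mulrAC divff ?mul1r// pnatr_eq0. Qed.

Lemma le_grid n : {homo grid T n : k l / (k <= l)%N >-> k <= l}.
Proof.
by move=> k l kl; rewrite ler_pM2r ?invr_gt0// ler_wpM2r// ler_nat.
Qed.

Lemma gridS n k : grid T n k.+1 = grid T n k + T / n.+1%:R.
Proof. by rewrite /grid -natr1 mulrDl mul1r mulrDl. Qed.

Lemma grid_itv n k : (k <= n.+1)%N -> grid T n k \in `[0, T].
Proof. by move=> kn; rewrite in_itv/= grid_ge0/= -[leRHS](gridT n) le_grid. Qed.

Lemma mesh_lt (e : R) : 0 < e -> \forall n \near \oo, T / n.+1%:R < e.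
Proof.
move=> e0; exists (Num.truncn (T / e)) => // n /= hn.
rewrite ltr_pdivrMr// mulrC -ltr_pdivrMr// (lt_le_trans (truncnS_gt _))//.
by rewrite ler_nat ltnS.
Qed.

Definition grid_index n (s : R) : nat := Num.truncn (s * n.+1%:R / T).

End Grid.

Section GridIndex.
Context {R : realType}.
Variable T : R.
Hypothesis T0 : 0 < T.

Lemma grid_index_le n s : s \in `[0, T] -> (grid_index T n s <= n.+1)%N.
Proof.
rewrite in_itv/= => /andP[s0 sT].
rewrite /grid_index truncn_le_nat ltr_pdivrMr// mulrC.
by rewrite (@le_lt_trans _ _ (n.+1%:R * T)) ?ler_wpM2l// ltr_pM2r// ltr_nat.
Qed.

Lemma grid_indexP n s : 0 <= s ->
  grid T n (grid_index T n s) <= s < grid T n (grid_index T n s) + T / n.+1%:R.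
Proof.
move=> s0; have := @truncn_itv R (s * n.+1%:R / T).
rewrite (divr_ge0 (mulr_ge0 s0 _) (ltW T0))// => /(_ isT) /andP[h1 h2].
rewrite ler_pdivlMr// in h1; rewrite ltr_pdivrMr// in h2.
rewrite -gridS; apply/andP; split; first by rewrite /grid ler_pdivrMr.
by rewrite /grid ltr_pdivlMr.
Qed.

End GridIndex.

(** The maximizers form a nonempty set, by compactness, and a closed one: if the value at their
    infimum were not the maximum, uniform continuity would keep them at a distance from it. *)
Lemma argmax_timeP (R : realType) (Omega : Type) (X : R -> Omega -> R) (T : R)
    (w : Omega) :
  0 <= T -> {within `[0, T], continuous (fun t => X t w)} ->
  exists t, [/\ argmax_time X T w = t%:E, t \in `[0, T],
    forall s, s \in `[0, T] -> X s w <= X t w &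
    forall s, s \in `[0, T] -> X s w = X t w -> t <= s].
Proof.
move=> T0 cX.
have [c cT maxc] := EVT_max T0 cX.
have supE : ereal_sup [set (X s w)%:E | s in `[0, T]] = (X c w)%:E.
  apply/eqP; rewrite eq_le; apply/andP; split.
    by apply: ge_ereal_sup => _ [s sT <-]; rewrite lee_fin maxc.
  by apply: ereal_sup_ubound; exists c.
pose A := [set t : R | 0 <= t <= T /\ X t w = X c w].
have AE : [set t%:E | t in [set t : R | 0 <= t <= T /\
    (X t w)%:E = ereal_sup [set (X s w)%:E | s in `[0, T]]]] = EFin @` A.
  rewrite supE; congr (_ @` _); apply/seteqP; split => t [? ht]; split => //.
    by case: ht.
  by rewrite ht.
have Ac : A c by split => //; move: cT; rewrite in_itv.
have lbA : has_lbound A by exists 0 => t [/andP[]].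
have Aneq0 : A !=set0 by exists c.
have hiA : has_inf A by [].
have t0 : 0 <= inf A by apply: lb_le_inf => // t [/andP[]].
have tc : inf A <= c by apply: ge_inf.
have tT : inf A \in `[0, T].
  by rewrite in_itv/= t0/= (le_trans tc)//; move: cT; rewrite in_itv/= => /andP[].
have XtE : X (inf A) w = X c w.
  apply/eqP/negP => /negP; rewrite -subr_eq0 -normr_gt0 => ne.
  have [del del0 hdel] := segment_uniform_continuity cX ne.
  have [t At tlt] := inf_adherent del0 hiA.
  have [tT' tE] := At.
  have := hdel (inf A) t tT _ _; rewrite tE ltxx in_itv/= tT' => h.
  suff : false by []; apply: h => //.
  by rewrite distrC ger0_norm ?subr_ge0 ?ge_inf// ltrBlDl.
exists (inf A); split => //.
- by rewrite /argmax_time AE ereal_inf_EFin.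
- by move=> s sT; rewrite XtE maxc.
- by move=> s sT sE; apply: ge_inf => //; split; [move: sT; rewrite in_itv|rewrite sE].
Qed.

Section ArgmaxMeasurable.
Context {R : realType} d {Omega : measurableType d}.
Implicit Types X V : R -> Omega -> R.

(** By continuity the maximum exceeds [x] exactly when the path does at some point of some grid,
    which is a countable union of events. *)
Lemma measurable_max X (T : R) : 0 <= T ->
  (forall t, t \in `[0, T] -> measurable_fun setT (X t)) ->
  (forall w, {within `[0, T], continuous (fun t => X t w)}) ->
  measurable_fun setT (at_time X (argmax_time X T)).
Proof.
move=> T0 mX cX mD; apply: (measurability _ (RGenOInfty.measurableE R)) => //.
move=> _ [_ [x ->] <-]; rewrite setTI.
rewrite [X in measurable X](_ : _ = \bigcup_n \bigcup_(k in `I_n.+2)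
    (X (grid T n k) @^-1` `]x, +oo[)).
  apply: bigcupT_measurable => n; apply: bigcup_measurable => k /= kn.
  rewrite -[X in measurable X]setTI; apply: mX => //.
  by apply: grid_itv.
apply/seteqP; split => w /=.
  have [t [tE tT maxt _]] := argmax_timeP T0 (cX w).
  rewrite /at_time tE/= in_itv/= andbT => xt.
  (* For [T = 0] the segment is a point, and [grid_indexP] does not apply. *)
  have := T0; rewrite le_eqVlt => /predU1P[T00|T0'].
    exists 0%N => //; exists 0%N => //=; rewrite in_itv/= andbT grid0.
    by move: tT; rewrite -T00 itv_xx/= => /eqP <-.
  have [] := @segment_uniform_continuity _ _ _ _ (X t w - x) (cX w).
    by rewrite subr_gt0.
  move=> del del0 hdel; have [n _ hn] := mesh_lt T del0.
  have /andP[kt tk] : grid T n (grid_index T n t) <= t <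
      grid T n (grid_index T n t) + T / n.+1%:R.
    by apply: grid_indexP => //; move: tT; rewrite in_itv/= => /andP[].
  have kn := grid_index_le T0' n tT.
  exists n => //; exists (grid_index T n t) => //=.
  rewrite in_itv/= andbT.
  have := hdel t (grid T n (grid_index T n t)) tT (grid_itv T0 kn).
  rewrite ger0_norm ?subr_ge0// => h.
  have := h _; rewrite ltrBlDl => /(_ (lt_trans tk _)); rewrite ltrD2l => /(_ (hn n _)).
  move=> /(_ (leqnn n)) /ltr_normlW; rewrite ltrD2l ltrN2; exact.
move=> [n _ [k /= kn]]; rewrite in_itv/= andbT => xk.
have [t [tE tT maxt _]] := argmax_timeP T0 (cX w).
rewrite /at_time tE/= in_itv/= andbT (lt_le_trans xk)// maxt//.
exact: grid_itv.
Qed.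

(** For s in [0, T], the first maximizer comes after [s] exactly when the maximum over [0, s] is
    smaller than the one over [0, T]; this equivalence rests on its being the first. *)
Lemma measurable_argmax_time X (T : R) : 0 <= T ->
  (forall t, t \in `[0, T] -> measurable_fun setT (X t)) ->
  (forall w, {within `[0, T], continuous (fun t => X t w)}) ->
  measurable_fun setT (fun w => fine (argmax_time X T w)).
Proof.
move=> T0 mX cX mD; apply: (measurability _ (RGenOInfty.measurableE R)) => //.
move=> _ [_ [s ->] <-]; rewrite setTI.
have [s0|s0] := ltP s 0.
  rewrite [X in measurable X](_ : _ = setT)//; apply/seteqP; split => // w _ /=.
  have [t [-> + _ _]] := argmax_timeP T0 (cX w).
  by rewrite !in_itv/= andbT => /andP[t0 _]; exact: lt_le_trans t0.
have [sT|Ts] := ltP T s.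
  rewrite [X in measurable X](_ : _ = set0)//; apply/seteqP; split => // w /=.
  have [t [-> + _ _]] := argmax_timeP T0 (cX w).
  rewrite !in_itv/= andbT => /andP[_ tT] st.
  by have := lt_trans st (le_lt_trans tT sT); rewrite ltxx.
have sub t : t \in `[0, s] -> t \in `[0, T].
  by rewrite !in_itv/= => /andP[-> ts]/=; exact: le_trans Ts.
have cXs w : {within `[0, s], continuous (fun t => X t w)}.
  by apply: continuous_subspaceW (cX w) => t /=; exact: sub.
have mMs : measurable_fun setT (at_time X (argmax_time X s)).
  by apply: measurable_max => // t /sub; exact: mX.
have mMT : measurable_fun setT (at_time X (argmax_time X T)) by exact: measurable_max.
rewrite [X in measurable X](_ : _ =
    (fun w => at_time X (argmax_time X s) w < at_time X (argmax_time X T) w)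
      @^-1` [set true]).
  by rewrite -[X in measurable X]setTI; apply: measurable_fun_ltr.
apply/seteqP; split => w /=; rewrite in_itv/= andbT /at_time;
  have [t [-> tT maxt mint]] := argmax_timeP T0 (cX w);
  have [t' [-> t's maxt' _]] := argmax_timeP s0 (cXs w) => /=.
  move=> st; rewrite lt_neqAle maxt ?sub// andbT; apply/negP => /eqP tE.
  have := mint _ (sub _ t's) tE; apply/negP; rewrite -ltNge.
  by rewrite (le_lt_trans _ st)//; move: t's; rewrite in_itv/= => /andP[].
move=> tt'; rewrite ltNge; apply/negP => ts.
move: tt'; apply/negP; rewrite -leNgt; apply: maxt'.
by rewrite in_itv/= ts; move: tT; rewrite in_itv/= => /andP[->].
Qed.

Lemma measurable_at_time V (T : R) (tau : Omega -> \bar R) : 0 < T ->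
  (forall t, t \in `[0, T] -> measurable_fun setT (V t)) ->
  (forall w, {within `[0, T], continuous (fun t => V t w)}) ->
  measurable_fun setT (fun w => fine (tau w)) ->
  (forall w, fine (tau w) \in `[0, T]) ->
  measurable_fun setT (at_time V tau).
Proof.
move=> T0 mV cV mtau tauT.
(* Evaluation at the last grid point not after [tau]; the index [n.+1] catches [tau = T]. *)
pose f n w := \sum_(k < n.+2) V (grid T n k) w *
  \1_((fun w => fine (tau w)) @^-1` `[grid T n k, grid T n k.+1[) w.
apply: (@measurable_fun_cvg _ _ _ _ f).
  move=> n; rewrite /f; apply: measurable_sum => k.
  apply: measurable_funM.
    by apply: mV; apply: grid_itv; rewrite ?ltW// -ltnS.
  apply: measurable_indic; rewrite -[X in measurable X]setTI.
  by apply: mtau => //; exact: measurable_itv.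
move=> w _.
have fE n : f n w = V (grid T n (grid_index T n (fine (tau w)))) w.
  have tw := tauT w; have t0 : 0 <= fine (tau w) by move: tw; rewrite in_itv/= => /andP[].
  have kn : (grid_index T n (fine (tau w)) < n.+2)%N by rewrite ltnS; exact: grid_index_le.
  have /andP[h1 h2] := grid_indexP T0 n t0.
  rewrite /f (bigD1 (Ordinal kn))//= indicE mem_set ?mulr1; last first.
    by rewrite /= in_itv/= h1 gridS.
  rewrite big1 ?addr0// => k /eqP kne; rewrite indicE memNset ?mulr0//=.
  rewrite in_itv/= => /andP[g1 g2]; apply: kne; apply: val_inj => /=.
  have mono k1 k2 : grid T n k1 < grid T n k2 -> (k1 < k2)%N.
    by rewrite ltNge => /negP h; rewrite ltnNge; apply/negP => /(le_grid (ltW T0) n).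
  have l1 : (k < (grid_index T n (fine (tau w))).+1)%N.
    by apply: mono; apply: (le_lt_trans g1); rewrite gridS.
  have l2 : (grid_index T n (fine (tau w)) < k.+1)%N.
    by apply: mono; apply: (le_lt_trans h1).
  by apply/eqP; rewrite eqn_leq -ltnS l1 -ltnS l2.
under eq_fun do rewrite fE.
apply/cvgrPdist_lt => e e0.
have [del del0 hdel] := segment_uniform_continuity (cV w) e0.
have [N _ hN] := mesh_lt T del0.
exists N => // n /= Nn; rewrite /at_time.
have tw := tauT w; have t0 : 0 <= fine (tau w) by move: tw; rewrite in_itv/= => /andP[].
have /andP[h1 h2] := grid_indexP T0 n t0.
apply: hdel => //; first by apply: grid_itv; [exact: ltW|exact: grid_index_le].
by rewrite ger0_norm ?subr_ge0// ltrBlDl (lt_trans h2)// ltrD2l hN.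
Qed.

End ArgmaxMeasurable.

(** * Reflection principle *)

Section FirstPassage.
Context {R : realType} dO {Omega : measurableType dO}.
Variables (X : R -> Omega -> R) (T u e : R).

(* The first time of the grid at which the path is at least [u] is the [k]-th,
   and the overshoot is less than [e]. *)
Definition first_passage n k : set Omega :=
  [set w | (k <= n.+1)%N /\ u <= X (grid T n k) w < u + e /\
    forall j, (j < k)%N -> X (grid T n j) w < u].

Definition passage n : set Omega := \big[setU/set0]_(k <- iota 0 n.+2) first_passage n k.

Lemma passageP n w : passage n w <-> exists k, first_passage n k w.
Proof.
rewrite /passage -bigcup_seq; split=> [[k _ h]|[k h]]; exists k => //.
have : k \in iota 0 n.+2 by rewrite mem_iota add0n ltnS; case: h.
exact.
Qed.

Lemma trivIset_first_passage n (D : set nat) : trivIset D (first_passage n).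
Proof.
move=> i j _ _ [w [[_ [/andP[ui _] hi]] [_ [/andP[uj _] hj]]]].
have [ij|ji|//] := ltngtP i j.
  by have := hj _ ij; rewrite ltNge ui.
by have := hi _ ji; rewrite ltNge uj.
Qed.

(** A first passage is decided by the path up to [grid T n k], as independence of the later
    increment requires. *)
Lemma first_passage_past n k : (k <= n.+1)%N ->
  g_sigma_preimage (fun j : 'I_k.+1 => X (grid T n j)) (first_passage n k).
Proof.
move=> kn; set S := g_sigma_preimage _.
have SX (j : 'I_k.+1) (B : set R) : measurable B -> S (X (grid T n j) @^-1` B).
  move=> mB; apply: sub_sigma_algebra; rewrite -bigcup_mkord_ord.
  have jE : inord j = j :> 'I_k.+1 by exact: inord_val.
  exists (nat_of_ord j); first by case: (j).
  by exists B => //; rewrite setTI jE.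
have SX' j (B : set R) : (j <= k)%N -> measurable B -> S (X (grid T n j) @^-1` B).
  by move=> jk mB; have := SX (Ordinal (jk : (j < k.+1)%N)) B mB.
have -> : first_passage n k = (X (grid T n k) @^-1` `[u, u + e[) `&`
    \bigcap_(j in `I_k) (X (grid T n j) @^-1` `]-oo, u[).
  apply/seteqP; split => w /=.
    move=> [_ [h hj]]; split; first by rewrite in_itv.
    by move=> j /= jk; rewrite in_itv/=; exact: hj.
  rewrite in_itv/= => -[h hj]; do 2 (split; first by []).
  by move=> j jk; have := hj j jk; rewrite /= in_itv.
pose T' := g_sigma_algebraType
  (\big[setU/set0]_(i < k.+1) preimage_set_system setT
    (fun w : Omega => X (grid T n i) w) measurable).
have := @measurableI _ T' (X (grid T n k) @^-1` `[u, u + e[)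
  (\bigcap_(j in `I_k) (X (grid T n j) @^-1` `]-oo, u[)).
apply; first by apply: SX' => //; exact: measurable_itv.
apply: (@bigcap_measurableType _ T') => // j /= jk.
by apply: SX'; [exact: ltnW|exact: measurable_itv].
Qed.

Hypothesis mX : forall t, t \in `[0, T] -> measurable_fun setT (X t).
Hypothesis T0 : 0 <= T.

Lemma measurable_first_passage n k : measurable (first_passage n k).
Proof.
have [kn|kn] := leqP k n.+1; last first.
  rewrite (_ : first_passage n k = set0)//; apply/seteqP; split => // w [].
  by rewrite leqNgt kn.
have -> : first_passage n k = (X (grid T n k) @^-1` `[u, u + e[) `&`
    \bigcap_(j in `I_k) (X (grid T n j) @^-1` `]-oo, u[).
  apply/seteqP; split => w /=.
    move=> [_ [h hj]]; split; first by rewrite in_itv.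
    by move=> j /= jk; rewrite in_itv/=; exact: hj.
  rewrite in_itv/= => -[h hj]; do 2 (split; first by []).
  by move=> j jk; have := hj j jk; rewrite /= in_itv.
have mp j (B : set R) : (j <= k)%N -> measurable B ->
    measurable (X (grid T n j) @^-1` B).
  move=> jk mB; rewrite -[X in measurable X]setTI; apply: mX => //.
  by apply: grid_itv => //; exact: leq_trans kn.
apply: measurableI; first by apply: mp => //; exact: measurable_itv.
by apply: bigcap_measurableType => // j /= jk; apply: mp; [exact: ltnW|exact: measurable_itv].
Qed.

Lemma measurable_passage n : measurable (passage n).
Proof. by apply: bigsetU_measurable => k _; exact: measurable_first_passage. Qed.

(** Let the mesh be so fine that the path moves by less than both [e] and X t - u over one step.
    Some grid point is then at least [u]; the first such one is preceded by a value below [u], as X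
    0 < u, and so overshoots by less than [e]. *)
Lemma passage_eventually w : 0 < T -> 0 < e -> X 0 w < u ->
  {within `[0, T], continuous (fun t => X t w)} ->
  (exists2 t, t \in `[0, T] & u < X t w) -> \forall n \near \oo, passage n w.
Proof.
move=> T0' e0 X0u cX [t tT ut].
pose eta := Num.min e (X t w - u).
have eta0 : 0 < eta by rewrite lt_min e0 subr_gt0.
have [del del0 hdel] := segment_uniform_continuity cX eta0.
have [N _ hN] := mesh_lt T del0.
exists N => // n /= Nn.
have t0 : 0 <= t by move: tT; rewrite in_itv/= => /andP[].
have /andP[h1 h2] := grid_indexP T0' n t0.
set k0 := grid_index T n t in h1 h2.
have k0n : (k0 <= n.+1)%N by exact: grid_index_le.
have uk0 : u <= X (grid T n k0) w.
  have := hdel t (grid T n k0) tT (grid_itv T0 k0n).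
  rewrite ger0_norm ?subr_ge0// => h.
  have /h : t - grid T n k0 < del by rewrite ltrBlDl (lt_trans h2)// ltrD2l hN.
  rewrite lt_min => /andP[_ /ltr_normlW].
  by rewrite ltrD2l ltrN2 => /ltW.
have exk : exists k, u <= X (grid T n k) w by exists k0.
have [k uk kmin] := ex_minnP exk.
have kk0 : (k <= k0)%N := kmin _ uk0.
have kn : (k <= n.+1)%N := leq_trans kk0 k0n.
apply/passageP; exists k; split => //; split; last first.
  by move=> j; apply: contraTT; rewrite -leNgt -leqNgt; exact: kmin.
rewrite uk/=; case: k uk kmin kk0 kn => [|k] uk kmin kk0 kn.
  by move: uk; rewrite grid0 leNgt X0u.
have Xk : X (grid T n k) w < u.
  by rewrite ltNge; apply/negP => /kmin; rewrite ltnn.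
have := hdel (grid T n k.+1) (grid T n k) (grid_itv T0 kn) (grid_itv T0 (ltnW kn)).
rewrite gridS addrAC subrr add0r ger0_norm ?divr_ge0// => /(_ (hN _ Nn)).
rewrite lt_min => /andP[/ltr_normlW h _].
rewrite -gridS ltrBlDr in h.
by rewrite -gridS (lt_trans h)// addrC ltrD2r.
Qed.

Lemma passage_max n w : (exists2 t, t \in `[0, T] & u <= X t w) \/ ~ passage n w.
Proof.
have [/passageP[k [kn [/andP[uk _] _]]]|] := pselect (passage n w); last by right.
by left; exists (grid T n k) => //; exact: grid_itv.
Qed.

Lemma ge0_integral_passage (P : {measure set Omega -> \bar R}) n (D : set Omega)
    (f : Omega -> \bar R) : measurable D -> measurable_fun setT f ->
  (forall w, 0 <= f w)%E ->
  (\int[P]_(w in passage n `&` D) f w =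
   \sum_(k <- iota 0 n.+2) \int[P]_(w in first_passage n k `&` D) f w)%E.
Proof.
move=> mD mf f0; rewrite integral_mkcondr ge0_integral_bigsetU.
- by apply: eq_bigr => k _; rewrite -integral_mkcondr.
- exact: measurable_first_passage.
- exact: iota_uniq.
- exact: trivIset_first_passage.
- apply: measurable_funTS; apply/(measurable_restrictT _ mD).
  exact: measurable_funTS.
- by move=> w _; exact: erestrict_ge0.
Qed.

End FirstPassage.

Definition last_inc (R : realType) (Omega : Type) (X : R -> Omega -> R) (T t : R)
  (w : Omega) : R := X T w - X t w.

Section Reflection.
Context {R : realType} dO {Omega : measurableType dO} (P : probability Omega R).
Variables (X : R -> Omega -> R) (M : Omega -> R) (T v mu : R).
Hypotheses (T0 : 0 < T) (v0 : 0 < v).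
Hypothesis mX : forall t, t \in `[0, T] -> measurable_fun setT (X t).
Hypothesis X0 : forall w, X 0 w = 0.
Hypothesis cX : forall w, {within `[0, T], continuous (fun t => X t w)}.
Hypothesis mM : measurable_fun setT M.
Hypothesis MX : forall w, exists2 t, t \in `[0, T] & X t w = M w.
Hypothesis XM : forall w t, t \in `[0, T] -> X t w <= M w.
Hypothesis lawX : forall t, 0 <= t -> t < T -> forall A, measurable A ->
  P (last_inc X T t @^-1` A) =
  normal_prob (mu * (T - t)) (Num.sqrt (v * (T - t))) A.
Hypothesis indX : forall n k, (k <= n.+1)%N -> forall E A,
  g_sigma_preimage (fun j : 'I_k.+1 => X (grid T n j)) E -> measurable A ->
  P (E `&` last_inc X T (grid T n k) @^-1` A) =
  (P E * P (last_inc X T (grid T n k) @^-1` A))%E.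

Let c := 2 * mu / v.
Let T0' : 0 <= T. Proof. exact: ltW. Qed.
Let TT : T \in `[0, T]. Proof. by rewrite in_itv/= T0' lexx. Qed.
Let mXT : measurable_fun setT (X T). Proof. exact: mX. Qed.

(* Conditionally on the path up to a passage near [u], the remaining increment [N]
   satisfies E[1 + exp (- c N); 0 <= N] = 1, because tilting its density by
   exp (- c x) reflects it. Hence E[F u; D u] is the probability of a passage,
   up to the overshoot. *)
Let F (a : R) (w : Omega) : \bar R := (1 + expR (c * (a - X T w)))%:E.
Let D (a : R) : set Omega := X T @^-1` `[a, +oo[.

Let mD a : measurable (D a).
Proof. by rewrite -[D a]setTI; apply: mXT => //; exact: measurable_itv. Qed.

Let mexp (Y : Omega -> R) b : measurable_fun setT Y ->
  measurable_fun setT (fun w => (1 + expR (c * (b - Y w)))%:E).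
Proof.
move=> mY; apply/measurable_EFinP; apply: measurable_funD => //.
apply: measurableT_comp => //; apply: measurable_funM => //.
exact: measurable_funB.
Qed.

Let mF a : measurable_fun setT (F a). Proof. exact: mexp. Qed.

Let F0 a w : (0 <= F a w)%E.
Proof. by rewrite lee_fin addr_ge0// expR_ge0. Qed.

Let mexpR (b : R) (B : set R) :
  measurable_fun B (fun x : R => (1 + expR (c * (b - x)))%:E).
Proof.
apply: measurable_funTS; apply/measurable_EFinP; apply: measurable_funD => //.
apply: measurableT_comp => //; apply: measurable_funM => //.
exact: measurable_funB.
Qed.

Let tiltE t : t < T ->
  c * Num.sqrt (v * (T - t)) ^+ 2 = 2 * (mu * (T - t)).
Proof.
move=> tT; rewrite sqr_sqrtr; last by rewrite mulr_ge0 ?subr_ge0 ?(ltW tT) ?(ltW v0).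
by rewrite /c; field; rewrite gt_eqF.
Qed.

Let sd0 t : t < T -> 0 < Num.sqrt (v * (T - t)).
Proof. by move=> tT; rewrite sqrtr_gt0 mulr_gt0// subr_gt0. Qed.

(** The case of time 0, with the whole space as past event: the process starts at 0, so the
    remaining increment is [X T]. *)
Let intF a : (\int[P]_(w in D a) F a w = (max_tail T v mu a)%:E)%E.
Proof.
have lawT A : measurable A -> P (setT `&` X T @^-1` A) =
    (P setT * normal_prob (mu * (T - 0)) (Num.sqrt (v * (T - 0))) A)%E.
  move=> mA; rewrite setTI probability_setT mul1e -lawX//.
  have -> // : last_inc X T 0 = X T.
  by apply/funext => w; rewrite /last_inc X0 subr0.
have := @ge0_integral_indep _ _ _ _ (measurableTypeR R) P (normal_prob (mu * (T - 0)) (Num.sqrt (v * (T - 0))))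
  (X T) setT `[a, +oo[%classic
  (fun x => (1 + expR (c * (a - x)))%:E) measurableT mXT lawT (measurable_itv _)
  (@mexpR a _) _.
rewrite setTI probability_setT mul1e => ->; last first.
  by move=> x _; rewrite lee_fin addr_ge0// expR_ge0.
by rewrite integral_normal_reflection ?sd0 ?tiltE// subr0.
Qed.

Let J e u n k : \bar R := (\int[P]_(w in first_passage X T u e n k `&`
    last_inc X T (grid T n k) @^-1` `[0%R, +oo[)
  (1 + expR (c * (0 - (X T w - X (grid T n k) w))))%:E)%E.

Let mfp e u n k : measurable (first_passage X T u e n k).
Proof. exact: measurable_first_passage. Qed.

Let mN n k : (k <= n.+1)%N -> measurable_fun setT (last_inc X T (grid T n k)).
Proof. by move=> kn; apply: measurable_funB => //; apply: mX; apply: grid_itv. Qed.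

(** Independence factors out the first passage, and the remaining normal expectation is 1. The index
    [n.+1] is left out: no time remains there, and the increment is not normal but 0. *)
Let JE e u n k : (k <= n)%N -> J e u n k = P (first_passage X T u e n k).
Proof.
move=> kn; have kn1 : (k <= n.+1)%N by exact: leqW.
have gT : grid T n k < T.
  by rewrite -[ltRHS](gridT T n) /grid ltr_pM2r ?invr_gt0// ltr_pM2r// ltr_nat ltnS.
have law A : measurable A -> P (first_passage X T u e n k `&`
    last_inc X T (grid T n k) @^-1` A) = (P (first_passage X T u e n k) *
    normal_prob (mu * (T - grid T n k)) (Num.sqrt (v * (T - grid T n k))) A)%E.
  move=> mA; rewrite indX//; last exact: first_passage_past.
  by rewrite lawX// grid_ge0.
rewrite /J (@ge0_integral_indep _ _ _ _ (measurableTypeR R) P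
  (normal_prob (mu * (T - grid T n k)) (Num.sqrt (v * (T - grid T n k))))
  (last_inc X T (grid T n k)) _ `[0%R, +oo[%classic
  (fun x => (1 + expR (c * (0 - x)))%:E) (mfp _ _ _ _) (mN kn1) law)//; last first.
  exact: (@mexpR 0 _).
rewrite integral_normal_reflection ?sd0 ?tiltE// subr0 mulr0 expR0 mul1r oppr0.
by rewrite sub0r mulNr PhiN mule1.
Qed.

(** At the final index the integrand is 2, so only an inequality survives. *)
Let fp_J e u n k : (k <= n.+1)%N -> (P (first_passage X T u e n k) <= J e u n k)%E.
Proof.
rewrite leq_eqVlt => /predU1P[->|]; last by rewrite ltnS => /JE ->.
rewrite /J (_ : _ `&` _ = first_passage X T u e n n.+1); last first.
  apply/seteqP; split => w; first by case.
  by move=> h; split => //=; rewrite /last_inc gridT subrr in_itv/= lexx.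
rewrite -(mul1e (P _)) -(@integral_cst _ _ _ P _ (mfp e u n n.+1)).
apply: ge0_le_integral => //.
- apply: measurable_funTS; apply: (@mexp (fun w => X T w - X (grid T n n.+1) w)).
  exact: mN.
- by move=> w _; rewrite lee_fin lerDl expR_ge0.
Qed.

(** The cost of replacing, inside the tilt, the position at the passage by [u] or by [u + e]. *)
Let C e := expR (`|c| * e).

(** A nonnegative increment after a passage ends at or above [u]. The passages being disjoint, their
    tilted masses add up to at most E[F u; D u], up to the factor [C e]. *)
Let lower e u n : 0 < e ->
  (P (passage X T u e n) <= (C e * max_tail T v mu u)%:E)%E.
Proof.
move=> e0; rewrite EFinM -intF.
have -> : P (passage X T u e n) =
    (\sum_(k <- iota 0 n.+2) P (first_passage X T u e n k))%E.
  have := @ge0_integral_passage _ _ _ X T u e mX T0' P n setT (cst 1%E) measurableT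
    (measurable_cst _) _.
  rewrite setIT integral_cst ?mul1e; last exact: measurable_passage.
  move=> -> //; apply: eq_bigr => k _.
  by rewrite setIT integral_cst ?mul1e.
apply: (@le_trans _ _ ((C e)%:E *
    \int[P]_(w in passage X T u e n `&` D u) F u w))%E; last first.
  rewrite lee_wpmul2l ?lee_fin ?expR_ge0//.
  apply: ge0_subset_integral => //.
  - by apply: measurableI => //; exact: measurable_passage.
  - exact: measurable_funTS.
rewrite (@ge0_integral_passage _ _ _ X T u e mX T0' P n)// ge0_sume_distrr; last first.
  by move=> k _; apply: integral_ge0 => w _; exact: F0.
rewrite big_seq [leRHS]big_seq; apply: lee_sum => k.
rewrite mem_iota add0n ltnS => /= kn.
apply: (le_trans (fp_J e u kn)).
rewrite -ge0_integralZl//; last 3 first.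
- by apply: measurableI.
- exact: measurable_funTS.
- by rewrite lee_fin expR_ge0.
apply: (@le_trans _ _ (\int[P]_(w in first_passage X T u e n k `&`
    last_inc X T (grid T n k) @^-1` `[0%R, +oo[) ((C e)%:E * F u w)))%E.
  apply: ge0_le_integral => //.
  - apply: measurableI => //; rewrite -[X in measurable X]setTI.
    by apply: mN => //; exact: measurable_itv.
  - apply: measurable_funTS; apply: (@mexp (fun w => X T w - X (grid T n k) w)).
    exact: mN.
  - apply: measurable_funTS; apply: emeasurable_funM => //.
  - move=> w [[_ [/andP[uX Xue] _]] _]; rewrite /F -EFinM lee_fin
      [C e * (1 + _)]mulrDr mulr1 /C -expRD.
    apply: lerD; first by rewrite -expR0 ler_expR mulr_ge0// ltW.
    rewrite ler_expR -lerBlDr.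
    have -> : c * (0 - (X T w - X (grid T n k) w)) - c * (u - X T w) =
      c * (X (grid T n k) w - u) by ring.
    rewrite (le_trans (ler_norm _))// normrM ler_wpM2l// ger0_norm ?subr_ge0//.
    by rewrite lerBlDl ltW.
apply: ge0_subset_integral => //.
- apply: measurableI => //; rewrite -[X in measurable X]setTI.
  by apply: mN => //; exact: measurable_itv.
- exact: measurableI.
- by apply: measurable_funTS; exact: emeasurable_funM.
- by move=> w _; rewrite mule_ge0 ?lee_fin ?expR_ge0.
- move=> w [h]; split => //; case: h => _ [/andP[uX _] _].
  by move: b; rewrite /D/= !in_itv/= !andbT subr_ge0; exact: le_trans.
Qed.

(** Conversely, a path that ends at or above [u + e] has a nonnegative increment after its passage,
    since the passage itself lies below [u + e]. *)
Let upper e u n : 0 < e ->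
  (\int[P]_(w in passage X T u e n `&` D (u + e)) F (u + e) w <=
   (C e)%:E * P (passage X T u e n))%E.
Proof.
move=> e0.
have -> : P (passage X T u e n) =
    (\sum_(k <- iota 0 n.+2) P (first_passage X T u e n k))%E.
  have := @ge0_integral_passage _ _ _ X T u e mX T0' P n setT (cst 1%E) measurableT
    (measurable_cst _) _.
  rewrite setIT integral_cst ?mul1e; last exact: measurable_passage.
  move=> -> //; apply: eq_bigr => k _.
  by rewrite setIT integral_cst ?mul1e.
rewrite (@ge0_integral_passage _ _ _ X T u e mX T0' P n)// ge0_sume_distrr; last first.
  by move=> k _; exact: measure_ge0.
rewrite big_seq [leRHS]big_seq; apply: lee_sum => k.
rewrite mem_iota add0n ltnS => /=; rewrite leq_eqVlt => /predU1P[->|].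
  (* At the final index the passage value is X T w itself, which is below [u + e]: the event is
     empty. *)
  rewrite (_ : _ `&` _ = set0) ?integral_set0 ?mule_ge0 ?lee_fin ?expR_ge0//.
  apply/seteqP; split => // w [[_ [/andP[_ +] _]]].
  by rewrite /D/= gridT in_itv/= andbT ltNge => /negP.
rewrite ltnS => kn; have kn1 : (k <= n.+1)%N by exact: leqW.
rewrite -(JE e u kn) /J -ge0_integralZl//; last 3 first.
- apply: measurableI => //; rewrite -[X in measurable X]setTI.
  by apply: mN => //; exact: measurable_itv.
- apply: measurable_funTS; apply: (@mexp (fun w => X T w - X (grid T n k) w)).
  exact: mN.
- by rewrite lee_fin expR_ge0.
have sub : first_passage X T u e n k `&` D (u + e) `<=`
    first_passage X T u e n k `&` last_inc X T (grid T n k) @^-1` `[0%R, +oo[.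
  move=> w [h DX]; split => //; case: h => _ [/andP[_ Xu] _].
  by move: DX; rewrite /D/= !in_itv/= !andbT subr_ge0; apply: le_trans; exact: ltW.
have mG : measurable_fun setT (fun w => (1 + expR (c * (0 - (X T w - X (grid T n k) w))))%:E).
  by apply: (@mexp (fun w => X T w - X (grid T n k) w)); exact: mN.
apply: (@le_trans _ _ (\int[P]_(w in first_passage X T u e n k `&` D (u + e))
   ((C e)%:E * (1 + expR (c * (0 - (X T w - X (grid T n k) w))))%:E)))%E; last first.
  apply: ge0_subset_integral => //.
  - exact: measurableI.
  - apply: measurableI => //; rewrite -[X in measurable X]setTI.
    by apply: mN => //; exact: measurable_itv.
  - by apply: measurable_funTS; exact: emeasurable_funM.
  - by move=> w _; rewrite -EFinM lee_fin mulr_ge0 ?addr_ge0 ?expR_ge0.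
apply: ge0_le_integral => //.
- exact: measurableI.
- exact: measurable_funTS.
- by apply: measurable_funTS; exact: emeasurable_funM.
- move=> w [[_ [/andP[uX Xue] _]] _]; rewrite /F -EFinM lee_fin
      [C e * (1 + _)]mulrDr mulr1 /C -expRD.
  apply: lerD; first by rewrite -expR0 ler_expR mulr_ge0// ltW.
  rewrite ler_expR -lerBlDr.
  have -> : c * (u + e - X T w) - c * (0 - (X T w - X (grid T n k) w)) =
    c * (u + e - X (grid T n k) w) by ring.
  rewrite (le_trans (ler_norm _))// normrM ler_wpM2l// ger0_norm ?subr_ge0 ?(ltW Xue)//.
  by rewrite lerBlDr (addrC e) lerD2r.
Qed.

Let mMgt (x : R) : measurable [set w | x < M w].
Proof.
have -> : [set w | x < M w] = M @^-1` `]x, +oo[.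
  by apply/seteqP; split => w /=; rewrite in_itv/= andbT.
by rewrite -[X in measurable X]setTI; apply: mM => //; exact: measurable_itv.
Qed.

Let mMge (x : R) : measurable [set w | x <= M w].
Proof.
have -> : [set w | x <= M w] = M @^-1` `[x, +oo[.
  by apply/seteqP; split => w /=; rewrite in_itv/= andbT.
by rewrite -[X in measurable X]setTI; apply: mM => //; exact: measurable_itv.
Qed.

Let ev e u w : 0 < e -> 0 < u -> u < M w -> \forall n \near \oo, passage X T u e n w.
Proof.
move=> e0 u0 uM; apply: passage_eventually => //; first by rewrite X0.
by have [t tT tE] := MX w; exists t; rewrite ?tE.
Qed.

Let lower_max e u : 0 < e -> 0 < u ->
  (P [set w | (u < M w)%R] <= (C e * max_tail T v mu u)%:E)%E.
Proof.
move=> e0 u0.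
have := @cvg_measure_eventually_in _ _ _ P [set w | u < M w] (passage X T u e)
  (mMgt u) (measurable_passage u e mX T0') (fun w => @ev e u w e0 u0).
move=> /cvge_to_le; apply; apply: nearW => n.
apply: le_trans (lower u n e0); apply: le_measure; rewrite ?inE//.
- by apply: measurableI => //; exact: measurable_passage.
- exact: measurable_passage.
Qed.

Let upper_max e u : 0 < e -> 0 < u ->
  ((max_tail T v mu (u + e))%:E <= (C e)%:E * P [set w | (u <= M w)%R])%E.
Proof.
move=> e0 u0.
have sub w : D (u + e) w -> u < M w.
  rewrite /D/= in_itv/= andbT => h; apply: (@lt_le_trans _ _ (X T w)).
    by rewrite (lt_le_trans _ h)// ltrDl.
  exact: XM.
have Fi : P.-integrable (D (u + e)) (F (u + e)).
  apply/integrableP; split; first exact: measurable_funTS.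
  under eq_integral => w _ do rewrite gee0_abs//.
  by rewrite intF ltry.
have := @cvg_integral_eventually_in _ _ _ P (D (u + e)) (passage X T u e) (F (u + e))
  (mD _) (measurable_passage u e mX T0') Fi (fun w h => @ev e u w e0 u0 (sub w h)).
rewrite intF => /cvge_to_le; apply; apply: nearW => n; rewrite setIC.
apply: le_trans (upper u n e0) _; rewrite lee_wpmul2l ?lee_fin ?expR_ge0//.
apply: le_measure; rewrite ?inE//; first exact: measurable_passage.
move=> w /= pw; have [[t tT uX]|//] := passage_max X u e T0' n w.
exact: le_trans uX (XM _ tT).
Qed.

Let cvgC : C e @[e --> 0^'+] --> (1 : R).
Proof.
have h : C e @[e --> 0] --> C 0.
  apply: (@continuous_comp _ _ _ (fun x => `|c| * x) expR).
    exact: mulrl_continuous.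
  exact: continuous_expR.
by apply: cvg_at_right_filter; rewrite {2}/C mulr0 expR0 in h.
Qed.

Let cvgCM y : C e * y @[e --> 0^'+] --> (y : R).
Proof. by rewrite -[X in _ --> X]mul1r; apply: cvgM cvgC _; exact: cvg_cst. Qed.

Let cvg_tail x : max_tail T v mu (x + e) @[e --> 0^'+] --> max_tail T v mu x.
Proof.
have h : max_tail T v mu (x + e) @[e --> 0] --> max_tail T v mu (x + 0).
  apply: (@continuous_comp _ _ _ (fun e => x + e) (max_tail T v mu)).
    by apply: cvgD; [exact: cvg_cst|exact: cvg_id].
  exact: continuous_max_tail.
by apply: cvg_at_right_filter; rewrite addr0 in h.
Qed.

(** As [e] decreases to 0 the bounds become P(M > u) <= max_tail u and max_tail u <= P(M >= u). The
    second one is used at [u + e], where M >= u + e implies M > u, and the continuity of [max_tail]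
    concludes. *)
Lemma law_max u : 0 < u -> P [set w | (u < M w)%R] = (max_tail T v mu u)%:E.
Proof.
move=> u0.
pose pgt x := fine (P [set w | x < M w]).
pose pge x := fine (P [set w | x <= M w]).
have pgtE x : P [set w | x < M w] = (pgt x)%:E by rewrite fineK// fin_num_measure.
have pgeE x : P [set w | x <= M w] = (pge x)%:E by rewrite fineK// fin_num_measure.
rewrite pgtE; congr EFin; apply/eqP; rewrite eq_le; apply/andP; split.
  apply: (cvgr_to_ge (@cvgCM (max_tail T v mu u))).
  near=> e; rewrite -lee_fin -pgtE; apply: lower_max => //.
have hge x : 0 < x -> max_tail T v mu x <= pge x.
  move=> x0.
  apply: (ler_cvg_to (@cvg_tail x) (@cvgCM (pge x))); near=> e; rewrite -lee_fin EFinM -pgeE.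
  exact: upper_max.
apply: (cvgr_to_le (@cvg_tail u)); near=> e.
have ue0 : 0 < u + e by rewrite addr_gt0.
apply: (le_trans (hge _ ue0)); rewrite -lee_fin -pgeE -pgtE.
apply: le_measure; rewrite ?inE// => w /=; apply: lt_le_trans.
by rewrite ltrDl.
Unshelve. all: by end_near. Qed.

End Reflection.

(** * Linear combinations of the Brownian motion *)

(** [B] vanishes at time 0 only almost surely; subtracting the initial values makes the process
    start at 0 on every path. *)
Definition lin_proc (R : realType) (Omega : Type) (d : nat)
    (B : 'I_d -> R -> Omega -> R) (a : 'rV[R]_d) (mu t : R) (w : Omega) : R :=
  mu * t + \sum_(j < d) a 0 j * (B j t w - B j 0 w).

Lemma preimage_measure_unique d1 d2 (T1 : measurableType d1) (T2 : measurableType d2)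
    (R : realType) (m1 : probability T1 R) (m2 : probability T2 R) (phi : T1 -> T2)
    (G : set (set T2)) (g : (set T2)^nat) :
  measurable_fun setT phi -> measurable = <<s G >> -> setI_closed G ->
  (forall i, G (g i)) -> \bigcup_k (g k) = setT ->
  (forall A, G A -> m1 (phi @^-1` A) = m2 A) ->
  forall A, measurable A -> m1 (phi @^-1` A) = m2 A.
Proof.
move=> mphi mG GI Gg gT m12 A mA.
pose f : {mfun _ >-> _} := mfun_Sub (mem_set mphi).
have := @measure_unique _ R T2 G g mG GI Gg gT (pushforward m1 f) m2 m12 _ A mA.
apply => k; have mgk : measurable (g k) by rewrite mG; exact: sub_sigma_algebra.
change (m1 (phi @^-1` g k) < +oo)%E.
by rewrite (m12 _ (Gg k)) -ge0_fin_numE// fin_num_measure.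
Qed.

(** It is enough to compare half-open intervals, whose masses are differences of values of [Phi]. *)
Lemma normal_prob_shift (R : realType) (m s b : R) (A : set R) : 0 < s ->
  measurable A ->
  normal_prob m s ((fun x => b + x) @^-1` A) = normal_prob (b + m) s A.
Proof.
move=> s0 mA.
have mf : measurable_fun setT ((fun x => b + x) : measurableTypeR R -> measurableTypeR R).
  exact: measurable_funD.
have ocE m' (x y : R) : x <= y -> (normal_prob m' s `]x, y] =
    (Phi ((y - m') / s))%:E - (Phi ((x - m') / s))%:E)%E.
  move=> xy; rewrite -!normal_probNy//.
  have -> : `]x, y]%classic = `]-oo, y] `\` `]-oo, x].
    by rewrite -[RHS]setCK setCD setCitvl setUC -[LHS]setCK setCitv.
  by rewrite measureD ?setIidr//; [exact: subset_itvl|rewrite -ge0_fin_numE// fin_num_measure].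
apply: (@preimage_measure_unique _ _ (measurableTypeR R) (measurableTypeR R) R
  (normal_prob m s) (normal_prob (b + m) s) (fun x => b + x) (@ocitv R)
  (fun k => `](- k%:R), k%:R]%classic)) => //.
- by move=> X Y; exact: ocitvI.
- by move=> i; exists (- i%:R, i%:R).
- apply/seteqP; split => // x _ /=.
  exists (Num.truncn `|x|).+1 => //=; rewrite in_itv/=.
  by have := truncnS_gt `|x|; rewrite ltr_norml => /andP[-> /ltW ->].
- move=> _ [[x y] _ <-]/=; have [xy|yx] := leP x y; last first.
    by rewrite set_itv_ge ?measure0// bnd_simp -leNgt ltW.
  rewrite (_ : _ @^-1` _ = `]x - b, y - b]%classic).
    by rewrite !ocE ?lerD2r// !opprD !addrA.
  by apply/seteqP; split => z /=; rewrite !in_itv/= ltrBlDl lerBrDl.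
Qed.

Section BrownianLin.
Context {R : realType} dO {Omega : measurableType dO} (P : probability Omega R).
Variables (d : nat) (Sigma : 'M[R]_d) (B : 'I_d -> R -> Omega -> R).
Hypothesis hB : brownian_motion P Sigma B.
Variables (a : 'rV[R]_d) (mu : R).

Let X := lin_proc B a mu.

Lemma lin_proc0 w : X 0 w = 0.
Proof.
by rewrite /X /lin_proc mulr0 add0r big1// => j _; rewrite subrr mulr0.
Qed.

Lemma measurable_lin_proc t : 0 <= t -> measurable_fun setT (X t).
Proof.
move=> t0; have [mB _ _ _ _] := hB.
apply: measurable_funD => //; apply: measurable_sum => j.
by apply: measurable_funM => //; apply: measurable_funB; exact: mB.
Qed.

Lemma continuous_lin_proc T w : {within `[0, T], continuous (fun t => X t w)}.
Proof.
have [_ _ cB _ _] := hB.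
have cX : {within `[0, +oo[, continuous (fun t => X t w)}.
  have ci : {within `[0, +oo[, continuous (fun t => mu * t)}.
    by apply: continuous_subspaceT; exact: mulrl_continuous.
  have cs (l : seq 'I_d) : {within `[0, +oo[, continuous
      (fun t => \sum_(j <- l) a 0 j * (B j t w - B j 0 w))}.
    elim: l => [|j l IH].
      rewrite (_ : (fun t => _) = cst 0); first by move=> t; exact: cvg_cst.
      by apply/funext => t; rewrite big_nil.
    rewrite (_ : (fun t => _) = (fun t => a 0 j * (B j t w - B j 0 w) +
      \sum_(j <- l) a 0 j * (B j t w - B j 0 w))); last first.
      by apply/funext => t; rewrite big_cons.
    move=> t; apply: cvgD; last exact: IH.
    by apply: cvgMr; apply: cvgB; [exact: cB|exact: cvg_cst].
  by move=> t; apply: cvgD; [exact: ci|exact: cs].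
apply: continuous_subspaceW cX => t.
by rewrite /= !in_itv/= andbT => /andP[].
Qed.

Lemma last_inc_lin_proc T s w : last_inc X T s w =
  mu * (T - s) + \sum_(j < d) a 0 j * (B j T w - B j s w).
Proof.
rewrite /last_inc /X /lin_proc opprD addrACA -mulrBr; congr (_ + _).
by rewrite -sumrB; apply: eq_bigr => j _; ring.
Qed.

Lemma law_lin_proc T s : 0 <= s -> s < T -> 0 < quad_form Sigma a ->
  forall A, measurable A -> P (last_inc X T s @^-1` A) =
  normal_prob (mu * (T - s)) (Num.sqrt (quad_form Sigma a * (T - s))) A.
Proof.
move=> s0 sT v0 A mA; have [_ _ _ _ gB] := hB.
have Ts : 0 < T - s by rewrite subr_gt0.
have mf : measurable_fun setT ((fun x => mu * (T - s) + x) : measurableTypeR R -> measurableTypeR R).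
  exact: measurable_funD.
have mA' : measurable ((fun x : R => mu * (T - s) + x) @^-1` A).
  by rewrite -[X in measurable X]setTI; exact: mf.
have [_ /(_ a _ mA') h] := gB s T s0 (ltW sT).
have qE : quad_form ((T - s) *: Sigma) a = quad_form Sigma a * (T - s).
  by rewrite /quad_form -scalemxAr -scalemxAl mxE mulrC.
rewrite /normal_law qE gt_eqF ?mulr_gt0// normal_prob_shift// in h; last first.
  by rewrite sqrtr_gt0 mulr_gt0.
rewrite addr0 in h; rewrite -h; congr (P _); apply/seteqP.
by split => w /=; rewrite last_inc_lin_proc.
Qed.

(** Grid positions are sums of increments, so the past lies in the sigma-algebra generated by the
    pi-system [G] of intersections of increment events. On [G] the product rule is the independence
    of increments; uniqueness of measures extends it. *)
Lemma indep_lin_proc T n k E A : 0 <= T -> (k <= n.+1)%N ->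
  g_sigma_preimage (fun j : 'I_k.+1 => X (grid T n j)) E -> measurable A ->
  P (E `&` last_inc X T (grid T n k) @^-1` A) =
  (P E * P (last_inc X T (grid T n k) @^-1` A))%E.
Proof.
move=> T0 kn pastE mA; have [mB _ _ iB _] := hB.
(* After index [k] the partition jumps to [T], so that its increment number [k] is the last one. *)
pose t j := if (j <= k)%N then grid T n j else T.
have tk j : (j <= k)%N -> t j = grid T n j by rewrite /t => ->.
have tk1 : t k.+1 = T by rewrite /t ltnn.
have grT j : (j <= k)%N -> grid T n j <= T.
  move=> jk; have := @grid_itv R T T0 n j (leq_trans jk kn).
  by rewrite in_itv/= => /andP[].
have t0 j : 0 <= t j by rewrite /t; case: ifP => // _; exact: grid_ge0.
have tmono : {homo t : i j / (i <= j)%N >-> i <= j}.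
  move=> i j ij; rewrite /t; case: (leqP i k) => ik; case: (leqP j k) => jk //.
  - exact: le_grid.
  - exact: grT.
  - by have := leq_trans ik (leq_trans ij jk); rewrite ltnn.
pose S j : set (set Omega) :=
  g_sigma_preimage (fun i : 'I_d => B i (t j.+1) \- B i (t j)).
have SB i j (C : set R) : measurable C ->
    S j ((B i (t j.+1) \- B i (t j)) @^-1` C).
  move=> mC; have Si := ltn_ord i; apply: sub_sigma_algebra.
  have : preimage_set_system setT (B i (t j.+1) \- B i (t j)) measurable
     ((B i (t j.+1) \- B i (t j)) @^-1` C) by exists C => //; rewrite setTI.
  (* [inord] needs a nonempty index type; the index [i] excludes [d = 0]. *)
  clear -i; case: d i B => [[]//|d'] i B' h.
  rewrite -bigcup_mkord_ord; exists (nat_of_ord i); first by case: (i).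
  by rewrite inord_val.
have ST j : S j setT by apply: (@measurableT _ (g_sigma_algebraType _)).
have SI j C D : S j C -> S j D -> S j (C `&` D).
  exact: (@measurableI _ (g_sigma_algebraType _)).
have Sm j C : S j C -> measurable C.
  apply: smallest_sub; first exact: sigma_algebra_measurable.
  move=> C'; clear -mB t0; case: d B mB => [|d'] B' mB'; first by rewrite big_ord0.
  rewrite -bigcup_mkord_ord => -[l _ [C'' mC'' <-]].
  apply: measurable_funB => //; exact: mB'.
pose F := last_inc X T (grid T n k) @^-1` A.
have inc j : (j <= k)%N -> S j ((fun w => \sum_(i < d) a 0 i *
    (B i (t j.+1) w - B i (t j) w)) @^-1` ((fun x => mu * (T - grid T n k) + x) @^-1` A)).
  move=> jk; have := @measurable_sum _ (g_sigma_algebraType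
    (\big[setU/set0]_(i < d) preimage_set_system setT (B i (t j.+1) \- B i (t j)) measurable))
    R setT _ (index_enum _)
    (fun (i : 'I_d) w => a 0 i * (B i (t j.+1) w - B i (t j) w)) _ measurableT
    ((fun x => mu * (T - grid T n k) + x) @^-1` A).
  rewrite setTI; apply.
    move=> i; apply: measurable_funM => // _ C mC.
    by rewrite setTI; exact: SB.
  have mf : measurable_fun setT ((fun x => mu * (T - grid T n k) + x) :
    measurableTypeR R -> measurableTypeR R) by exact: measurable_funD.
  by rewrite -[X in measurable X]setTI; exact: mf.
have SF : S k F.
  have := inc k (leqnn k); rewrite tk1 tk//.
  by congr (S k _); apply/seteqP; split => w; rewrite /F /= last_inc_lin_proc.
have mF : measurable F := Sm _ _ SF.
pose G := [set C : set Omega | exists E_ : nat -> set Omega,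
  (forall j, (j < k)%N -> S j (E_ j)) /\ C = \bigcap_(j in `I_k) E_ j].
have prodP (E_ : nat -> set Omega) (F' : set Omega) :
    (forall j, (j < k)%N -> S j (E_ j)) -> S k F' ->
    (P ((\bigcap_(j in `I_k) E_ j) `&` F') = (\prod_(j < k) P (E_ j)) * P F')%E.
  move=> SE SF'.
  pose E' (j : 'I_k.+1) := if (j < k)%N then E_ j else F'.
  have <- : (\prod_(j < k.+1) P (E' j) = (\prod_(j < k) P (E_ j)) * P F')%E.
    rewrite big_ord_recr/=; congr (_ * _)%E.
      by apply: eq_bigr => j _; rewrite /E'/= ltn_ord.
    by rewrite /E'/= ltnn.
  rewrite -(iB k.+1 t E' (t0 0%N) tmono).
    congr (P _); apply/seteqP; split => w.
      move=> [h hF] j _; rewrite /E'; case: ifPn => // jk; exact: h.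
    move=> h; split.
      move=> j /= jk; have := h (Ordinal (leqW jk)) Logic.I.
      by rewrite /E'/= jk.
    by have := h ord_max Logic.I; rewrite /E'/= ltnn.
  move=> j; rewrite /E'; case: ifPn => [jk|]; first exact: SE.
  rewrite -leqNgt => kj; have -> : nat_of_ord j = k.
    by apply/eqP; rewrite eqn_leq kj -ltnS ltn_ord.
  exact: SF'.
have mG : G `<=` measurable.
  move=> _ [E_ [SE ->]]; apply: bigcap_measurableType => j /= jk.
  exact: Sm (SE j jk).
have SG : <<s G >> E.
  pose GT := g_sigma_algebraType G.
  have incG j : (j < k)%N -> @measurable_fun _ _ GT R setT
      (fun w : Omega => \sum_(i < d) a 0 i * (B i (t j.+1) w - B i (t j) w)).
    move=> jk; apply: measurable_sum => i; apply: measurable_funM => // _ C mC.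
    rewrite setTI; apply: sub_sigma_algebra.
    exists (fun l => if l == j then (B i (t j.+1) \- B i (t j)) @^-1` C else setT).
    split; first by move=> l lk; case: eqP => [->|_]; [exact: SB|exact: ST].
    apply/seteqP; split => w /=; first by move=> h l _; case: eqP.
    by move=> /(_ j jk); rewrite /= eqxx.
  have XG j : (j <= k)%N -> @measurable_fun _ _ GT R setT (X (grid T n j)).
    elim: j => [_|j IH jk].
      have -> : X (grid T n 0) = cst 0.
        by apply/funext => w; rewrite grid0 lin_proc0.
      exact: measurable_cst.
    have -> : X (grid T n j.+1) = (fun w => X (grid T n j) w +
        (mu * (grid T n j.+1 - grid T n j) +
         \sum_(i < d) a 0 i * (B i (t j.+1) w - B i (t j) w))).
      apply/funext => w; rewrite !tk//; last exact: ltnW.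
      by rewrite -last_inc_lin_proc /last_inc addrC subrK.
    apply: measurable_funD; first exact: IH (ltnW jk).
    by apply: measurable_funD => //; exact: incG.
  move: pastE; apply: smallest_sub; first exact: smallest_sigma_algebra.
  move=> C; rewrite -bigcup_mkord_ord => -[l lk [C' mC' <-]].
  apply: (XG (@inord k l)) => //.
  by rewrite -ltnS ltn_ord.
have PF0 : 0 <= fine (P F) by exact: fine_ge0.
(* The finite measures compared send C to P(C and F) and to P(F) P(C). *)
have := @g_sigma_algebra_measure_unique _ R Omega G mG (fun=> setT) _ _
  (mrestr P mF) (mscale (NngNum PF0) P) _ _ _ E SG.
rewrite /= /mrestr /mscale/= fineK ?fin_num_measure// muleC; apply.
- move=> _; exists (fun=> setT); split; first by move=> j _; exact: ST.
  by apply/seteqP; split.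
- by apply/seteqP; split => // w _; exists 0%N.
- move=> _ _ [C [SC ->]] [D [SD ->]]; exists (fun j => C j `&` D j); split.
    by move=> j jk; apply: SI; [exact: SC|exact: SD].
  by rewrite bigcapI.
- move=> _ [C [SC ->]]; rewrite prodP// muleC.
  have := prodP C setT SC (ST k); rewrite setIT probability_setT mule1 => ->.
  by [].
- by move=> _; rewrite setTI -ge0_fin_numE// fin_num_measure.
Qed.

End BrownianLin.

Section LinProcMax.
Context {R : realType} dO {Omega : measurableType dO} (P : probability Omega R).
Variables (d : nat) (Sigma : 'M[R]_d) (B : 'I_d -> R -> Omega -> R).
Hypothesis hB : brownian_motion P Sigma B.
Variable T : R.
Hypothesis T0 : 0 < T.

Let T0' : 0 <= T. Proof. exact: ltW. Qed.

Definition lin_max (a : 'rV[R]_d) (mu : R) : Omega -> R :=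
  at_time (lin_proc B a mu) (argmax_time (lin_proc B a mu) T).

Let mX a mu t : t \in `[0, T] -> measurable_fun setT (lin_proc B a mu t).
Proof. by rewrite in_itv/= => /andP[t0 _]; exact: (measurable_lin_proc hB). Qed.

Let cX a mu w : {within `[0, T], continuous (fun t => lin_proc B a mu t w)}.
Proof. exact: (continuous_lin_proc hB). Qed.

Lemma measurable_lin_max a mu : measurable_fun setT (lin_max a mu).
Proof. by apply: measurable_max => // t tT; exact: mX. Qed.

Lemma le_lin_max a mu t w : t \in `[0, T] -> lin_proc B a mu t w <= lin_max a mu w.
Proof.
move=> tT; have [s [sE _ maxs _]] := argmax_timeP T0' (@cX a mu w).
by rewrite /lin_max /at_time sE/= maxs.
Qed.

Lemma law_lin_max a mu u : 0 < quad_form Sigma a -> 0 < u ->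
  P [set w | (u < lin_max a mu w)%R] =
  (max_tail T (quad_form Sigma a) mu u)%:E.
Proof.
move=> a0 u0; apply: (@law_max _ _ _ _ (lin_proc B a mu)) => //.
- by move=> t tT; exact: mX.
- by move=> w; exact: lin_proc0.
- exact: measurable_lin_max.
- move=> w; have [s [sE sT _ _]] :=
    argmax_timeP T0' (@cX a mu w).
  by exists s => //; rewrite /lin_max /at_time sE.
- by move=> w t; exact: le_lin_max.
- by move=> t t0 tT A mA; exact: (law_lin_proc hB).
- by move=> n k kn E A; exact: (indep_lin_proc hB).
Qed.

(** Read off from the law, since the formula does not show it; this is the hypothesis of
    [max_dens_factor_gt0]. *)
Lemma max_tail_ninc a mu x y : 0 < quad_form Sigma a -> 0 < x -> x <= y ->
  max_tail T (quad_form Sigma a) mu y <= max_tail T (quad_form Sigma a) mu x.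
Proof.
move=> a0 x0 xy; rewrite -lee_fin -!law_lin_max//; last exact: lt_le_trans xy.
have mgt z : measurable [set w | z < lin_max a mu w].
  have -> : [set w | z < lin_max a mu w] = lin_max a mu @^-1` `]z, +oo[.
    by apply/seteqP; split => w /=; rewrite in_itv/= andbT.
  by rewrite -[X in measurable X]setTI; exact: measurable_lin_max.
by apply: le_measure; rewrite ?inE//= => w /=; exact: le_lt_trans.
Qed.

Lemma max_dens_factor_lin_gt0 a mu u : 0 < quad_form Sigma a -> 0 < u ->
  0 < max_dens_factor T (quad_form Sigma a) mu u.
Proof. by move=> a0; apply: max_dens_factor_gt0 => // x y; exact: max_tail_ninc. Qed.

(* Positivity of the density of the maximum at drift [sqrt (v / T)] is Mills'
   inequality. *)
Lemma Phi_le_pdf a (y : R) : 0 < quad_form Sigma a -> 1 < y ->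
  Phi (- y) <= normal_pdf 0 1 y.
Proof.
move=> v0 y1; set v := quad_form Sigma a in v0; pose s := Num.sqrt (v * T).
have s0 : 0 < s by rewrite sqrtr_gt0 mulr_gt0.
(* With the drift mu = s / T, this point u satisfies (- u - mu T) / s = - y; the condition y > 1 is
   u > 0. *)
have u0 : 0 < s * (y - 1) by rewrite mulr_gt0// subr_gt0.
have := max_dens_factor_lin_gt0 (s / T) v0 u0; rewrite /max_dens_factor -/v -/s.
have sn0 : s != 0 by rewrite gt_eqF.
have Tn0 : T != 0 by rewrite gt_eqF.
have -> : (- (s * (y - 1)) - s / T * T) / s = - y by field; rewrite sn0 Tn0.
have pN : normal_pdf (0 : R) 1 (- y) = normal_pdf 0 1 y.
  by rewrite !normal_pdf01E sqrrN.
have -> : v * normal_pdf 0 1 (- y) / s - s / T * Phi (- y) =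
   s / T * (normal_pdf 0 1 y - Phi (- y)).
  rewrite pN mulrBr; congr (_ - _).
  have -> : v = s ^+ 2 / T by rewrite sqr_sqrtr ?mulfK// mulr_ge0// ltW.
  by field; rewrite sn0 Tn0.
by rewrite pmulr_rgt0 ?divr_gt0// subr_gt0 => /ltW.
Qed.

End LinProcMax.

(** * Clipped expectations and their one-sided comparison *)

Definition clip (R : realType) (a b x : R) : R := Num.min (Num.max x a) b.

Section Clip.
Context {R : realType}.
Implicit Types a b x y : R.

Lemma clip_itv a b x : a <= b -> a <= clip a b x <= b.
Proof. by move=> ab; rewrite /clip le_min le_max lexx orbT/= ab ge_min lexx orbT. Qed.

Lemma le_clip a b : {homo clip a b : x y / x <= y}.
Proof. by move=> x y xy; rewrite /clip le_min2// le_max2. Qed.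

Lemma clip_dist a b x y : `|clip a b x - clip a b y| <= `|x - y|.
Proof.
wlog xy : x y / x <= y.
  by move=> h; have [/h//|/ltW /h] := leP x y; rewrite distrC (distrC y).
rewrite distrC (distrC x) !ger0_norm ?subr_ge0 ?le_clip//.
rewrite /clip /Num.min /Num.max.
by case: ifPn; case: ifPn; case: ifPn; case: ifPn; rewrite -?leNgt; lra.
Qed.

Lemma clip_lt a b x : a <= b -> x < a -> clip a b x = a.
Proof. by move=> ab xa; rewrite /clip max_r ?ltW// min_l. Qed.

Lemma clip_gt a b x : a <= b -> b < x -> clip a b x = b.
Proof. by move=> ab bx; rewrite /clip min_r// le_max ltW. Qed.

Lemma clip_in a b x : a <= x <= b -> clip a b x = x.
Proof. by move=> /andP[ax xb]; rewrite /clip max_l// min_l. Qed.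

Lemma measurable_clip a b : measurable_fun setT (clip a b).
Proof. by apply: measurable_minr => //; exact: measurable_maxr. Qed.

End Clip.

Section ClipExpectation.
Context {R : realType} dO {Omega : measurableType dO} (P : probability Omega R).
Variables (a b : R).
Hypothesis ab : a < b.
Implicit Types Y : Omega -> R.

Local Notation mu := (@lebesgue_measure R).

Lemma measurable_clip_comp Y : measurable_fun setT Y ->
  measurable_fun setT (fun w => clip a b (Y w)).
Proof. by move=> mY; apply: measurableT_comp => //; exact: measurable_clip. Qed.

Lemma integrable_clip Y : measurable_fun setT Y ->
  P.-integrable setT (fun w => (clip a b (Y w))%:E).
Proof.
move=> mY; apply: measurable_bounded_integrable => //.
- by rewrite -ge0_fin_numE// fin_num_measure.
- exact: measurable_clip_comp.
exists (`|a| + `|b|); split; first exact: num_real.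
move=> M hM w _ /=; rewrite (le_trans _ (ltW hM))//.
have /andP[h1 h2] := @clip_itv _ a b (Y w) (ltW ab).
rewrite ler_norml; apply/andP; split.
  rewrite (le_trans _ h1)// lerNl (le_trans (ler_norm _))// normrN lerDl.
  exact: normr_ge0.
by rewrite (le_trans h2)// (le_trans (ler_norm _))// lerDr.
Qed.

(** Layer cake: clip - a is the length of the part of [a, b] below [Y w], and Tonelli exchanges the
    integrals. Only the tail of [Y] on [a, b] enters, which for maxima is [max_tail]. *)
Lemma expectation_clip Y : measurable_fun setT Y ->
  \int[P]_w clip a b (Y w) =
  a + \int[mu]_(x in `[a, b]) fine (P [set w | x < Y w]).
Proof.
move=> mY.
have mK : measurable_fun setT (fun w => (clip a b (Y w) - a)%:E).
  by apply/measurable_EFinP; apply: measurable_funB => //; exact: measurable_clip_comp.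
have mgt x : measurable [set w | x < Y w].
  have -> : [set w | x < Y w] = Y @^-1` `]x, +oo[.
    by apply/seteqP; split => w /=; rewrite in_itv/= andbT.
  by rewrite -[X in measurable X]setTI; exact: mY.
have e : (\int[P]_w (clip a b (Y w) - a)%:E =
    \int[mu]_(x in `[a, b]) P [set w | (x < Y w)%R])%E.
  transitivity (\int[P]_w (\int[mu]_x (\1_(`[a, b] `&` `]-oo, Y w[) x)%:E))%E.
    apply: eq_integral => w _; rewrite integral_indic//; last exact: measurableI.
    rewrite setIT; have [Ya|aY] := leP (Y w) a.
      rewrite /clip max_r// min_l ?ltW// subrr (_ : _ `&` _ = set0) ?measure0//.
      apply/seteqP; split => // x [] /=; rewrite !in_itv/= => /andP[ax _] xY.
      by have := lt_le_trans xY (le_trans Ya ax); rewrite ltxx.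
    have [Yb|bY] := leP (Y w) b.
      rewrite /clip max_l ?(ltW aY)// min_l//.
      rewrite (_ : _ `&` _ = `[a, Y w[%classic); last first.
        apply/seteqP; split => x /=; rewrite !in_itv/=; first by case=> /andP[-> _] ->.
        by move=> /andP[-> xY]; split => //=; rewrite (le_trans (ltW xY)).
      have h := lebesgue_measure_itv `[a, Y w[; rewrite /= lte_fin aY in h.
      exact: esym h.
    rewrite /clip max_l ?(ltW aY)// min_r ?(ltW bY)//.
    rewrite (_ : _ `&` _ = `[a, b]%classic); last first.
      apply/seteqP; split => x /=; rewrite !in_itv/=; first by case=> /andP[-> ->].
      by move=> /andP[-> xb]; split => //=; rewrite (le_lt_trans xb).
    have h := lebesgue_measure_itv `[a, b]; rewrite /= lte_fin ab in h.
    exact: esym h.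
  rewrite (@fubini_tonelli _ _ _ (measurableTypeR R) R P mu
    (fun p : Omega * measurableTypeR R => (\1_(`[a, b] `&` `]-oo, Y p.1[) p.2)%:E))/=.
  - rewrite [RHS]integral_mkcond; apply: eq_integral => x _; rewrite patchE.
    case: ifPn => xab.
      transitivity (\int[P]_w (\1_[set w | x < Y w] w)%:E)%E.
        apply: eq_integral => w _; rewrite !indicE.
        have -> // : (x \in `[a, b]%classic `&` `]-oo, Y w[) = (w \in [set w | x < Y w]).
        by rewrite in_setI xab/=; apply/idP/idP; rewrite !inE.
      by rewrite integral_indic// setIT.
    apply: integral0_eq => w _; rewrite indicE memNset//= => -[xab' _].
    by move: xab; rewrite notin_setE.
  - apply/measurable_EFinP/measurable_indic.
    rewrite [X in measurable X](_ : _ = ([set: Omega] `*` `[a, b]) `&`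
      (fun p : Omega * measurableTypeR R => p.2 < Y p.1) @^-1` [set true]).
      apply: measurableI; first exact: measurableX.
      rewrite -[X in measurable X]setTI; apply: measurable_fun_ltr => //.
      exact: measurableT_comp.
    by apply/seteqP; split => p /=; rewrite !in_itv/= => -[]; [move=> ? ?|move=> [_ ?] ?].
  - by move=> p; rewrite lee_fin.
have ia : P.-integrable setT (EFin \o cst a).
  by apply: finite_measure_integrable_cst.
have -> : \int[P]_w clip a b (Y w) = a + \int[P]_w (clip a b (Y w) - a).
  rewrite RintegralB//; last exact: integrable_clip.
  rewrite Rintegral_cst// (_ : fine (P setT) = 1) ?mulr1 1?addrC ?subrK//.
  by rewrite probability_setT.
congr (_ + _); rewrite /Rintegral e; congr fine.
by apply: eq_integral => x _; rewrite fineK// fin_num_measure.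
Qed.

End ClipExpectation.

Section Touching.
Context {R : realType} dO {Omega : measurableType dO} (P : probability Omega R).
Variables (a b : R) (M V g : Omega -> R) (U : nat -> Omega -> R).
Hypotheses (ab : a < b) (mM : measurable_fun setT M) (mV : measurable_fun setT V).
Hypothesis mU : forall n, measurable_fun setT (U n).
Hypothesis gi : P.-integrable setT (EFin \o g).
Hypothesis Ug : forall n w, `|U n w| <= g w.
Hypothesis UV : forall w, U n w @[n --> \oo] --> V w.
Hypotheses (Ma : P (M @^-1` [set a]) = 0%E) (Mb : P (M @^-1` [set b]) = 0%E).

(** Difference quotient at e = 1 / (n + 1). The direction [U n] may vary with [n], because the
    rotation to which this is applied is not affine in e. *)
Let D n w := (clip a b (M w + U n w / n.+1%:R) - clip a b (M w)) * n.+1%:R.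
Let VD w := V w * \1_(M @^-1` `]a, b]) w.

Let n0 n : 0 < n.+1%:R :> R. Proof. by []. Qed.

Let D_g n w : `|D n w| <= g w.
Proof.
rewrite /D normrM (gtr0_norm (n0 n)) -ler_pdivlMr//.
rewrite (le_trans (clip_dist _ _ _ _))// addrAC subrr add0r normrM.
by rewrite (gtr0_norm (x := n.+1%:R^-1)) ?invr_gt0// ler_pM2r ?invr_gt0.
Qed.

(** The clipping is locally the identity inside ]a, b[ and locally constant outside [a, b]; the
    endpoints are the only exceptions, and [M] avoids them almost surely. *)
Let cvgD w : M w != a -> M w != b -> D n w @[n --> \oo] --> VD w.
Proof.
move=> Mwa Mwb.
have small e : 0 < e -> \forall n \near \oo, `|U n w / n.+1%:R| < e.
  (* [mesh_lt] serves here to say that g w / (n + 1) tends to 0. *)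
  move=> e0; have [N _ hN] := mesh_lt (g w) e0.
  exists N => // n Nn; rewrite normrM (gtr0_norm (x := n.+1%:R^-1)) ?invr_gt0//.
  by rewrite (le_lt_trans _ (hN n Nn))// ler_pM2r ?invr_gt0.
rewrite /VD indicE; have [Ma'|aM|Meq] := ltgtP (M w) a; last by rewrite Meq eqxx in Mwa.
  rewrite memNset ?mulr0; last by rewrite /= in_itv/= ltNge (ltW Ma').
  apply: cvg_near_cst; have aM0 : 0 < a - M w by rewrite subr_gt0.
  apply: filterS (small _ aM0) => n /ltr_normlW h.
  rewrite /D !clip_lt ?subrr ?mul0r//; try exact: ltW.
  by rewrite -ltrBrDl.
have [Mb'|bM|Meq] := ltgtP (M w) b; last by rewrite Meq eqxx in Mwb.
  rewrite mem_set ?mulr1; last by rewrite /= in_itv/= aM ltW.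
  pose e := Num.min (M w - a) (b - M w).
  have e0 : 0 < e by rewrite lt_min !subr_gt0 aM.
  apply: cvg_trans (@UV w); apply: near_eq_cvg.
  apply: filterS (small _ e0) => n; rewrite lt_min => /andP[h1 h2].
  rewrite /D !clip_in; last 2 first.
  - by rewrite !ltW.
  - move: h1 h2; rewrite !ltr_norml => /andP[h1 _] /andP[_ h2].
    apply/andP; split; last by rewrite -lerBrDl ltW.
    by rewrite -lerBlDl (le_trans _ (ltW h1))// opprB.
  by rewrite addrAC subrr add0r mulfVK// gt_eqF.
rewrite memNset ?mulr0; last by rewrite /= in_itv/= leNgt bM andbF.
apply: cvg_near_cst; have bM0 : 0 < M w - b by rewrite subr_gt0.
apply: filterS (small _ bM0) => n; rewrite ltr_norml => /andP[h _].
rewrite /D !clip_gt ?subrr ?mul0r//; try exact: ltW.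
by rewrite -ltrBlDl (le_lt_trans _ h)// opprB.
Qed.

Let mD n : measurable_fun setT (EFin \o D n).
Proof.
apply/measurable_EFinP; apply: measurable_funM => //.
apply: measurable_funB; last exact: measurable_clip_comp.
by apply: measurable_clip_comp; apply: measurable_funD => //; exact: measurable_funM.
Qed.

Let mMab : measurable (M @^-1` `]a, b]).
Proof. by rewrite -[X in measurable X]setTI; apply: mM => //; exact: measurable_itv. Qed.

(* Two functions of [1 / n.+1] that agree at 0: their slopes are ordered. *)
Lemma touching_le (q : nat -> R) (l : R) :
  (forall n, \int[P]_w clip a b (M w + U n w / n.+1%:R) <=
             \int[P]_w clip a b (M w) + q n / n.+1%:R) ->
  q n @[n --> \oo] --> l -> \int[P]_(w in M @^-1` `]a, b]) V w <= l.
Proof.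
move=> hq ql.
have mVD : measurable_fun setT (EFin \o VD).
  by apply/measurable_EFinP; exact: measurable_funM.
have aecvg : {ae P, forall w, setT w -> (EFin \o D n) w @[n --> \oo] --> (EFin \o VD) w}.
  have mMc c : measurable (M @^-1` [set c]).
    by rewrite -[X in measurable X]setTI; exact: mM.
  exists (M @^-1` [set a] `|` M @^-1` [set b]); split.
  - exact: measurableU.
  - apply/eqP; rewrite eq_le measure_ge0 andbT.
    apply: (le_trans (measureU2 _ (mMc a) (mMc b))).
    by rewrite [X in (X + _ <= _)%E]Ma [X in (_ + X <= _)%E]Mb adde0.
  - move=> w /=; apply: contra_notP => /not_orP[/eqP wa /eqP wb] _.
    apply: cvg_EFin; first exact: nearW.
    exact: cvgD.
have [VDi _ cvgI] := @dominated_convergence _ _ _ P setT measurableT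
  (fun n => EFin \o D n) (EFin \o VD) (EFin \o g) mD mVD aecvg gi
  (aeW _ (fun w n _ => D_g n w)).
have Di n : P.-integrable setT (EFin \o D n).
  by apply: le_integrable gi => // w _ /=; rewrite lee_fin (le_trans (D_g n w))// ler_norm.
have cvgR : \int[P]_w D n w @[n --> \oo] --> \int[P]_w VD w.
  by apply: fine_cvg; rewrite fineK ?integrable_fin_num.
have -> : \int[P]_(w in M @^-1` `]a, b]) V w = \int[P]_w VD w.
  rewrite Rintegral_mkcond; apply: eq_Rintegral => w _.
  by rewrite /VD patch_indic.
apply: (ler_cvg_to cvgR ql); apply: nearW => n.
have mMU : measurable_fun setT (fun w => M w + U n w / n.+1%:R).
  by apply: measurable_funD => //; exact: measurable_funM.
rewrite RintegralZr//; last first.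
  rewrite (_ : EFin \o _ = (fun w => (clip a b (M w + U n w / n.+1%:R))%:E) \-
    (fun w => (clip a b (M w))%:E))%E.
    by apply: integrableB => //; exact: integrable_clip.
  by apply/funext => w.
rewrite RintegralB//; [|exact: integrable_clip|exact: integrable_clip].
by rewrite -ler_pdivlMr// lerBlDl.
Qed.

End Touching.

(** * Orthogonal combinations; integrability of maxima and of values at a random time *)

Section QuadForm.
Context {R : realType} (d : nat) (Sigma : 'M[R]_d).

(** Pythagoras: both cross terms vanish, the second one by symmetry. *)
Lemma quad_formD (x y : 'rV[R]_d) : Sigma^T = Sigma ->
  (x *m Sigma *m y^T) 0 0 = 0 ->
  forall p q, quad_form Sigma (p *: x + q *: y) =
    p ^+ 2 * quad_form Sigma x + q ^+ 2 * quad_form Sigma y.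
Proof.
move=> sym xy p q; rewrite /quad_form.
have yx : (y *m Sigma *m x^T) 0 0 = 0.
  have -> : y *m Sigma *m x^T = (x *m Sigma *m y^T)^T.
    by rewrite !trmx_mul trmxK sym mulmxA.
  by rewrite mxE xy.
have e (u : 'rV[R]_d) : (p *: x + q *: y) *m Sigma *m u^T =
    p *: (x *m Sigma *m u^T) + q *: (y *m Sigma *m u^T).
  by rewrite mulmxDl -!scalemxAl mulmxDl -!scalemxAl.
have t : (p *: x + q *: y)^T = p *: x^T + q *: y^T.
  by rewrite linearD !linearZ.
have lin p' q' (A C : 'M[R]_1) : (p' *: A + q' *: C) 0 0 = p' * A 0 0 + q' * C 0 0.
  by rewrite !mxE.
rewrite [in LHS]e t !mulmxDr -!scalemxAr !lin xy yx; ring.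
Qed.

End QuadForm.

Section LinProcAt.
Context {R : realType} dO {Omega : measurableType dO} (P : probability Omega R).
Variables (d : nat) (Sigma : 'M[R]_d) (B : 'I_d -> R -> Omega -> R).
Hypothesis hB : brownian_motion P Sigma B.
Variable T : R.
Hypothesis T0 : 0 < T.

Let T0' : 0 <= T. Proof. exact: ltW. Qed.

Lemma lin_procZ p (x : 'rV[R]_d) t w :
  lin_proc B (p *: x) 0 t w = p * lin_proc B x 0 t w.
Proof.
rewrite /lin_proc !mul0r !add0r mulr_sumr; apply: eq_bigr => j _.
by rewrite mxE mulrA.
Qed.

Lemma lin_procD (x y : 'rV[R]_d) m m' t w :
  lin_proc B (x + y) (m + m') t w = lin_proc B x m t w + lin_proc B y m' t w.
Proof.
rewrite /lin_proc mulrDl addrACA -big_split/=; congr (_ + _).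
by apply: eq_bigr => j _; rewrite mxE mulrDl.
Qed.

Lemma lin_proc_drift (x : 'rV[R]_d) m m' t w :
  lin_proc B x (m + m') t w = lin_proc B x m t w + m' * t.
Proof. by rewrite /lin_proc mulrDl addrAC. Qed.

Lemma lin_max_ge0 (x : 'rV[R]_d) m w : 0 <= lin_max B T x m w.
Proof.
rewrite -(lin_proc0 B x m w); apply: (le_lin_max hB T0).
by rewrite in_itv/= lexx.
Qed.

(** Without drift the tail is 2 Phi (- y / s), at most twice the normal density at y / s by Mills'
    inequality. The clipped expectations are thus bounded in [n], and monotone convergence
    applies. *)
Lemma integrable_lin_max (x : 'rV[R]_d) : 0 < quad_form Sigma x ->
  P.-integrable setT (EFin \o lin_max B T x 0).
Proof.
move=> x0; set v := quad_form Sigma x in x0; pose s := Num.sqrt (v * T).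
have s0 : 0 < s by rewrite sqrtr_gt0 mulr_gt0.
have sn0 : s != 0 by rewrite gt_eqF.
have mM : measurable_fun setT (lin_max B T x 0) by exact: (measurable_lin_max hB T0).
(* Clipping from [2 * s] on keeps y / s above 1, as [Phi_le_pdf] requires. *)
pose a := 2 * s; have sa : s < a by rewrite ltr_pMl// ltr1n.
have ab n : a < a + n.+1%:R by rewrite ltrDl.
pose K n w := clip a (a + n.+1%:R) (lin_max B T x 0 w).
have mK n : measurable_fun setT (EFin \o K n).
  by apply/measurable_EFinP; exact: measurable_clip_comp.
have aK n w : a <= K n w.
  by have /andP[] := clip_itv (lin_max B T x 0 w) (ltW (ab n)).
have a0 : 0 < a by exact: lt_trans sa.
have Kint n : (\int[P]_w (K n w)%:E <= (a + 2 * s)%:E)%E.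
  have Ki : P.-integrable setT (EFin \o K n) by exact: integrable_clip.
  rewrite -[leLHS]fineK ?integrable_fin_num// lee_fin.
  rewrite [leLHS](expectation_clip P (ab n) mM) lerD2l.
  have pi : lebesgue_measure.-integrable `[a, a + n.+1%:R]
      (EFin \o normal_pdf (0 : R) s).
    by apply: integrableS (integrable_normal_pdf 0 s).
  have pi2 : lebesgue_measure.-integrable `[a, a + n.+1%:R]
      (EFin \o (fun y => 2 * s * normal_pdf (0 : R) s y)).
    rewrite (_ : _ \o _ = fun y => ((2 * s)%:E * (normal_pdf 0 s y)%:E)%E).
      exact: integrableZl.
    by apply/funext => y; rewrite /= EFinM.
  apply: (@le_trans _ _
      (\int[lebesgue_measure]_(y in `[a, a + n.+1%:R]) (2 * s * normal_pdf 0 s y))).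
    have -> : \int[lebesgue_measure]_(y in `[a, a + n.+1%:R])
        fine (P [set w | y < lin_max B T x 0 w]) =
        \int[lebesgue_measure]_(y in `[a, a + n.+1%:R]) max_tail T v 0 y.
      apply: eq_Rintegral => y /set_mem /=; rewrite in_itv/= => /andP[ay _].
      by rewrite (law_lin_max hB T0)// (lt_le_trans a0).
    apply: le_Rintegral => //.
      apply: continuous_compact_integrable; first exact: segment_compact.
      by apply: continuous_subspaceT; exact: continuous_max_tail.
    move=> y /=; rewrite in_itv/= => /andP[ay _].
    rewrite /max_tail -/s mul0r sub0r mulr0 !mul0r expR0 mul1r subr0.
    have -> : 2 * s * normal_pdf 0 s y = 2 * normal_pdf 0 1 (y / s).
      by rewrite (normal_pdf_scale _ _ s0) subr0; field.
    suff : Phi (- y / s) <= normal_pdf 0 1 (y / s) by move=> h; rewrite mulr_natl mulr2n lerD.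
    rewrite mulNr; apply: (Phi_le_pdf hB T0 x0).
    by rewrite ltr_pdivlMr// mul1r (lt_le_trans sa).
  rewrite RintegralZl// ler_piMr ?mulr_ge0 ?(ltW s0)//.
  rewrite -lee_fin /Rintegral fineK ?integrable_fin_num//.
  exact: (@probability_le1 _ _ _ (normal_prob 0 s)).
have nd w m n : (m <= n)%N -> K m w <= K n w.
  by move=> mn; rewrite /K /clip le_min2// lerD2l ler_nat.
have cvgK w : (K n w)%:E @[n --> \oo] --> (Num.max (lin_max B T x 0 w) a)%:E.
  apply: cvg_near_cst.
  exists (Num.truncn (Num.max (lin_max B T x 0 w) a)).+1 => // n /= hn.
  congr EFin; rewrite /K /clip min_l//.
  rewrite ltW// (lt_le_trans (truncnS_gt _))// ler_wpDl ?(ltW a0)//.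
  by rewrite ler_nat; exact: ltnW.
have lim_le : (\int[P]_w (Num.max (lin_max B T x 0 w) a)%:E <= (a + 2 * s)%:E)%E.
  have := @cvg_monotone_convergence _ _ _ P setT measurableT (fun n w => (K n w)%:E) mK _ _.
  rewrite (_ : (fun w => limn _) = (fun w => (Num.max (lin_max B T x 0 w) a)%:E)).
    move=> /(_ _ _)/cvge_to_le; apply.
    - by move=> n w _; rewrite lee_fin (le_trans (ltW a0)).
    - by move=> w _ m n mn; rewrite lee_fin nd.
    - exact: nearW.
  by apply/funext => w; apply/cvg_lim => //; exact: cvgK.
apply/integrableP; split; first exact/measurable_EFinP.
apply: (@le_lt_trans _ _ (\int[P]_w (Num.max (lin_max B T x 0 w) a)%:E)%E).
  apply: ge0_le_integral => //.
  - by apply: measurableT_comp => //; exact/measurable_EFinP.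
  - by apply/measurable_EFinP; exact: measurable_maxr.
  - by move=> w _; rewrite /= lee_fin ger0_norm ?lin_max_ge0// le_max lexx.
exact: (le_lt_trans lim_le (ltry _)).
Qed.

Lemma norm_lin_proc_le (x : 'rV[R]_d) t w : t \in `[0, T] ->
  `|lin_proc B x 0 t w| <= lin_max B T x 0 w + lin_max B T (- x) 0 w.
Proof.
move=> tT; have h1 := le_lin_max hB T0 x 0 w tT.
have h2 := le_lin_max hB T0 (- x) 0 w tT.
have e : lin_proc B (- x) 0 t w = - lin_proc B x 0 t w.
  by rewrite -scaleN1r lin_procZ mulN1r.
rewrite e in h2; rewrite ler_norml; apply/andP; split.
  by rewrite lerNl (le_trans h2)// lerDr lin_max_ge0.
by rewrite (le_trans h1)// lerDl lin_max_ge0.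
Qed.

Section AtTau.
Variable tau : Omega -> \bar R.
Hypothesis mtau : measurable_fun setT (fun w => fine (tau w)).
Hypothesis tauT : forall w, fine (tau w) \in `[0, T].

Lemma measurable_lin_at (x : 'rV[R]_d) m :
  measurable_fun setT (at_time (lin_proc B x m) tau).
Proof.
apply: (@measurable_at_time _ _ _ _ T) => //.
- by move=> t; rewrite in_itv/= => /andP[t0 _]; exact: (measurable_lin_proc hB).
- by move=> w; exact: (continuous_lin_proc hB).
Qed.

Lemma integrable_lin_at_gt0 (x : 'rV[R]_d) : 0 < quad_form Sigma x ->
  P.-integrable setT (EFin \o at_time (lin_proc B x 0) tau).
Proof.
move=> x0; have x0' : 0 < quad_form Sigma (- x).
  by rewrite /quad_form linearN/= mulNmx mulmxN mulNmx opprK.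
have i := integrableD measurableT (integrable_lin_max x0) (integrable_lin_max x0').
apply: le_integrable i => //.
- by apply/measurable_EFinP; exact: measurable_lin_at.
- move=> w _ /=; rewrite lee_fin (le_trans (norm_lin_proc_le x w (tauT w)))//.
  exact: ler_norm.
Qed.

(* Adding [y] makes the variance positive when [x] is degenerate. *)
Lemma integrable_lin_at (x y : 'rV[R]_d) : 0 < quad_form Sigma y ->
  (y *m Sigma *m x^T) 0 0 = 0 ->
  P.-integrable setT (EFin \o at_time (lin_proc B x 0) tau).
Proof.
move=> y0 yx; have [_ _ _ _ /(_ 0 1 (lexx 0) ler01)] := hB.
rewrite subr0 scale1r => -[[sym psd] _].
have xy0 : 0 < quad_form Sigma (y + x).
  have := quad_formD sym yx 1 1; rewrite !scale1r expr1n !mul1r => ->.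
  by rewrite ltr_wpDr.
have i := integrableB measurableT (integrable_lin_at_gt0 xy0) (integrable_lin_at_gt0 y0).
apply: eq_integrable i => // w _ /=; rewrite /at_time -EFinB; congr EFin.
have := lin_procD y x 0 0 (fine (tau w)) w; rewrite addr0 => ->.
by rewrite addrAC subrr add0r.
Qed.

End AtTau.
End LinProcAt.

(** * Envelope theorem *)

Section EnvelopeTheorem.
Context {R : realType} dO {Omega : measurableType dO} (P : probability Omega R).
Variables (d : nat) (Sigma : 'M[R]_d) (B : 'I_d -> R -> Omega -> R).
Hypothesis hB : brownian_motion P Sigma B.
Variable T : R.
Hypothesis T0 : 0 < T.
Variables (o : 'rV[R]_d) (r : R).
Let v := quad_form Sigma o.
Hypothesis v0 : 0 < v.

Let T0' : 0 <= T. Proof. exact: ltW. Qed.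
Let X := lin_proc B o r.
Let tau := argmax_time X T.
Let M := lin_max B T o r.

Let mM : measurable_fun setT M. Proof. exact: (measurable_lin_max hB T0). Qed.

Let cX w : {within `[0, T], continuous (fun t => X t w)}.
Proof. exact: (continuous_lin_proc hB). Qed.

Lemma argmax_lin_itv w : fine (tau w) \in `[0, T].
Proof. by have [t [tE tT _ _]] := argmax_timeP T0' (@cX w); rewrite /tau tE. Qed.

Lemma measurable_argmax_lin : measurable_fun setT (fun w => fine (tau w)).
Proof.
apply: measurable_argmax_time => // t; rewrite in_itv/= => /andP[t0 _].
exact: (measurable_lin_proc hB).
Qed.

Let mMset (A : set R) : measurable A -> measurable (M @^-1` A).
Proof. by move=> mA; rewrite -[X in measurable X]setTI; exact: mM. Qed.

Let gtE x : [set w | x < M w] = M @^-1` `]x, +oo[.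
Proof. by apply/seteqP; split => w /=; rewrite in_itv/= andbT. Qed.

Let lawM u : 0 < u -> P [set w | (u < M w)%R] = (max_tail T v r u)%:E.
Proof. exact: (law_lin_max hB T0). Qed.

Lemma measure_lin_max_itv a b : 0 < a -> a < b ->
  P (M @^-1` `]a, b]) = (max_tail T v r a - max_tail T v r b)%:E.
Proof.
move=> a0 ab.
have -> : M @^-1` `]a, b] = [set w | a < M w] `\` [set w | b < M w].
  apply/seteqP; split => w /=; rewrite in_itv/=.
    by move=> /andP[aM Mb]; split => //; apply/negP; rewrite -leNgt.
  by move=> [-> /negP]; rewrite -leNgt.
have mgt x : measurable [set w | x < M w].
  by rewrite gtE; exact: mMset (measurable_itv _).
rewrite EFinB -!lawM//; last exact: lt_trans ab.
rewrite measureD//; last by rewrite -ge0_fin_numE// fin_num_measure.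
rewrite setIidr// => w /=; exact: lt_trans.
Qed.

(** An atom at [a] has at most the mass of ]a - h, a], which tends to 0 by continuity of
    [max_tail]. *)
Lemma lin_max_atomless a : 0 < a -> P (M @^-1` [set a]) = 0%E.
Proof.
move=> a0; apply/eqP; rewrite eq_le measure_ge0 andbT.
have fP : P (M @^-1` [set a]) = (fine (P (M @^-1` [set a])))%:E.
  by rewrite fineK// fin_num_measure//; exact: mMset.
have cvg0 : max_tail T v r (a - h) - max_tail T v r a @[h --> 0^'+] --> (0 : R).
  rewrite -[X in _ --> X](subrr (max_tail T v r a)).
  apply: cvgB; last exact: cvg_cst.
  have h : max_tail T v r (a - h) @[h --> 0] --> max_tail T v r (a - 0).
    apply: (@continuous_comp _ _ _ (fun h => a - h) (max_tail T v r)).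
      by apply: cvgB; [exact: cvg_cst|exact: cvg_id].
    exact: continuous_max_tail.
  by apply: cvg_at_right_filter; rewrite subr0 in h.
rewrite fP lee_fin; apply: (cvgr_to_ge cvg0); near=> h.
have h0 : 0 < h by [].
have ha : h < a by near: h; exact: nbhs_right_lt.
rewrite -lee_fin -fP -measure_lin_max_itv ?subr_gt0// ?gtrBl//.
apply: le_measure; rewrite ?inE; [exact: mMset|exact: mMset (measurable_itv _)|].
by move=> w /= ->; rewrite in_itv/= lexx gtrBl h0.
Unshelve. all: by end_near. Qed.

(** The envelope inequality: the maximizer of the unperturbed process is a competitor in every
    perturbed maximum. *)
Let at_tau_le x m w : lin_proc B x m (fine (tau w)) w <= lin_max B T x m w.
Proof. by apply: (le_lin_max hB T0); exact: argmax_lin_itv. Qed.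

Let ME w : M w = lin_proc B o r (fine (tau w)) w. Proof. by []. Qed.

Let n0 n : n.+1%:R != 0 :> R. Proof. by rewrite pnatr_eq0. Qed.

Section Orthogonal.
Variables (a b : R).
Hypotheses (a0 : 0 < a) (ab : a < b).

Let clipE x m : quad_form Sigma x = v -> 
  \int[P]_w clip a b (lin_max B T x m w) =
  a + \int[lebesgue_measure]_(y in `[a, b]) max_tail T v m y.
Proof.
move=> xv; rewrite (expectation_clip P ab); last exact: (measurable_lin_max hB T0).
congr (_ + _); apply: eq_Rintegral => y /set_mem/=; rewrite in_itv/= => /andP[ay _].
by rewrite (law_lin_max hB T0)/= ?xv// (lt_le_trans a0).
Qed.

(* [o + e *: y e] is a rotation of [o] towards [z], so that the law of the
   maximum does not depend on [e]. *)
Let orthogonal_le (z : 'rV[R]_d) : (o *m Sigma *m z^T) 0 0 = 0 ->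
  \int[P]_(w in M @^-1` `]a, b]) (2 * at_time (lin_proc B z 0) tau w) <= 0.
Proof.
move=> oz; have [_ _ _ _ /(_ 0 1 (lexx 0) ler01)] := hB.
rewrite subr0 scale1r => -[[sym psd] _].
pose k := quad_form Sigma z / v.
have k0 : 0 <= k by rewrite divr_ge0 ?(ltW v0).
have kE : quad_form Sigma z = k * v by rewrite /k mulfVK// gt_eqF.
clearbody k.
pose den (e : R) := 1 + e ^+ 2 * k.
have den1 e : 1 <= den e by rewrite lerDl mulr_ge0// sqr_ge0.
have den0 e : 0 < den e by rewrite (lt_le_trans ltr01).
have denn0 e : den e != 0 by rewrite gt_eqF.
(* Let p = (1 - e^2 k) / den and q = 2 e / den, the rational parametrization of p^2 + k q^2 = 1.
   Then [y e] is (p o + q z - o) / e, in a form that makes sense at e = 0; there it is 2 z, whence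
   the factor 2 in the integrand. *)
pose y e : 'rV[R]_d := (2 / den e) *: z + (- (2 * e * k) / den e) *: o.
have yE e : o + e *: y e = ((1 - e ^+ 2 * k) / den e) *: o + (2 * e / den e) *: z.
  rewrite /y scalerDr !scalerA addrCA [in RHS]addrC; congr (_ + _); last first.
    by rewrite -[X in X + _]scale1r -scalerDl; congr (_ *: _); rewrite /den; field; exact: denn0.
  by congr (_ *: _); ring.
have vy e : quad_form Sigma (o + e *: y e) = v.
  rewrite yE (quad_formD sym oz) -/v.
  by rewrite kE /den; field; exact: denn0.
pose e_ n : R := n.+1%:R^-1.
have e_1 n : `|e_ n| <= 1.
  by rewrite ger0_norm ?invr_ge0// invf_le1// ler1n.
pose Z := at_time (lin_proc B z 0) tau.
pose W := at_time (lin_proc B o 0) tau.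
pose U n w := lin_proc B (y (e_ n)) 0 (fine (tau w)) w.
have UE n w : U n w = (2 * Z w - 2 * e_ n * k * W w) / den (e_ n).
  rewrite /U /y; have := lin_procD B ((2 / den (e_ n)) *: z)
    ((- (2 * e_ n * k) / den (e_ n)) *: o) 0 0 (fine (tau w)) w.
  rewrite addr0 => ->; rewrite !lin_procZ /Z /W /at_time.
  by field; exact: denn0.
have mtau := measurable_argmax_lin.
have mat x : measurable_fun setT (at_time (lin_proc B x 0) tau).
  by apply: (measurable_lin_at hB T0) => //; exact: argmax_lin_itv.
have Zi : P.-integrable setT (EFin \o Z).
  by apply: (integrable_lin_at hB T0 mtau argmax_lin_itv v0).
have Wi : P.-integrable setT (EFin \o W).
  by apply: (integrable_lin_at_gt0 hB T0 mtau argmax_lin_itv v0).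
have cvge : e_ n @[n --> \oo] --> (0 : R) by exact: cvg_harmonic.
apply: (@touching_le _ _ _ P a b M (fun w => 2 * Z w)
   (fun w => 2 * `|Z w| + 2 * k * `|W w|) U ab mM _ _ _ _ _ _ _ (fun=> 0)).
- by apply: measurable_funM => //; exact: mat.
- by move=> n; exact: mat.
- have i1 := integrableZl measurableT 2 (integrable_norm Zi).
  have i2 := integrableZl measurableT (2 * k) (integrable_norm Wi).
  by apply: eq_integrable (integrableD measurableT i1 i2) => // w _.
- move=> n w; rewrite UE normrM normfV (gtr0_norm (den0 _)) ler_pdivrMr//.
  rewrite (@le_trans _ _ (2 * `|Z w| + 2 * k * `|W w|))//; last first.
    by rewrite ler_peMr// addr_ge0// mulr_ge0// mulr_ge0.
  rewrite (le_trans (ler_normB _ _))// !normrM (ger0_norm k0) (gtr0_norm (x := 2))//.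
  rewrite lerD2l ler_wpM2r// ler_wpM2r// -[leRHS]mulr1 ler_wpM2l//.
- move=> w.
  have h : (2 * Z w - 2 * e_ n * k * W w) / den (e_ n) @[n --> \oo] -->
      (2 * Z w - 2 * 0 * k * W w) / (1 + 0 * 0 * k).
    apply: cvgM.
      apply: cvgB; first exact: cvg_cst.
      by do 2 (apply: cvgMl); apply: cvgMr.
    apply: cvgV; first by rewrite !mul0r addr0 oner_neq0.
    apply: cvgD; first exact: cvg_cst.
    by apply: cvgMl; exact: cvgM.
  rewrite !(mulr0, mul0r) addr0 subr0 divr1 in h.
  by under eq_fun do rewrite UE.
- exact: lin_max_atomless.
- by apply: lin_max_atomless; exact: lt_trans ab.
- move=> n; rewrite mul0r addr0.
  rewrite (clipE r (erefl v)) -(clipE r (vy (e_ n))).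
  have mlm := measurable_lin_max hB T0 (o + e_ n *: y (e_ n)) r.
  apply: le_Rintegral => //.
  + apply: integrable_clip => //; apply: measurable_funD => //.
    by apply: measurable_funM => //; exact: mat.
  + exact: integrable_clip.
  move=> w _; apply: le_clip.
  rewrite ME -/(e_ n) mulrC -lin_procZ.
  have := lin_procD B o (e_ n *: y (e_ n)) r 0 (fine (tau w)) w; rewrite addr0 => <-.
  exact: at_tau_le.
- exact: cvg_cst.
Qed.

(** [orthogonal_le] applied to [z] and to [- z] gives the two inequalities. *)
Lemma orthogonal_integral (z : 'rV[R]_d) : (o *m Sigma *m z^T) 0 0 = 0 ->
  \int[P]_(w in M @^-1` `]a, b]) at_time (lin_proc B z 0) tau w = 0.
Proof.
move=> oz; have oz' : (o *m Sigma *m (- z)^T) 0 0 = 0.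
  by rewrite linearN mulmxN mxE oz oppr0.
have mtau := measurable_argmax_lin.
have Zi : P.-integrable (M @^-1` `]a, b]) (EFin \o at_time (lin_proc B z 0) tau).
  apply: integrableS (integrable_lin_at hB T0 mtau argmax_lin_itv v0 oz) => //.
  exact: mMset (measurable_itv _).
have mab : measurable (M @^-1` `]a, b]) by exact: mMset (measurable_itv _).
have := orthogonal_le oz; have := orthogonal_le oz'.
have -> : (fun w => 2 * at_time (lin_proc B (- z) 0) tau w) =
    (fun w => - 2 * at_time (lin_proc B z 0) tau w).
  apply/funext => w; rewrite /at_time -scaleN1r lin_procZ; ring.
rewrite !RintegralZl//; lra.
Qed.

Let I m := \int[lebesgue_measure]_(y in `[a, b]) max_tail T v m y.

Let cvg_drift : h^-1 *: (I (h + r) - I r) @[h --> 0^'] -->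
  \int[lebesgue_measure]_(y in `[a, b]) max_tail_drift T v r y.
Proof.
(* Bounds [max_tail_drift] for drifts within 1 of [r] and points of [a, b], [Phi] being at most 1;
   it dominates the differentiation under the integral. *)
pose C := 2 * b / v * expR (2 * (`|r| + 1) / v * b).
have b0 : 0 < b by exact: lt_trans ab.
have C0 : 0 <= C by rewrite mulr_ge0 ?expR_ge0// mulr_ge0 ?invr_ge0 ?(ltW v0)// mulr_ge0// ltW.
have ci m : lebesgue_measure.-integrable `[a, b] (EFin \o max_tail T v m).
  apply: continuous_compact_integrable; first exact: segment_compact.
  by apply: continuous_subspaceT; exact: continuous_max_tail.
have dE m y : partial1of2 (fun m y => max_tail T v m y) m y = max_tail_drift T v m y.
  by rewrite partial1of2E; have [_ ->] := is_derive_max_tail_drift T0 v0 m y.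
have Ir : `]r - 1, r + 1[%classic r by rewrite /= in_itv/= gtrBl ltrDl ltr01.
have := @cvg_differentiation_under_integral R _ (measurableTypeR R) lebesgue_measure
  (fun m y => max_tail T v m y) `[a, b]%classic (measurable_itv _) r (r - 1) (r + 1) Ir
  (fun m _ => ci m) _ (fun=> C) (fun=> C0) _ _.
have -> : \int[lebesgue_measure]_(y in `[a, b])
    partial1of2 (fun m y => max_tail T v m y) r y =
    \int[lebesgue_measure]_(y in `[a, b]) max_tail_drift T v r y.
  by apply: eq_Rintegral => y _; exact: dE.
apply.
- by move=> m y _ _; have [] := is_derive_max_tail_drift T0 v0 m y.
- apply: continuous_compact_integrable; first exact: segment_compact.
  by apply: continuous_subspaceT; exact: cst_continuous.
- move=> m y /=; rewrite !in_itv/= => /andP[m1 m2] /andP[ay yb].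
  have y0 : 0 < y by exact: lt_le_trans ay.
  rewrite dE /max_tail_drift ger0_norm; last first.
    rewrite mulr_ge0 ?Phi_ge0// mulr_ge0 ?expR_ge0// mulr_ge0 ?invr_ge0 ?(ltW v0)//.
    by rewrite mulr_ge0// ltW.
  rewrite -[leRHS]mulr1 ler_pM ?Phi_ge0 ?Phi_le1//.
    by rewrite mulr_ge0 ?expR_ge0// mulr_ge0 ?invr_ge0 ?(ltW v0)// mulr_ge0// ltW.
  rewrite ler_pM ?expR_ge0//.
  + by rewrite mulr_ge0 ?invr_ge0 ?(ltW v0)// mulr_ge0// ltW.
  + by rewrite ler_pM2r ?invr_gt0// ler_pM2l.
  rewrite ler_expR (le_trans (ler_norm _))// !normrM normfV (gtr0_norm v0).
  rewrite (gtr0_norm y0) (gtr0_norm (x := 2))// ler_pM// ?mulr_ge0 ?invr_ge0 ?(ltW v0) ?(ltW y0)//.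
  rewrite ler_pM2r ?invr_gt0// ler_pM2l// ler_norml.
  have := ler_norm r; have := ler_norm (- r); rewrite normrN.
  by move=> *; apply/andP; split; lra.
Qed.

(** [s] is 1 or -1: raising and lowering the drift give the two inequalities of [drift_integral]. *)
Let drift_le (s : R) : s ^+ 2 = 1 ->
  \int[P]_(w in M @^-1` `]a, b]) (s * fine (tau w)) <=
  s * \int[lebesgue_measure]_(y in `[a, b]) max_tail_drift T v r y.
Proof.
move=> s1; have sn0 : s != 0 by apply: contra_eq_neq s1 => ->; rewrite expr0n/= eq_sym oner_neq0.
have sn1 : `|s| = 1.
  by apply/eqP; rewrite -sqrp_eq1// -normrX s1 normr1.
have mtau := measurable_argmax_lin.
pose h n : R := s / n.+1%:R.
pose q n := s * ((h n)^-1 *: (I (h n + r) - I r)).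
apply: (@touching_le _ _ _ P a b M (fun w => s * fine (tau w)) (cst T)
  (fun n w => s * fine (tau w)) ab mM _ _ _ _ _ _ _ q).
- exact: measurable_funM.
- by move=> n; exact: measurable_funM.
- exact: finite_measure_integrable_cst.
- move=> n w; have := argmax_lin_itv w; rewrite in_itv/= => /andP[t0 tT].
  by rewrite normrM sn1 mul1r ger0_norm.
- by move=> w; exact: cvg_cst.
- exact: lin_max_atomless.
- by apply: lin_max_atomless; exact: lt_trans ab.
- move=> n.
  have -> : q n / n.+1%:R = I (h n + r) - I r.
    rewrite /q; move: (I (h n + r) - I r) => y; rewrite /h.
    have := n0 n; move: (n.+1%:R) => N N0.
    by rewrite /GRing.scale/=; field; rewrite N0 sn0.
  have -> : \int[P]_w clip a b (M w) = a + I r := clipE r (erefl v).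
  have -> : a + I r + (I (h n + r) - I r) =
      \int[P]_w clip a b (lin_max B T o (h n + r) w).
    rewrite (clipE (h n + r) (erefl v)) -/(I (h n + r)).
    by move: (I r) (I (h n + r)) => p1 p2; ring.
  have mlm := measurable_lin_max hB T0 o (h n + r).
  apply: le_Rintegral => //.
  + apply: integrable_clip => //; apply: measurable_funD => //.
    by apply: measurable_funM => //; exact: measurable_funM.
  + exact: integrable_clip.
  move=> w _; apply: le_clip.
  have -> : M w + s * fine (tau w) / n.+1%:R =
      lin_proc B o (h n + r) (fine (tau w)) w.
    by rewrite ME addrC /h (addrC _ r) lin_proc_drift addrC mulrAC.
  exact: at_tau_le.
- apply: cvgMr.
  have := iffLR (cvgr_dnbhsP _ _ _) (@cvg_drift) h; apply; split.
    by move=> n; rewrite mulf_neq0// invr_eq0.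
  by rewrite -[X in _ --> X](mulr0 s); apply: cvgMr; exact: cvg_harmonic.
Qed.

Lemma drift_integral :
  \int[P]_(w in M @^-1` `]a, b]) fine (tau w) =
  \int[lebesgue_measure]_(y in `[a, b]) max_tail_drift T v r y.
Proof.
have mab : measurable (M @^-1` `]a, b]) by exact: mMset (measurable_itv _).
have ti : P.-integrable (M @^-1` `]a, b]) (EFin \o (fun w => fine (tau w))).
  apply: (@le_integrable _ _ _ _ _ mab _ (EFin \o cst T)).
  - by apply/measurable_EFinP; apply: measurable_funTS; exact: measurable_argmax_lin.
  - move=> w _ /=; have := argmax_lin_itv w; rewrite in_itv/= => /andP[t0 tT].
    by rewrite lee_fin !ger0_norm.
  - exact: finite_measure_integrable_cst.
have N1 : (-1) ^+ 2 = 1 :> R by rewrite sqrrN expr1n.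
have := drift_le (expr1n _ 2); have := drift_le N1.
rewrite !RintegralZl//; lra.
Qed.

End Orthogonal.

End EnvelopeTheorem.

(** * Conditional expectations given the maximum *)

(** For nonnegative [X] this is a measure in [A], so that identities known on intervals extend to
    Borel sets. With X = 1 it is the law of [Y]. *)
Definition ge0_law d (T : measurableType d) (R : realType)
    (P : {measure set T -> \bar R}) (X : T -> R) (Y : T -> R) (A : set R) : \bar R :=
  (\int[P]_(w in Y @^-1` A) (X w)%:E)%E.

Section Ge0Law.
Local Open Scope ereal_scope.
Context d (T : measurableType d) (R : realType) (P : {measure set T -> \bar R}).
Variables (X : {mfun T >-> R}) (Y : {mfun T >-> R}).
Hypothesis X0 : forall w, (0 <= X w)%R.

Let law0 : ge0_law P X Y set0 = 0.
Proof. by rewrite /ge0_law preimage_set0 integral_set0. Qed.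

Let law_ge0 A : 0 <= ge0_law P X Y A.
Proof. by apply: integral_ge0 => w _; rewrite lee_fin X0. Qed.

Let law_sigma_additive : semi_sigma_additive (ge0_law P X Y).
Proof.
move=> /= F mF tF mUF; rewrite /ge0_law preimage_bigcup ge0_integral_bigcup//.
- by apply: is_cvg_ereal_nneg_natsum_cond => n _ _; exact: law_ge0.
- by move=> n; rewrite -[X in measurable X]setTI; exact: measurable_funP.
- by apply/measurable_EFinP; exact: measurable_funTS.
- by move=> w _; rewrite lee_fin X0.
- by move=> i j _ _ [w [Fi Fj]]; apply: (tF i j) => //; exists (Y w).
Qed.

Definition ge0_law_measure : {measure set R -> \bar R} :=
  HB.pack (ge0_law P X Y)
    (isMeasure.Build _ _ _ (ge0_law P X Y) law0 law_ge0 law_sigma_additive).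

End Ge0Law.

(** The two sides may live on different spaces: a law under [P] is compared with a Lebesgue density
    by taking the identity for [Y2]. *)
Lemma ge0_law_unique d1 d2 (T1 : measurableType d1) (T2 : measurableType d2)
    (R : realType) (P1 : {measure set T1 -> \bar R}) (P2 : {measure set T2 -> \bar R})
    (X1 Y1 : T1 -> R) (X2 Y2 : T2 -> R) :
  measurable_fun setT X1 -> measurable_fun setT Y1 ->
  measurable_fun setT X2 -> measurable_fun setT Y2 ->
  (forall w, 0 <= X1 w) -> (forall w, 0 <= X2 w) ->
  (forall a b : R, 0 < a -> a < b ->
    ge0_law P1 X1 Y1 `]a, b]%classic = ge0_law P2 X2 Y2 `]a, b]%classic) ->
  (forall a b : R, 0 < a -> a < b -> (ge0_law P1 X1 Y1 `]a, b]%classic < +oo)%E) ->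
  forall A : set R, measurable A -> A `<=` `]0, +oo[ ->
    ge0_law P1 X1 Y1 A = ge0_law P2 X2 Y2 A.
Proof.
move=> mX1 mY1 mX2 mY2 X10 X20 e fin A mA A0.
pose FX1 : {mfun T1 >-> R} := mfun_Sub (mem_set mX1).
pose FX2 : {mfun T2 >-> R} := mfun_Sub (mem_set mX2).
pose FY1 : {mfun T1 >-> R} := mfun_Sub (mem_set mY1).
pose FY2 : {mfun T2 >-> R} := mfun_Sub (mem_set mY2).
exact: (@measure_pos_itv_unique R (@ge0_law_measure _ _ _ P1 FX1 FY1 X10)
  (@ge0_law_measure _ _ _ P2 FX2 FY2 X20) e fin A mA A0).
Qed.

Lemma ge0_law_cst1 d (T : measurableType d) (R : realType)
    (P : {measure set T -> \bar R}) (Y : T -> R) (A : set R) :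
  measurable (Y @^-1` A) -> ge0_law P (fun=> 1) Y A = P (Y @^-1` A).
Proof. by move=> mA; rewrite /ge0_law integral_cst// mul1e. Qed.

Lemma ge0_integral_push_density d1 d2 (T1 : measurableType d1)
    (T2 : measurableType d2) (R : realType) (P : {measure set T1 -> \bar R})
    (mu : {measure set T2 -> \bar R}) (Y : T1 -> T2) (f : T2 -> R) (D : set T2)
    (h : T2 -> \bar R) :
  measurable_fun setT Y -> measurable D -> measurable_fun D f ->
  (forall x, 0 <= f x) ->
  (forall A, measurable A -> A `<=` D ->
    P (Y @^-1` A) = (\int[mu]_(x in A) (f x)%:E)%E) ->
  measurable_fun D h -> (forall x, D x -> (0 <= h x)%E) ->
  (\int[P]_(w in Y @^-1` D) h (Y w) = \int[mu]_(x in D) (h x * (f x)%:E))%E.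
Proof.
move=> mY mD mf f0 lawY mh h0.
rewrite -(ge0_integral_pushforward mY P mD mh).
  pose FY : {mfun T1 >-> T2} := mfun_Sub (mem_set mY).
  by apply: (@ge0_integral_density _ T2 R mu (pushforward P FY) f D h mD mf) => //.
by move=> x /set_mem; exact: h0.
Qed.

(** The density is given on intervals; uniqueness carries it to Borel sets, and from there to
    integrals of functions of [Y]. *)
Lemma ge0_integral_law_density d (T : measurableType d) (R : realType)
    (P : probability T R) (Y : T -> R) (f : R -> R)
    (a b : R) (h : R -> \bar R) :
  measurable_fun setT Y -> measurable_fun setT f -> (forall x, 0 <= f x) ->
  (forall a b : R, 0 < a -> a < b ->
    P (Y @^-1` `]a, b]) = (\int[lebesgue_measure]_(x in `]a, b]) (f x)%:E)%E) ->
  0 < a -> a < b ->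
  measurable_fun (`]a, b] : set R) h -> (forall x, x \in `]a, b] -> (0 <= h x)%E) ->
  (\int[P]_(w in Y @^-1` `]a, b]) h (Y w) =
   \int[lebesgue_measure]_(x in `]a, b]) (h x * (f x)%:E))%E.
Proof.
move=> mY mf f0 lawY a0 ab mh h0.
have mYA (A : set R) : measurable A -> measurable (Y @^-1` A).
  by move=> mA; rewrite -[X in measurable X]setTI; exact: mY.
have nuE (A : set R) : measurable A -> A `<=` `]0, +oo[ ->
    pushforward P Y A = (\int[lebesgue_measure]_(x in A) (f x)%:E)%E.
  move=> mA A0; rewrite /pushforward -ge0_law_cst1; last exact: mYA.
  apply: (@ge0_law_unique _ _ T (measurableTypeR R) R P lebesgue_measure
    (fun=> 1) Y f idfun) => //; first exact: (@measurable_id _ (measurableTypeR R)).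
  - move=> x y x0 xy; rewrite ge0_law_cst1; first exact: lawY.
    by apply: mYA; exact: measurable_itv.
  - move=> x y x0 xy; rewrite ge0_law_cst1; last first.
      by apply: mYA; exact: measurable_itv.
    by rewrite -ge0_fin_numE// fin_num_measure//; apply: mYA; exact: measurable_itv.
apply: (@ge0_integral_push_density _ _ T (measurableTypeR R) R P lebesgue_measure
  Y f `]a, b]%classic h) => //.
- exact: measurable_funTS.
- move=> A mA Aab; apply: nuE => // x /Aab /=; rewrite !in_itv/= andbT.
  by move=> /andP[ax _]; exact: lt_trans ax.
Qed.

Section CondE.
Context {R : realType} dO {Omega : measurableType dO} (P : probability Omega R).
Implicit Types (X Y : Omega -> R) (k : R -> R).

(** Continuous versions that differ at [y] stay apart by at least [e] when [Y] falls in some ]y -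
    del / 2, y], an event of positive probability on which their integrals are equal. *)
Lemma condE_version_unique X Y k1 k2 : measurable_fun setT Y ->
  (forall a b : R, 0 < a -> a < b -> (0 < P (Y @^-1` `]a, b]))%E) ->
  condE_version P setT X Y k1 -> condE_version P setT X Y k2 ->
  forall y, 0 < y -> k1 y = k2 y.
Proof.
move=> mY pos.
have main l1 l2 y : condE_version P setT X Y l1 -> condE_version P setT X Y l2 ->
    0 < y -> l1 y <= l2 y.
  move=> [Xi c1 h1] [_ c2 h2] y0; rewrite leNgt; apply/negP => l21.
  have cat k : {within `]0, +oo[, continuous k} -> {for y, continuous k}.
    rewrite continuous_open_subspace; last exact: interval_open.
    by apply; rewrite inE/= in_itv/= y0.
  (* A third of the gap: an error below [e] on each version leaves a gap of at least [e]. *)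
  pose e := (l1 y - l2 y) / 3.
  have e0 : 0 < e by rewrite divr_gt0// subr_gt0.
  have := cat _ c1; move=> /cvgrPdist_lt /(_ e e0) [d1 /= d10 hd1].
  have := cat _ c2; move=> /cvgrPdist_lt /(_ e e0) [d2 /= d20 hd2].
  (* The bound by [y] keeps the interval inside ]0, +oo[. *)
  pose del := Num.min (Num.min d1 d2) y.
  have del0 : 0 < del by rewrite !lt_min d10 d20.
  have del2 : del / 2 < del by rewrite ltr_pdivrMr// ltr_pMr// ltr1n.
  have yd : 0 < y - del / 2.
    by rewrite subr_gt0 (lt_le_trans del2)// ge_min lexx orbT.
  pose A := `](y - del / 2), y]%classic.
  have near1 x : A x -> `|l1 y - l1 x| < e /\ `|l2 y - l2 x| < e.
    rewrite /A /= in_itv/= => /andP[yx xy].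
    have yxd : `|y - x| < del.
      by rewrite ger0_norm ?subr_ge0// (lt_trans _ del2)// ltrBlDr -ltrBlDl.
    by split; [apply: hd1|apply: hd2]; rewrite /= (lt_le_trans yxd)// !ge_min lexx ?orbT.
  have gap x : A x -> e <= l1 x - l2 x.
    move=> /near1[]; rewrite !ltr_norml => /andP[p1 p2] /andP[p3 p4].
    have : l1 y - l2 y = 3 * e by rewrite /e; field.
    by move: p1 p2 p3 p4; move: e0; clearbody e; lra.
  have bnd (l : R -> R) x : `|l y - l x| < e -> `|l x| <= `|l y| + e.
    move=> h; rewrite -[l x](subrK (l y)) addrC (le_trans (ler_normD _ _))//.
    by rewrite lerD2l distrC ltW.
  have mA : measurable A by exact: measurable_itv.
  have mYA : measurable (Y @^-1` A).
    by rewrite -[X in measurable X]setTI; exact: mY.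
  have sA : A `<=` `]0, +oo[.
    by move=> x; rewrite /A /= !in_itv/= andbT => /andP[yx _]; exact: lt_trans yx.
  have ml (l : R -> R) : {within `]0, +oo[, continuous l} ->
      measurable_fun (Y @^-1` A) (fun w => l (Y w)).
    move=> cl; apply: (@measurable_comp _ _ _ _ R R `]0, +oo[%classic l _ Y).
    - exact: measurable_itv.
    - by move=> _ [w Aw <-]; exact: sA.
    - by apply: subspace_continuous_measurable_fun => //; exact: measurable_itv.
    - exact: measurable_funTS.
  have il (l : R -> R) : {within `]0, +oo[, continuous l} ->
      (forall x, A x -> `|l y - l x| < e) ->
      P.-integrable (Y @^-1` A) (fun w => (l (Y w))%:E).
    move=> cl hl; apply: (@le_integrable _ _ _ _ _ mYA _ (EFin \o cst (`|l y| + e))).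
    - by apply/measurable_EFinP; exact: ml.
    - move=> w Aw /=; rewrite lee_fin (le_trans (bnd l _ (hl _ Aw)))// ler_norm//.
    - exact: finite_measure_integrable_cst.
  have i1 := il l1 c1 (fun x Ax => (near1 x Ax).1).
  have i2 := il l2 c2 (fun x Ax => (near1 x Ax).2).
  have eq12 : (\int[P]_(w in Y @^-1` A) (l1 (Y w))%:E =
      \int[P]_(w in Y @^-1` A) (l2 (Y w))%:E)%E.
    by have := h1 A mA sA; have := h2 A mA sA; rewrite setTI => -> ->.
  have z : (\int[P]_(w in Y @^-1` A) ((l1 (Y w))%:E - (l2 (Y w))%:E) = 0)%E.
    by rewrite integralB// eq12 subee// integrable_fin_num.
  have : (e%:E * P (Y @^-1` A) <= 0)%E.
    rewrite -z -integral_cst//; apply: ge0_le_integral => //.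
    + by move=> w _; rewrite lee_fin ltW.
    + by apply: emeasurable_funB; apply/measurable_EFinP; exact: ml.
    + by move=> w Aw; rewrite -EFinB lee_fin; exact: gap.
  apply/negP; rewrite -ltNge mule_gt0 ?lte_fin//; apply: pos => //.
  by rewrite gtrBl divr_gt0.
move=> v1 v2 y y0; apply/eqP; rewrite eq_le.
by rewrite (main k1 k2)// (main k2 k1).
Qed.

Lemma condE_definedP X Y k : measurable_fun setT Y ->
  (forall a b : R, 0 < a -> a < b -> (0 < P (Y @^-1` `]a, b]))%E) ->
  condE_version P setT X Y k ->
  condE_defined P setT X Y /\ forall u, 0 < u -> condE P setT X Y u = k u.
Proof.
move=> mY pos vk; have uniq := condE_version_unique mY pos.
split; first by split; [exists k|move=> k1 k2 h1 h2; exact: uniq h1 h2].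
move=> u u0; rewrite /condE; case: xgetP => [k' _ vk'|/(_ k)//].
exact: uniq vk' vk _ u0.
Qed.

End CondE.

Section ConditionalVersions.
Context {R : realType} dO {Omega : measurableType dO} (P : probability Omega R).
Implicit Types (X Y : Omega -> R) (k : R -> R).

Lemma measurable_within_comp Y k (A : set R) : measurable_fun setT Y ->
  {within `]0, +oo[, continuous k} -> measurable A -> A `<=` `]0, +oo[ ->
  measurable_fun (Y @^-1` A) (fun w => k (Y w)).
Proof.
move=> mY ck mA A0; apply: (@measurable_comp _ _ _ _ R R `]0, +oo[%classic k _ Y).
- exact: measurable_itv.
- by move=> _ [w Aw <-]; exact: A0.
- by apply: subspace_continuous_measurable_fun => //; exact: measurable_itv.
- exact: measurable_funTS.
Qed.

Lemma integral_preimage_ae (f g : Omega -> \bar R) Y Y' (A : set R) :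
  measurable A -> measurable_fun setT Y -> measurable_fun setT Y' ->
  measurable_fun (Y @^-1` A) f -> measurable_fun (Y' @^-1` A) g ->
  {ae P, forall w, f w = g w /\ Y w = Y' w} ->
  (\int[P]_(w in Y @^-1` A) f w = \int[P]_(w in Y' @^-1` A) g w)%E.
Proof.
move=> mA mY mY' mf mg fg.
have mYA : measurable (Y @^-1` A) by rewrite -[X in measurable X]setTI; exact: mY.
have mYA' : measurable (Y' @^-1` A) by rewrite -[X in measurable X]setTI; exact: mY'.
rewrite integral_mkcond [in RHS]integral_mkcond.
apply: ae_eq_integral => //.
- exact: (measurable_restrictT f mYA).1.
- exact: (measurable_restrictT g mYA').1.
apply: filterS fg => w [fgw YY] _; rewrite !patchE fgw.
suff -> : (w \in Y @^-1` A) = (w \in Y' @^-1` A) by [].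
by apply/idP/idP => /set_mem h; apply/mem_set; move: h; rewrite /preimage/= YY.
Qed.

(** Bridges the processes that start at 0 everywhere and those of the statement, which do so almost
    surely. *)
Lemma condE_version_ae X X' Y Y' k :
  measurable_fun setT X' -> measurable_fun setT Y -> measurable_fun setT Y' ->
  {ae P, forall w, X w = X' w /\ Y w = Y' w} ->
  condE_version P setT X Y k -> condE_version P setT X' Y' k.
Proof.
move=> mX' mY mY' XX [iX ck h].
have mX : measurable_fun setT X by apply/measurable_EFinP; exact: measurable_int iX.
split => //.
- apply/integrableP; split; first exact/measurable_EFinP.
  move/integrableP: iX => [_]; apply: le_lt_trans.
  rewrite (@ae_eq_integral _ _ _ _ _ (fun w => `|(X w)%:E|)%E)//.
  + by apply/measurable_EFinP; exact: measurableT_comp.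
  + by apply/measurable_EFinP; exact: measurableT_comp.
  + by apply: filterS XX => w [-> _].
- move=> A mA A0; have := h A mA A0; rewrite !setTI => e.
  have YA (f : R -> R) : {within `]0, +oo[, continuous f} -> 
    (\int[P]_(w in Y @^-1` A) (f (Y w))%:E = \int[P]_(w in Y' @^-1` A) (f (Y' w))%:E)%E.
    move=> cf; apply: integral_preimage_ae => //.
    + by apply/measurable_EFinP; exact: measurable_within_comp.
    + by apply/measurable_EFinP; exact: measurable_within_comp.
    + by apply: filterS XX => w [_ ->].
  rewrite -YA// -e; apply/esym; apply: integral_preimage_ae => //.
  + by apply/measurable_EFinP; exact: measurable_funTS.
  + by apply/measurable_EFinP; exact: measurable_funTS.
  + by apply: filterS XX => w [-> ->].
Qed.

(** [Z] is signed: its positive and negative parts define two measures that are finite and equal on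
    intervals, hence equal on Borel sets. *)
Lemma integral_pos_itv_eq0 (Z Y : Omega -> R) :
  P.-integrable setT (EFin \o Z) -> measurable_fun setT Y ->
  (forall a b : R, 0 < a -> a < b -> \int[P]_(w in Y @^-1` `]a, b]) Z w = 0) ->
  forall A : set R, measurable A -> A `<=` `]0, +oo[ ->
    (\int[P]_(w in Y @^-1` A) (Z w)%:E = 0)%E.
Proof.
move=> iZ mY Z0 A mA A0.
have mZ : measurable_fun setT Z by apply/measurable_EFinP; exact: measurable_int iZ.
have mYA (C : set R) : measurable C -> measurable (Y @^-1` C).
  by move=> mC; rewrite -[X in measurable X]setTI; exact: mY.
pose Zp w := Num.max (Z w) 0; pose Zn w := Num.max (- Z w) 0.
have ZE w : Z w = Zp w - Zn w.
  by rewrite /Zp /Zn; have [z0|z0] := leP (Z w) 0;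
    [rewrite max_l ?oppr_ge0|rewrite max_r ?oppr_le0 1?ltW]; lra.
have mZp : measurable_fun setT Zp by exact: measurable_maxr.
have mZn : measurable_fun setT Zn by apply: measurable_maxr => //; exact: measurableT_comp.
have Zp0 w : 0 <= Zp w by rewrite /Zp le_max lexx orbT.
have Zn0 w : 0 <= Zn w by rewrite /Zn le_max lexx orbT.
have iZp : P.-integrable setT (EFin \o Zp).
  apply: (le_integrable measurableT _ _ iZ); first exact/measurable_EFinP.
  move=> w _ /=; rewrite lee_fin ger0_norm// /Zp.
  by have [z0|z0] := leP (Z w) 0; rewrite ?normr_ge0 ?ler_norm.
have iZn : P.-integrable setT (EFin \o Zn).
  apply: (le_integrable measurableT _ _ iZ); first exact/measurable_EFinP.
  move=> w _ /=; rewrite lee_fin ger0_norm// /Zn -normrN.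
  by have [z0|z0] := leP (- Z w) 0; rewrite ?normr_ge0 ?ler_norm.
have split (C : set R) : measurable C ->
    (\int[P]_(w in Y @^-1` C) (Z w)%:E = ge0_law P Zp Y C - ge0_law P Zn Y C)%E.
  move=> mC; rewrite /ge0_law -(integralB (mYA _ mC)).
  - by apply: eq_integral => w _; rewrite ZE EFinB.
  - exact: (integrableS measurableT (mYA _ mC) _ iZp).
  - exact: (integrableS measurableT (mYA _ mC) _ iZn).
have fin (V : Omega -> R) (C : set R) : P.-integrable setT (EFin \o V) -> measurable C ->
    ge0_law P V Y C \is a fin_num.
  by move=> iV mC; apply: integrable_fin_num; [exact: mYA|exact: (integrableS measurableT (mYA _ mC) _ iV)].
rewrite split// (@ge0_law_unique _ _ _ _ R P P Zp Y Zn Y)//.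
- by rewrite subee// fin.
- move=> a b a0 ab; have mab : measurable (`]a, b] : set R) by exact: measurable_itv.
  have fp := fin _ _ iZp mab; have fn := fin _ _ iZn mab.
  rewrite -(fineK fp) -(fineK fn); congr EFin; apply/eqP.
  by rewrite -subr_eq0 -fineB// -split//; apply/eqP; exact: Z0.
- move=> a b a0 ab; rewrite -ge0_fin_numE; first exact: (fin _ _ iZp (measurable_itv _)).
  by apply: integral_ge0 => w _; rewrite lee_fin.
Qed.

End ConditionalVersions.

Definition argmax_given_max (R : realType) (T v mu u : R) : R :=
  max_tail_drift T v mu u / max_dens T v mu u.

Section GivenMax.
Context {R : realType} dO {Omega : measurableType dO} (P : probability Omega R).
Variables (d : nat) (Sigma : 'M[R]_d) (B : 'I_d -> R -> Omega -> R).
Hypothesis hB : brownian_motion P Sigma B.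
Variable T : R.
Hypothesis T0 : 0 < T.
Variables (o : 'rV[R]_d) (r : R).
Let v := quad_form Sigma o.
Hypothesis v0 : 0 < v.

Let X := lin_proc B o r.
Let tau := argmax_time X T.
Let M := lin_max B T o r.
Let k := argmax_given_max T v r.

Let mM : measurable_fun setT M. Proof. exact: (measurable_lin_max hB T0). Qed.

Let mMset (A : set R) : measurable A -> measurable (M @^-1` A).
Proof. by move=> mA; rewrite -[X in measurable X]setTI; exact: mM. Qed.

Let mtau : measurable_fun setT (fun w => fine (tau w)).
Proof. exact: (measurable_argmax_lin hB T0). Qed.

Let tauT w : fine (tau w) \in `[0, T].
Proof. exact: (argmax_lin_itv hB T0). Qed.

Let tau0 w : 0 <= fine (tau w).
Proof. by have := tauT w; rewrite in_itv/= => /andP[]. Qed.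

Lemma max_dens_lin_gt0 u : 0 < u -> 0 < max_dens T v r u.
Proof.
move=> u0; rewrite /max_dens mulr_gt0//; last exact: (max_dens_factor_lin_gt0 hB T0).
by rewrite mulr_gt0 ?expR_gt0// divr_gt0.
Qed.

(** Truncated to ]0, +oo[, where [max_dens] is known to be positive, so as to be nonnegative
    everywhere. *)
Let f u := max_dens T v r u * \1_`]0, +oo[%classic u.

Let f0 u : 0 <= f u.
Proof.
rewrite /f indicE; case: (boolP (u \in _)) => [/set_mem|_]; last by rewrite mulr0.
by rewrite /= in_itv/= andbT mulr1 => /max_dens_lin_gt0/ltW.
Qed.

Let mf : measurable_fun setT f.
Proof.
apply: measurable_funM; last by apply: measurable_indic; exact: measurable_itv.
by apply: continuous_measurable_fun; exact: (continuous_max_dens T0 v0).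
Qed.

Let fE (a b u : R) : 0 < a -> u \in `]a, b] -> f u = max_dens T v r u.
Proof.
move=> a0; rewrite in_itv/= => /andP[au _].
by rewrite /f indicE mem_set ?mulr1//= in_itv/= andbT (lt_trans a0).
Qed.

Lemma measure_lin_max_dens (a b : R) : 0 < a -> a < b ->
  P (M @^-1` `]a, b]) = (\int[lebesgue_measure]_(x in `]a, b]) (max_dens T v r x)%:E)%E.
Proof.
move=> a0 ab; rewrite (measure_lin_max_itv hB T0 r v0)//.
have mh : measurable_fun setT (EFin \o max_dens T v r).
  apply/measurable_EFinP; apply: continuous_measurable_fun.
  exact: (continuous_max_dens T0 v0).
rewrite integral_itv_obnd_cbnd; last exact: measurable_funTS.
have dF (u : R) : is_derive u 1 (fun u => - max_tail T v r u) (max_dens T v r u).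
  have := is_derive_max_tail T0 v0 r u => h.
  by apply: is_derive_eq; rewrite opprK.
rewrite (@continuous_FTC2 _ _ (fun u => - max_tail T v r u))//.
- by rewrite -EFinB opprK addrC.
- by apply: continuous_subspaceT; exact: (continuous_max_dens T0 v0).
- have cF : continuous (fun u => - max_tail T v r u).
    by move=> u; apply: cvgN; exact: (continuous_max_tail T0 v0).
  split.
  + by move=> u _; have [] := dF u.
  + exact/cvg_at_right_filter/cF.
  + exact/cvg_at_left_filter/cF.
- by move=> u _; rewrite derive1E; have [] := dF u.
Qed.

Let lawf (a b : R) : 0 < a -> a < b ->
  P (M @^-1` `]a, b]) = (\int[lebesgue_measure]_(x in `]a, b]) (f x)%:E)%E.
Proof.
move=> a0 ab; rewrite measure_lin_max_dens//; apply: eq_integral => x /set_mem xab.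
by rewrite (fE a0 xab).
Qed.

Lemma measure_lin_max_itv_gt0 (a b : R) : 0 < a -> a < b -> (0 < P (M @^-1` `]a, b]))%E.
Proof.
move=> a0 ab; rewrite (measure_lin_max_itv hB T0 r v0)// lte_fin subr_gt0.
have [||c cab] := @MVT _ (max_tail T v r) (fun y => - max_dens T v r y) _ _ ab.
- by move=> y _; exact: (is_derive_max_tail T0 v0).
- by apply: continuous_subspaceT; exact: (continuous_max_tail T0 v0).
move=> e; rewrite -subr_lt0 e mulNr oppr_lt0 mulr_gt0 ?subr_gt0//.
by apply: max_dens_lin_gt0; move: cab; rewrite in_itv/= => /andP[ac _]; exact: lt_trans ac.
Qed.

Lemma continuous_argmax_given_max :
  {within `]0, +oo[, continuous k}.
Proof.
rewrite continuous_open_subspace; last exact: interval_open.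
move=> u /set_mem/=; rewrite in_itv/= andbT => u0.
have cd := @continuous_max_dens _ _ _ T0 v0 r u.
have cg := @continuous_max_tail_drift R T v r u.
by apply: (cvgM cg); apply: cvgV => //; rewrite gt_eqF// max_dens_lin_gt0.
Qed.

(** The same truncation, [ge0_law_unique] asking for nonnegativity at every [w]. *)
Let kM w := k (M w) * \1_`]0, +oo[%classic (M w).

Let k_ge0 u : 0 < u -> 0 <= k u.
Proof.
move=> u0; rewrite /k /argmax_given_max divr_ge0//; last exact/ltW/max_dens_lin_gt0.
rewrite /max_tail_drift mulr_ge0 ?Phi_ge0// mulr_ge0 ?expR_ge0//.
by apply: divr_ge0; [apply: mulr_ge0 => //|]; exact: ltW.
Qed.

Let kM0 w : 0 <= kM w.
Proof.
rewrite /kM indicE; case: (boolP (M w \in _)) => [/set_mem|_]; last by rewrite mulr0.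
by rewrite /= in_itv/= andbT mulr1 => /k_ge0.
Qed.

Let kME (A : set R) w : A `<=` `]0, +oo[ -> A (M w) -> kM w = k (M w).
Proof. by move=> A0 /A0 Mw; rewrite /kM indicE mem_set// mulr1. Qed.

Let mkM : measurable_fun setT kM.
Proof.
pose g u := k u * \1_`]0, +oo[%classic u.
have mg : measurable_fun setT g.
  have -> : g = k \_ `]0, +oo[.
    apply/funext => u; rewrite /g patchE indicE.
    by case: (u \in _); rewrite ?mulr1 ?mulr0.
  apply/(measurable_restrictT k (measurable_itv _)).
  apply: subspace_continuous_measurable_fun; first exact: measurable_itv.
  exact: continuous_argmax_given_max.
exact: (measurableT_comp mg mM).
Qed.

Let mitv a b : measurable (`]a, b] : set R). Proof. exact: measurable_itv. Qed.

Let taui (A : set Omega) : measurable A ->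
  P.-integrable A (EFin \o (fun w => fine (tau w))).
Proof.
move=> mA; apply: (@le_integrable _ _ _ _ _ mA _ (EFin \o cst T)).
- by apply/measurable_EFinP; exact: measurable_funTS.
- move=> w _ /=; have := tauT w; rewrite in_itv/= => /andP[t0 tT].
  by rewrite lee_fin !ger0_norm// ltW.
- exact: finite_measure_integrable_cst.
Qed.

(** [drift_integral] yields the integral of [max_tail_drift], which is [k] times the density; the
    law of [M] turns it into an expectation of k(M). *)
Let law_eq_itv (a b : R) : 0 < a -> a < b ->
  ge0_law P (fun w => fine (tau w)) M `]a, b]%classic = ge0_law P kM M `]a, b]%classic.
Proof.
move=> a0 ab.
have sab : (`]a, b] : set R) `<=` `]0, +oo[.
  by move=> x /=; rewrite !in_itv/= andbT => /andP[ax _]; exact: lt_trans ax.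
have := drift_integral hB T0 r v0 a0 ab; rewrite -/M -/tau -/X => e.
have -> : ge0_law P (fun w => fine (tau w)) M `]a, b]%classic =
    (\int[lebesgue_measure]_(y in `]a, b]) (max_tail_drift T v r y)%:E)%E.
  have mg : measurable_fun setT (EFin \o max_tail_drift T v r).
    apply/measurable_EFinP; apply: continuous_measurable_fun.
    exact: (@continuous_max_tail_drift R T v r).
  rewrite integral_itv_obnd_cbnd; last exact: measurable_funTS.
  have gi : lebesgue_measure.-integrable `[a, b] (EFin \o max_tail_drift T v r).
    apply: continuous_compact_integrable; first exact: segment_compact.
    by apply: continuous_subspaceT; exact: (@continuous_max_tail_drift R T v r).
  rewrite /ge0_law -[LHS]fineK; last first.
    by apply: integrable_fin_num; [exact: mMset|exact: taui (mMset _)].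
  rewrite -[RHS]fineK; last by apply: integrable_fin_num => //; exact: measurable_itv.
  by congr EFin; exact: e.
transitivity (\int[P]_(w in M @^-1` `]a, b]) (k (M w))%:E)%E; last first.
  apply: eq_integral => w /set_mem Mw; congr EFin; apply/esym; exact: (kME sab Mw).
rewrite (@ge0_integral_law_density _ _ _ P M f a b (EFin \o k))//.
- apply: eq_integral => x /set_mem xab; rewrite (fE a0 xab)/= -EFinM; congr EFin.
  rewrite /k /argmax_given_max divfK// gt_eqF// max_dens_lin_gt0//.
  by have := sab _ xab; rewrite /= in_itv/= andbT.
- apply/measurable_EFinP.
  apply: (@measurable_funS _ _ R R `]0, +oo[%classic) => //.
  apply: subspace_continuous_measurable_fun; first exact: measurable_itv.
  exact: continuous_argmax_given_max.
- move=> x xab; rewrite lee_fin k_ge0//.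
  by have := sab _ xab; rewrite /= in_itv/= andbT.
Qed.

Let law_eq (A : set R) : measurable A -> A `<=` `]0, +oo[ ->
  (\int[P]_(w in M @^-1` A) (fine (tau w))%:E = \int[P]_(w in M @^-1` A) (k (M w))%:E)%E.
Proof.
move=> mA A0; transitivity (ge0_law P kM M A); last first.
  by apply: eq_integral => w /set_mem Mw; congr EFin; exact: (kME A0 Mw).
apply: ge0_law_unique => //.
move=> a b a0 ab; rewrite -ge0_fin_numE; last first.
  by apply: integral_ge0 => w _; rewrite lee_fin.
by apply: integrable_fin_num; [exact: mMset|exact: taui (mMset _)].
Qed.

Let ki (A : set R) : measurable A -> A `<=` `]0, +oo[ ->
  P.-integrable (M @^-1` A) (fun w => (k (M w))%:E).
Proof.
move=> mA A0; apply/integrableP; split.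
  apply/measurable_EFinP; apply: measurable_within_comp => //.
  exact: continuous_argmax_given_max.
rewrite (eq_integral (fun w => (k (M w))%:E)); last first.
  move=> w /set_mem Mw /=; rewrite ger0_norm// k_ge0//.
  by have := A0 _ Mw; rewrite /= in_itv/= andbT.
rewrite -law_eq// -ge0_fin_numE; last by apply: integral_ge0 => w _; rewrite lee_fin.
by apply: integrable_fin_num; [exact: mMset|exact: taui (mMset _)].
Qed.

Lemma argmax_version : condE_version P setT (fun w => fine (tau w)) M k.
Proof.
split; [exact: taui|exact: continuous_argmax_given_max|].
by move=> A mA A0; rewrite setTI; exact: law_eq.
Qed.

Lemma lin_max_version (z : 'rV[R]_d) (c beta : R) :
  (o *m Sigma *m z^T) 0 0 = 0 ->
  condE_version P setT
    (fun w => c * fine (tau w) + beta * M w + at_time (lin_proc B z 0) tau w) M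
    (fun u => c * k u + beta * u).
Proof.
move=> oz.
pose Z := at_time (lin_proc B z 0) tau.
have iZ : P.-integrable setT (EFin \o Z) by exact: (integrable_lin_at hB T0 mtau tauT v0 oz).
(* [M] is the driftless process at [tau] plus [r] times [tau]. *)
have iM : P.-integrable setT (EFin \o M).
  have := integrableD measurableT (integrable_lin_at_gt0 hB T0 mtau tauT v0)
    (integrableZl measurableT r (taui measurableT)).
  apply: eq_integrable => // w _ /=.
  have := lin_proc_drift B o 0 r (fine (tau w)) w; rewrite add0r => e.
  by rewrite -EFinM -EFinD; congr EFin; exact/esym/e.
have i1 (D : set Omega) : measurable D ->
    P.-integrable D (fun w => (c * fine (tau w) + beta * M w + Z w)%:E).
  move=> mD; have := integrableD mD (integrableD mD (integrableZl mD c (taui mD))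
    (integrableZl mD beta (integrableS measurableT mD (@subsetT _ D) iM)))
    (integrableS measurableT mD (@subsetT _ D) iZ).
  exact: eq_integrable.
split; first exact: i1.
- have ck := continuous_argmax_given_max.
  move=> u; apply: cvgD; first by apply: cvgM; [exact: cvg_cst|exact: ck].
  apply: cvgM; first exact: cvg_cst.
  by apply: continuous_subspaceT => ?; exact: cvg_id.
- move=> A mA A0; rewrite !setTI.
  have mD := mMset mA.
  have iM' := integrableZl mD beta (integrableS measurableT mD (@subsetT _ _) iM).
  have iZ' := integrableS measurableT mD (@subsetT _ _) iZ.
  have it' := integrableZl mD c (taui mD).
  have ik' := integrableZl mD c (ki mA A0).
  transitivity (c%:E * \int[P]_(w in M @^-1` A) (fine (tau w))%:E +
     \int[P]_(w in M @^-1` A) (beta%:E * (M w)%:E))%E.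
    rewrite -integralZl ?taui//.
    (* The zero added is the integral of [Z] over the event, by orthogonality. *)
    rewrite -(integralD mD it' iM') -[RHS]adde0.
    rewrite -(@integral_pos_itv_eq0 _ _ _ P Z M iZ mM _ A mA A0).
      rewrite -(integralD mD (integrableD mD it' iM') iZ').
      by apply: eq_integral => w _ /=; rewrite !EFinD !EFinM.
    by move=> a b a0 ab; exact: (orthogonal_integral hB T0 r v0 a0 ab oz).
  rewrite law_eq// -integralZl ?ki// -(integralD mD ik' iM').
  by apply: eq_integral => w _ /=; rewrite !EFinD !EFinM.
Qed.

End GivenMax.

(** * The aggregate process and its allocation *)

Lemma argmax_time_shift (R : realType) (Omega : Type) (X Y : R -> Omega -> R)
    (T c : R) (w : Omega) : 0 <= T ->
  {within `[0, T], continuous (fun t => X t w)} ->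
  (forall t, Y t w = X t w + c) ->
  argmax_time Y T w = argmax_time X T w.
Proof.
move=> T0 cX YE.
have cY : {within `[0, T], continuous (fun t => Y t w)}.
  rewrite (_ : (fun t => Y t w) = (fun t => X t w + c)); last exact/funext.
  by move=> t; apply: cvgD; [exact: cX|exact: cvg_cst].
have [t [-> tT maxt mint]] := argmax_timeP T0 cX.
have [s [-> sT maxs mins]] := argmax_timeP T0 cY.
have XsXt : X s w = X t w.
  apply/eqP; rewrite eq_le maxt//=; have := maxs _ tT.
  by rewrite !YE lerD2r.
congr EFin; apply/eqP; rewrite eq_le mint// mins// !YE ?XsXt//.
Qed.

Lemma quad_form_const1 (R : realType) d (C : 'M[R]_d) :
  quad_form C (const_mx 1) = \sum_(j < d) \sum_(k < d) C j k.
Proof.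
rewrite /quad_form mxE exchange_big; apply: eq_bigr => k _ /=.
by rewrite !mxE mulr1; apply: eq_bigr => j _; rewrite !mxE mul1r.
Qed.

Lemma argmax_given_maxE (R : realType) (T v r u : R) : 0 < T -> 0 < v ->
  argmax_given_max T v r u =
  u * (- r + Num.sqrt v * expR (- ((u + r * T) ^+ 2 / (2 * v * T)))
             / (Num.sqrt (2 * pi * T)
                * Phi ((- u - r * T) / (Num.sqrt v * Num.sqrt T))))^-1.
Proof.
move=> T0 v0; have s0 : 0 < Num.sqrt v by rewrite sqrtr_gt0.
have t0 : 0 < Num.sqrt T by rewrite sqrtr_gt0.
have vE : v = Num.sqrt v ^+ 2 by rewrite sqr_sqrtr// ltW.
have TE : T = Num.sqrt T ^+ 2 by rewrite sqr_sqrtr// ltW.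
rewrite /argmax_given_max /max_tail_drift /max_dens /max_dens_factor.
rewrite !sqrtrM ?(ltW v0) ?mulr_ge0 ?pi_ge0// normal_pdf01E.
set s := Num.sqrt v in s0 vE *; set t := Num.sqrt T in t0 TE *.
set z := (- u - r * T) / (s * t).
have -> : expR (- (z ^+ 2 / 2)) = expR (- ((u + r * T) ^+ 2 / (2 * v * T))).
  congr expR; rewrite /z vE TE; field; rewrite !gt_eqF//.
set E := expR (- _); have Ph := Phi_gt0 z; move: (Phi z) Ph => Ph Ph0.
have ex0 := expR_gt0 (2 * r / v * u); move: (expR (2 * r / v * u)) ex0 => ex ex0.
set Q := (X in _ = u * X^-1).
(* The common factor of numerator and denominator: they are c u and c Q. *)
pose c := 2 / v * ex * Ph.
have c0 : c != 0 by rewrite gt_eqF// !mulr_gt0// invr_gt0.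
have -> : 2 * u / v * ex * Ph = c * u by rewrite /c; ring.
set D := 2 / v * ex * _; have -> : D = c * Q; last by rewrite -mulf_div divff// mul1r.
rewrite /D /c /Q sqrtrM ?mulr_ge0 ?pi_ge0//.
by rewrite vE; field; rewrite !gt_eqF// sqrtr_gt0 pi_gt0.
Qed.

Theorem theorem5 (R : realType) (dO : measure_display)
    (Omega : measurableType dO) (P : probability Omega R)
    (d : nat) (hd : (2 <= d)%N)
    (Sigma : 'M[R]_d) (B : 'I_d -> R -> Omega -> R)
    (hB : brownian_motion P Sigma B)
    (r_ : 'I_d -> R) (T u : R)
    (hSigma : 0 < \sum_(i < d) \sum_(j < d) Sigma i j)
    (hT : 0 < T) (hu : 0 < u) (i : 'I_d) :
  let Si := drifted r_ B in
  let S := aggregate Si in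
  let r := \sum_(j < d) r_ j in
  let sigma2 := \sum_(j < d) \sum_(k < d) Sigma j k in
  let sigma := Num.sqrt sigma2 in
  let beta := (\sum_(j < d) Sigma i j) / sigma2 in
  let tstar := argmax_time S T in
  let M := at_time S tstar in
  let Sit := at_time (Si i) tstar in
  let t_ := fun w => fine (tstar w) in
  [/\ condE_defined P (attained_by tstar T) Sit M,
      condE_defined P setT Sit M &
      condE_defined P setT t_ M] /\
  [/\ allocation P Si T u i = condE P setT Sit M u,
      condE P setT Sit M u
        = condE P setT t_ M u * (r_ i - beta * r) + beta * u &
      condE P setT t_ M u
        = u * (- r + sigma * expR (- ((u + r * T) ^+ 2 / (2 * sigma2 * T)))
                     / (Num.sqrt (2 * pi * T)
                        * Phi ((- u - r * T) / (sigma * Num.sqrt T))))^-1].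
Proof.
move=> Si S r sigma2 sigma beta tstar M Sit t_.
pose o : 'rV[R]_d := const_mx 1.
have vE : quad_form Sigma o = sigma2 by exact: quad_form_const1.
have v0 : 0 < quad_form Sigma o by rewrite vE.
pose tau := argmax_time (lin_proc B o r) T.
pose M0 := lin_max B T o r.
(* [beta] is the regression coefficient of B_i on the sum of the components, which makes [z]
   orthogonal to [o] for [Sigma]. *)
pose z : 'rV[R]_d := delta_mx 0 i - beta *: o.
pose Z := at_time (lin_proc B z 0) tau.
have sym : Sigma^T = Sigma.
  have [_ _ _ _ /(_ 0 1 (lexx _) ler01)[[+ _] _]] := hB.
  by rewrite subr0 scale1r.
have oz : (o *m Sigma *m z^T) 0 0 = 0.
  transitivity ((o *m Sigma *m (delta_mx 0 i : 'rV[R]_d)^T) 0 0 - beta * quad_form Sigma o).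
    by rewrite /quad_form linearB linearZ/= mulmxBr -scalemxAr !mxE.
  rewrite vE divfK ?gt_eqF//; apply/eqP; rewrite subr_eq0; apply/eqP.
  rewrite trmx_delta -colE !mxE; apply: eq_bigr => j _.
  by rewrite mxE mul1r -[in LHS]sym mxE.
(* The aggregate differs from [lin_proc] by its initial value, constant in time: the first
   maximizers coincide on every path, the maxima almost surely. *)
have SE t w : S t w = lin_proc B o r t w + \sum_(j < d) B j 0 w.
  rewrite /S /aggregate /Si /drifted /lin_proc big_split/= -mulr_suml -addrA.
  congr (_ + _); rewrite -big_split/=; apply: eq_bigr => j _.
  by rewrite mxE mul1r subrK.
have tauE : tstar = tau.
  apply/funext => w; apply: argmax_time_shift; first exact: ltW.
    exact: (continuous_lin_proc hB).
  by move=> t; exact: SE.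
have ME w : M w = M0 w + \sum_(j < d) B j 0 w by rewrite /M tauE /at_time SE.
have ZE w : Z w = (B i (fine (tau w)) w - B i 0 w) - beta * (M0 w - r * fine (tau w)).
  have -> : M0 w - r * fine (tau w) = \sum_j (B j (fine (tau w)) w - B j 0 w).
    rewrite /M0 /lin_max /at_time -/tau /lin_proc addrAC subrr add0r.
    by apply: eq_bigr => j _; rewrite mxE mul1r.
  rewrite /Z /at_time /lin_proc mul0r add0r mulr_sumr.
  rewrite (bigD1 i)//= [in RHS](bigD1 i)//= !mxE !eqxx mulr1 mulrBl mul1r opprD addrA.
  congr (_ + _); rewrite -sumrN; apply: eq_bigr => j ji.
  by rewrite !mxE (negbTE ji) mulr1 sub0r mulNr.
have SitE w : Sit w = (r_ i - beta * r) * fine (tau w) + beta * M0 w + Z w + B i 0 w.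
  by rewrite /Sit tauE /at_time /Si /drifted ZE; ring.
have mB0 j : measurable_fun setT (B j 0) by have [mB _ _ _ _] := hB; exact: mB.
have mM0 : measurable_fun setT M0 by exact: (measurable_lin_max hB hT).
have mtau : measurable_fun setT (fun w => fine (tau w)).
  exact: (measurable_argmax_lin hB hT).
have tauT w : fine (tau w) \in `[0, T] by exact: (argmax_lin_itv hB hT).
have mM : measurable_fun setT M.
  rewrite (_ : M = fun w => M0 w + \sum_(j < d) B j 0 w); last exact/funext.
  by apply: measurable_funD => //; exact: measurable_sum.
have mSit : measurable_fun setT Sit.
  rewrite (_ : Sit = fun w => (r_ i - beta * r) * fine (tau w) + beta * M0 w + Z w + B i 0 w);
    last exact/funext.
  apply: measurable_funD => //; apply: measurable_funD; last first.
    exact: (measurable_lin_at hB hT).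
  by apply: measurable_funD; apply: measurable_funM.
have B0 : {ae P, forall w, forall j, B j 0 w = 0} by have [_ + _ _ _] := hB.
have MM0 w : (forall j, B j 0 w = 0) -> M0 w = M w.
  by move=> Bw; rewrite ME big1 ?addr0// => j _; exact: Bw.
have vt : condE_version P setT t_ M (argmax_given_max T (quad_form Sigma o) r).
  apply: (condE_version_ae _ mM0 mM _ (argmax_version hB hT r v0)).
    by rewrite /t_ tauE.
  by apply: filterS B0 => w /MM0 ->; rewrite /t_ tauE.
have vS := lin_max_version hB hT r v0 (r_ i - beta * r) beta oz.
have {}vS := condE_version_ae mSit mM0 mM _ vS.
have {}vS : condE_version P setT Sit M (fun u =>
    (r_ i - beta * r) * argmax_given_max T (quad_form Sigma o) r u + beta * u).
  by apply: vS; apply: filterS B0 => w Bw; split; [rewrite SitE Bw addr0|exact: MM0].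
have pos a b : 0 < a -> a < b -> (0 < P (M @^-1` `]a, b]))%E.
  move=> a0 ab; have := measure_lin_max_itv_gt0 hB hT r v0 a0 ab.
  have mitv : measurable (`]a, b] : set R) by exact: measurable_itv.
  have := @integral_preimage_ae _ _ _ P (cst 1%E) (cst 1%E) M0 M _ mitv mM0 mM.
  have m1 : measurable (M0 @^-1` `]a, b]).
    by rewrite -[X in measurable X]setTI; exact: mM0.
  have m2 : measurable (M @^-1` `]a, b]) by rewrite -[X in measurable X]setTI; exact: mM.
  rewrite (integral_cst P m1) (integral_cst P m2) !mul1e => -> //.
  by apply: filterS B0 => w /MM0 ->.
have [dt ct] := condE_definedP mM pos vt.
have [dS cS] := condE_definedP mM pos vS.
(* A continuous path attains its supremum, so the event in the allocation is the whole space. *)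
have att : attained_by tstar T = setT.
  apply/seteqP; split => // w _; rewrite /attained_by/= tauE.
  have [t [tE + _ _]] := argmax_timeP (ltW hT) (@continuous_lin_proc _ _ _ _ _ _ _ hB o r T w).
  by rewrite in_itv/= => /andP[_ tT]; rewrite /tau tE lee_fin.
split; first by rewrite att.
split.
- by rewrite /allocation -/S -/tstar att.
- by rewrite cS// ct// mulrC.
- by rewrite ct// vE argmax_given_maxE.
Qed.
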